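(* Take an $M\times N$ unit norm frame $F$ which satisfies the Strong Coherence Property, pick $t\in(0,1)$, and choose $$\lambda=\sqrt{2\sigma^2\log N}\,\max\Big\{\tfrac{10}{t}\mu_F\sqrt{M\,\mathsf{snr}},\ \tfrac{\sqrt2}{1-t}\Big\}.$$ Further, suppose $x\in\mathbb{C}^N$ has support $\mathcal{K}$ drawn uniformly at random from all possible $K$-subsets of $\{1,\ldots,N\}$. Let $y=Fx+e$, where the entries of the noise vector $e\in\mathbb{C}^M$ are independent, identically distributed complex-Gaussian random variables with mean zero and variance $\sigma^2$. Then provided $$K\leq\frac{N}{c_1^2\|F\|_2^2\log N},$$ the One-Step Thresholding algorithm with input $(F,y,\lambda)$ produces $\hat{\mathcal{K}}$ such that $$\mathcal{T}_\sigma(t)\cap\mathcal{T}_\mu(t)\subseteq\hat{\mathcal{K}}\subseteq\mathcal{K}$$ and $\hat x$ such that $$\|x-\hat x\|\leq c_2\sqrt{\sigma^2|\hat{\mathcal{K}}|\log N}+c_3\|x_{\mathcal{K}\setminus\hat{\mathcal{K}}}\|$$ with probability exceeding $1-10N^{-1}$. Finally, defining $T:=|\mathcal{T}_\sigma(t)\cap\mathcal{T}_\mu(t)|$, we further have $$\|x-\hat x\|\leq c_2\sqrt{\sigma^2K\log N}+c_3\|x-x_T\|$$ in the same probability event. Here $c_1=37\mathrm{e}$, $c_2=\frac{2}{1-\mathrm{e}^{-1/2}}$, and $c_3=1+\frac{\mathrm{e}^{-1/2}}{1-\mathrm{e}^{-1/2}}$ are numerical constants.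
   Context: $\log$ is the natural logarithm, $\|\cdot\|$ on vectors is the Euclidean norm, and $\|F\|_2$ is the spectral norm. An $M\times N$ unit norm frame is an $M\times N$ (real or complex) matrix of rank $M$ whose columns $f_1,\ldots,f_N$ have Euclidean norm $1$. The worst-case coherence is $\mu_F:=\max_{i\neq j}|\langle f_i,f_j\rangle|$ and the average coherence is $\nu_F:=\frac{1}{N-1}\max_{i\in\{1,\ldots,N\}}\big|\sum_{j\neq i}\langle f_i,f_j\rangle\big|$, where $i,j$ range over $\{1,\ldots,N\}$. Strong Coherence Property: an $M\times N$ unit norm frame $F$ satisfies it if $\mu_F\leq\frac{1}{164\log N}$ and $\nu_F\leq\frac{\mu_F}{\sqrt{M}}$. The signal-to-noise ratio is $\mathsf{snr}:=\|x\|^2/\mathbb{E}[\|e\|^2]$. For $t\in(0,1)$, define $\mathcal{T}_\sigma(t):=\{n:|x_n|>\frac{2\sqrt2}{1-t}\sqrt{2\sigma^2\log N}\}$ and $\mathcal{T}_\mu(t):=\{n:|x_n|>\frac{20}{t}\mu_F\|x\|\sqrt{2\log N}\}$. For an index set $S$, $x_S$ is the restriction of $x$ to the entries indexed by $S$; for the integer $T$, $x_T$ denotes the best $T$-term approximation of $x$ (keep $T$ entries of largest magnitude and set the others to zero). One-Step Thresholding algorithm: the input is an $M\times N$ unit norm frame $F$, a vector $y=Fx+e\in\mathbb{C}^M$, and a threshold $\lambda>0$. Form $z:=F^*y\in\mathbb{C}^N$; set $\hat{\mathcal{K}}:=\{n:|z_n|>\lambda\}$; let $\hat x\in\mathbb{C}^N$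 be the vector that is zero outside $\hat{\mathcal{K}}$ and whose restriction to $\hat{\mathcal{K}}$ is $(F_{\hat{\mathcal{K}}})^\dagger y$, where $F_{\hat{\mathcal{K}}}$ is the submatrix of columns of $F$ indexed by $\hat{\mathcal{K}}$ and $\dagger$ is the Moore–Penrose pseudoinverse. Output $\hat{\mathcal{K}}$ (an estimate of the support of $x$) and $\hat x$ (an estimate of $x$).
   Formalization: The nonzero values of x are fixed in advance and placed by a uniformly random permutation of the indices, independent of the noise; if the values may depend on the random support, the claim fails, since phases can align with a column of F. *)

(* Defs.v *)
From HB Require Import structures.
From mathcomp Require Import all_boot all_order all_algebra perm.
From mathcomp Require Import complex.
From mathcomp Require Import all_classical all_reals all_analysis.

Set Implicit Arguments.
Unset Strict Implicit.
Unset Printing Implicit Defensive.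

Import Order.TTheory GRing.Theory Num.Theory.
Import numFieldNormedType.Exports.
Import ComplexField.Normc.

Local Open Scope classical_set_scope.
Local Open Scope ring_scope.
Local Open Scope sesquilinear_scope.

Section Vectors.
Variable R : realType.
Implicit Types (m n k : nat).

(* [normc] is the complex modulus with values in R, whereas [`|z|] lives in
   R[i]. *)
Definition l2norm n (v : 'cV[R[i]]_n) : R :=
  Num.sqrt (\sum_i normc (v i 0) ^+ 2).

Definition inner n (u v : 'cV[R[i]]_n) : R[i] := \sum_i u i 0 * (v i 0)^*.

Definition supp n (x : 'cV[R[i]]_n) : {set 'I_n} := [set i | x i 0 != 0].

(* The restriction x_S is represented by the vector of the same length that
   agrees with x on S and vanishes off S. *)
Definition restrict n (S : {set 'I_n}) (x : 'cV[R[i]]_n) : 'cV[R[i]]_n :=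
  \col_i (if i \in S then x i 0 else 0).

(* Ties in magnitude are broken by the index order. *)
Definition largest_entries n k (x : 'cV[R[i]]_n) : {set 'I_n} :=
  [set i in take k (sort (fun i j => normc (x j 0) <= normc (x i 0))
                         (enum 'I_n))]%SET.

Definition best_approx n k (x : 'cV[R[i]]_n) : 'cV[R[i]]_n :=
  restrict (largest_entries k x) x.

Definition spectral_norm m n (F : 'M[R[i]]_(m, n)) : R :=
  sup [set l2norm (F *m v) | v in [set v : 'cV[R[i]]_n | l2norm v = 1]].

End Vectors.

Section PseudoInverse.
Variable C : numClosedFieldType.
Implicit Types m n : nat.

Definition is_mp_pinv m n (A : 'M[C]_(m, n)) (B : 'M[C]_(n, m)) : Prop :=
  [/\ A *m B *m A = A,
      B *m A *m B = B,
      (A *m B) ^t* = A *m B &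
      (B *m A) ^t* = B *m A].

(* Moore-Penrose pseudoinverse; not to be confused with the library's
   [pinvmx], which is a partial inverse without the Hermitian conditions.  The
   default value is never taken, by [mp_pinvP]. *)
Definition mp_pinv m n (A : 'M[C]_(m, n)) : 'M[C]_(n, m) :=
  xget 0 [set B | is_mp_pinv A B].

Lemma adjM m n k (A : 'M[C]_(m, n)) (B : 'M[C]_(n, k)) :
  (A *m B) ^t* = B ^t* *m A ^t*.
Proof. by rewrite trmx_mul map_mxM. Qed.

Lemma gram_unit m n (A : 'M[C]_(m, n)) :
  row_free A -> A *m A ^t* \in unitmx.
Proof.
move=> fA; rewrite -row_free_unit; apply: inj_row_free => v.
rewrite mulmxA => vAA.
apply: (row_free_inj fA); rewrite mul0mx; apply/rowP => j; rewrite [RHS]mxE.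
pose u := v *m A; rewrite -/u in vAA; rewrite -/u.
have : (u *m u ^t*) 0 0 = 0 by rewrite {2}/u adjM mulmxA vAA mul0mx mxE.
rewrite mxE => /eqP; rewrite psumr_eq0 => [/allP/(_ j)|k _]; last first.
  by rewrite !mxE -normCK exprn_ge0.
rewrite mem_index_enum => /(_ isT) /=; rewrite !mxE -normCK.
by rewrite expf_eq0 normr_eq0 => /eqP.
Qed.

Lemma is_mp_pinv_uniq m n (A : 'M[C]_(m, n)) (B D : 'M[C]_(n, m)) :
  is_mp_pinv A B -> is_mp_pinv A D -> B = D.
Proof.
move=> [ABA BAB hAB hBA] [ADA DAD hAD hDA].
have eAB : A *m B = A *m D.
  by rewrite -hAB -{1}ADA -mulmxA adjM hAB hAD mulmxA ABA.
have eBA : B *m A = D *m A.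
  by rewrite -hBA -{1}ADA -mulmxA mulmxA adjM hDA hBA -mulmxA (mulmxA A) ABA.
by rewrite -BAB eBA -mulmxA eAB mulmxA DAD.
Qed.

Lemma mp_pinvP m n (A : 'M[C]_(m, n)) : is_mp_pinv A (mp_pinv A).
Proof.
suff [B hB] : exists B, is_mp_pinv A B by apply: xgetPex; exists B.
have := row_base_free A; have := col_base_full A; have := mulmx_base A.
move: (col_base A) (row_base A) => c r.
move: (\rank A) c r => k c r <- fc fr.
have rU : r *m r ^t* \in unitmx by apply: gram_unit.
have cU : c ^t* *m c \in unitmx.
  rewrite -{2}[c]trmxCK; apply: gram_unit.
  by rewrite /row_free mxrank_map mxrank_tr.
pose G := invmx (r *m r ^t*); pose H := invmx (c ^t* *m c).
have hG : G ^t* = G by rewrite /G trmx_inv map_invmx adjM trmxCK.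
have hH : H ^t* = H by rewrite /H trmx_inv map_invmx adjM trmxCK.
pose B := r ^t* *m G *m (H *m c ^t*).
have eAB : c *m r *m B = c *m H *m c ^t*.
  rewrite /B -!mulmxA; congr (_ *m _).
  by rewrite !mulmxA mulmxV // mul1mx.
have eBA : B *m (c *m r) = r ^t* *m G *m r.
  rewrite /B -!mulmxA; congr (_ *m (_ *m _)).
  by rewrite (mulmxA (c ^t*)) mulmxA mulVmx // mul1mx.
exists B; split.
- by rewrite eAB mulmxA -(mulmxA _ (c ^t*)) -(mulmxA c) mulVmx // mulmx1.
- rewrite eBA /B !mulmxA -(mulmxA _ r) -(mulmxA _ (r *m _)) mulmxV //.
  by rewrite mulmx1.
- by rewrite eAB !adjM trmxCK hH mulmxA.
- by rewrite eBA !adjM trmxCK hG mulmxA.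
Qed.

End PseudoInverse.

Definition ost_c1 (R : realType) : R := 37 * expR 1.
Definition ost_c2 (R : realType) : R := 2 / (1 - expR (- (1 / 2))).
Definition ost_c3 (R : realType) : R :=
  1 + expR (- (1 / 2)) / (1 - expR (- (1 / 2))).

Section Frames.
Variable R : realType.
Variables M N : nat.
Implicit Types F : 'M[R[i]]_(M, N).

Definition unit_norm_frame F : Prop :=
  \rank F = M /\ forall i, l2norm (col i F) = 1.

Definition worst_coherence F : R :=
  \big[Num.max/0]_(i < N) \big[Num.max/0]_(j < N | j != i)
    normc (inner (col i F) (col j F)).

Definition avg_coherence F : R :=
  (N%:R - 1)^-1 * \big[Num.max/0]_(i < N)
    normc (\sum_(j < N | j != i) inner (col i F) (col j F)).

Definition strong_coherence F : Prop :=
  worst_coherence F <= 1 / (164 * ln N%:R) /\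
  avg_coherence F <= worst_coherence F / Num.sqrt M%:R.

Definition T_sigma (sigma t : R) (x : 'cV[R[i]]_N) : {set 'I_N} :=
  [set n | normc (x n 0) >
     2 * Num.sqrt 2 / (1 - t) * Num.sqrt (2 * sigma ^+ 2 * ln N%:R)]%SET.

Definition T_mu F (t : R) (x : 'cV[R[i]]_N) : {set 'I_N} :=
  [set n | normc (x n 0) >
     20 / t * worst_coherence F * l2norm x * Num.sqrt (2 * ln N%:R)]%SET.

Definition ost_lambda F (sigma t snr : R) : R :=
  Num.sqrt (2 * sigma ^+ 2 * ln N%:R) *
  Num.max (10 / t * worst_coherence F * Num.sqrt (M%:R * snr))
          (Num.sqrt 2 / (1 - t)).

Definition subcols F (S : {set 'I_N}) : 'M[R[i]]_(M, #|S|) :=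
  colsub (fun k : 'I_#|S| => enum_val k) F.

(* Inverse of restriction: [v] is indexed by the elements of [S], enumerated in
   increasing order as in [subcols]. *)
Definition zero_extend (S : {set 'I_N}) (v : 'cV[R[i]]_#|S|) : 'cV[R[i]]_N :=
  \col_i \sum_(k < #|S| | enum_val k == i) v k 0.

Definition ost_support F (y : 'cV[R[i]]_M) (lambda : R) : {set 'I_N} :=
  [set n | normc ((F ^t* *m y) n 0) > lambda]%SET.

Definition ost_estimate F (y : 'cV[R[i]]_M) (lambda : R) : 'cV[R[i]]_N :=
  let Khat := ost_support F y lambda in
  zero_extend (mp_pinv (subcols F Khat) *m y).

End Frames.

Lemma perm_of_card N (A B : {set 'I_N}) : #|A| = #|B| ->
  exists s : {perm 'I_N}, s @^-1: B = A.
Proof.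
move=> AB.
pose e (D : {set 'I_N}) := enum D ++ enum (~: D).
have se D : size (e D) = N by rewrite size_cat -!cardE cardsC card_ord.
have ue D : uniq (e D).
  rewrite cat_uniq !enum_uniq /= andbT; apply/hasPn => i.
  by rewrite !mem_enum inE.
have me D i : i \in e D by rewrite mem_cat !mem_enum inE orbN.
pose g i := nth i (e B) (index i (e A)).
have lt i : (index i (e A) < size (e B))%N.
  by rewrite (_ : size (e B) = size (e A)) ?index_mem // !se.
have g_inj : injective g.
  move=> i j; rewrite /g (set_nth_default i j) // => /eqP.
  rewrite nth_uniq // => /eqP ij.
  by rewrite -(nth_index i (me A i)) ij nth_index.
exists (perm g_inj); apply/setP => i; rewrite inE permE /g.
rewrite nth_cat -cardE -AB index_cat mem_enum.
case: (boolP (i \in A)) => iA.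
  have iB : (index i (enum A) < #|A|)%N by rewrite cardE index_mem mem_enum.
  by rewrite iB -[LHS]mem_enum mem_nth // -cardE -AB.
rewrite -cardE ltnNge leq_addr /= addKn.
rewrite -[LHS]negbK -finset.in_setC -mem_enum mem_nth // -cardE.
have -> : #|~: B| = #|~: A|.
  by apply/eqP; rewrite -(eqn_add2l #|B|) cardsC -AB cardsC.
by rewrite cardE index_mem mem_enum inE iA.
Qed.

Lemma card_perm_preim N (A B : {set 'I_N}) : #|A| = #|B| ->
  (#|[set s : {perm 'I_N} | s @^-1: B == A]%SET| * 'C(N, #|B|) = N`!)%N.
Proof.
move=> AB.
pose Q (D : {set 'I_N}) := [set s : {perm 'I_N} | s @^-1: B == D]%SET.
have QQ (D E : {set 'I_N}) : #|D| = #|E| -> (#|Q D| <= #|Q E|)%N.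
  move=> DE; have [u uE] : exists u : {perm 'I_N}, u @^-1: D = E.
    by apply: perm_of_card; rewrite DE.
  rewrite -(card_imset _ (@mulgI _ u)).
  apply/subset_leq_card/fintype.subsetP => s /imsetP[v].
  rewrite !inE => /eqP vD ->; apply/eqP; rewrite -uE -vD.
  by apply/setP => i; rewrite !inE permM.
transitivity (\sum_(s : {perm 'I_N}) 1)%N; last by rewrite sum1_card card_Sn.
rewrite (partition_big (fun s : {perm 'I_N} => s @^-1: B)
  (fun D : {set 'I_N} => #|D| == #|B|)) /=; last first.
  by move=> s _; rewrite card_preimset //; exact: perm_inj.
transitivity (\sum_(D : {set 'I_N} | #|D| == #|B|) #|Q A|)%N.
  rewrite sum_nat_const mulnC; congr (_ * _)%N.
  by rewrite -{1}(card_ord N) -card_draws; apply: eq_card => D; rewrite !inE.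
apply: eq_bigr => D /eqP DB; rewrite sum1_card.
transitivity #|Q D|.
  by apply/eqP; rewrite eqn_leq !QQ // AB DB.
by apply: eq_card => s; rewrite !inE.
Qed.

Section RandomModel.
Context {d : measure_display} {T : measurableType d} {R : realType}.
Variable P : probability T R.
Variables M N : nat.

Definition re_im (z : R[i]) : R * R := (complex.Re z, complex.Im z).

(* Circularly symmetric complex Gaussian with mean 0 and variance v: the real
   and imaginary parts are independent centred real Gaussians of variance v/2
   each.  The second argument of [normal_prob] is a standard deviation. *)
Definition complex_gaussian (v : R) (X : T -> R[i]) : Prop :=
  measurable_fun setT (re_im \o X) /\
  forall A : set (R * R), measurable A ->
    P ((re_im \o X) @^-1` A) =
    (normal_prob 0 (Num.sqrt (v / 2)) \x normal_prob 0 (Num.sqrt (v / 2)))%E A.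

Definition entries_in (e : T -> 'cV[R[i]]_M) (A : 'I_M -> set (R * R)) :
    set T :=
  [set w | forall m, A m (re_im (e w m 0))].

(* For measurable sets [A m], taking [A m = setT] for the indices outside a
   subfamily gives the product rule for that subfamily. *)
Definition independent_entries (e : T -> 'cV[R[i]]_M) : Prop :=
  forall A : 'I_M -> set (R * R), (forall m, measurable (A m)) ->
    P (entries_in e A) =
    (\prod_m P [set w | A m (re_im (e w m 0%R))])%E.

Definition gaussian_noise (sigma : R) (e : T -> 'cV[R[i]]_M) : Prop :=
  (forall m, complex_gaussian (sigma ^+ 2) (fun w => e w m 0)) /\
  independent_entries e.

Definition uniform_perm (p : T -> {perm 'I_N}) : Prop :=
  forall s, measurable (p @^-1` [set s]) /\
            P (p @^-1` [set s]) = ((N`!%:R)^-1)%:E.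

(* When p is a uniform permutation, the support of [row_perm (p w) x0] is
   uniform among the sets of cardinality #|supp x0|. *)
Lemma uniform_supp (p : T -> {perm 'I_N}) (x0 : 'cV[R[i]]_N)
    (A : {set 'I_N}) :
  uniform_perm p -> #|A| = #|supp x0| ->
  P [set w | supp (row_perm (p w) x0) = A] = ('C(N, #|A|)%:R^-1)%:E.
Proof.
move=> hp hA.
pose Q := [set s : {perm 'I_N} | s @^-1: supp x0 == A]%SET.
have suppE s : supp (row_perm s x0) = s @^-1: supp x0.
  by apply/setP => i; rewrite !inE mxE.
have -> : [set w | supp (row_perm (p w) x0) = A] =
    \bigcup_(s in [set` Q]) p @^-1` [set s].
  apply/seteqP; split=> [w /= wA|w [s /=]].
    by exists (p w) => //=; rewrite inE -suppE wA.
  by rewrite inE -suppE => /eqP sA ->.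
rewrite measure_fin_bigcup //=; last 2 first.
- by move=> s u _ _ [w [<- <-]].
- by move=> s _; have [] := hp s.
rewrite (eq_fsbigr (fun _ => (N`!%:R^-1)%:E)); last first.
  by move=> s _; have [] := hp s.
rewrite -(bigfs _ (r := index_enum {perm 'I_N})) ?index_enum_uniq //.
have -> : (\sum_(s in Q) (N`!%:R^-1)%:E = (\sum_(s in Q) N`!%:R^-1 : R)%:E)%E.
  by rewrite sumEFin.
have := card_perm_preim hA; rewrite -hA -/Q => cQ.
have N0 : N`!%:R != 0 :> R by rewrite pnatr_eq0 -lt0n fact_gt0.
have C0 : 'C(N, #|A|)%:R != 0 :> R.
  by move: N0; rewrite -cQ natrM mulf_eq0 negb_or => /andP[].
congr EFin; rewrite sumr_const -[LHS]mulr_natr.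
by apply: (mulIf C0); rewrite -mulrA -natrM cQ !mulVf.
by move=> s _; rewrite mem_index_enum.
Qed.

(* The events {p = s}, together with the empty set, and the events
   [entries_in e A] are pi-systems generating the sigma-algebras of p and e. *)
Definition perm_noise_independent (p : T -> {perm 'I_N})
    (e : T -> 'cV[R[i]]_M) : Prop :=
  forall s (A : 'I_M -> set (R * R)), (forall m, measurable (A m)) ->
    P (p @^-1` [set s] `&` entries_in e A) =
    (P (p @^-1` [set s]) * P (entries_in e A))%E.

Definition snr (x : 'cV[R[i]]_N) (e : T -> 'cV[R[i]]_M) : R :=
  l2norm x ^+ 2 / fine 'E_P[fun w => l2norm (e w) ^+ 2].

End RandomModel.

(* Main.v *)
(* Thresholding succeeds deterministically as soon as three things hold for the
   random support S: the interference |(F^* F x - x)_n| is at most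
   10 mu |x| sqrt (2 log N) for all n, the noise |(F^* e)_n| is at most
   2 sigma sqrt (log N) for all n, and the hollow Gram matrix F_S^* F_S - I has
   norm at most e^(-1/2). The threshold lambda is at least the sum of the first two
   bounds, so no index outside S is selected and every entry above 2 lambda is;
   the third bound controls the least squares step.

   The noise bound is a Gaussian tail in each of the four directions 1, i, -1, -i
   followed by a union bound. The interference is a linear statistic of a random
   permutation t; its mean is small by the average coherence, and its moment
   generating function is bounded by revealing t one value at a time.

   For the hollow Gram matrix, a random split S = S1 u S2 decouples the quadratic
   form. Given S2, the matrix sum_(i in S1) v_i v_i^* with
   v_i = F_S2^* f_i is a sum of rank one matrices sampled without replacement, and
   its trace moments of order q ~ 2 log N are estimated by exchanging t a with an
   arbitrary unsampled value. The same estimate gives the two inputs that this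
   needs, |v_i|^2 <= eta and |F_S2|^2 <= 20 log N. *)

From HB Require Import structures.
From mathcomp Require Import all_boot all_order all_algebra perm.
From mathcomp Require Import ring lra zify.
From mathcomp Require Import reals sequences exp.

Set Implicit Arguments.
Unset Strict Implicit.
Unset Printing Implicit Defensive.

Import Order.TTheory GRing.Theory Num.Theory.
Local Open Scope ring_scope.
Local Open Scope sesquilinear_scope.

(** * Positive semidefinite matrices *)

Section PsdMatrices.
Variable C : numClosedFieldType.
Implicit Types (d : nat).

(** The support enters only through a uniform permutation, so statements about it are inequalities
    between numbers of permutations; probability returns only when these are combined with the
    noise. The values of a random permutation are not independent, which blocks the usual Chernoff
    arguments. The substitute is that, given the values at some positions, the value at another is
    uniform over what is left; as the support has size at most N / 20, an average over what is left
    costs little more than the full sum over all columns divided by N, which the spectral norm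
    controls. The matrix estimate is used in two layers. The vectors of the second layer depend on
    S2 and obey their bounds only outside exceptional permutations; these exceptional sets depend
    only on the values on A2, so the vectors can be set to zero there without disturbing the
    conditioning. The failure budget is 1 / N for the Gram matrix, 4 / N for the interference and 4
    / N for the noise. The numerical room comes from (37 e)^2 >= 20^3 and from replacing e^(-1/2) by
    54 / 100. *)

Definition normsq d (u : 'cV[C]_d) : C := \sum_l `|u l 0| ^+ 2.

Definition qform d (W : 'M[C]_d) (u : 'cV[C]_d) : C := (u ^t* *m W *m u) 0 0.

Definition psd d (W : 'M[C]_d) : Prop := W ^t* = W /\ forall u, 0 <= qform W u.

Lemma normsq_ge0 d (u : 'cV[C]_d) : 0 <= normsq u.
Proof. by apply: sumr_ge0 => l _; rewrite exprn_ge0. Qed.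

Lemma normsqE d (u : 'cV[C]_d) : normsq u = (u ^t* *m u) 0 0.
Proof.
by rewrite mxE; apply: eq_bigr => l _; rewrite !mxE normCK mulrC.
Qed.

Lemma trmxC_mul m n k (A : 'M[C]_(m, n)) (B : 'M[C]_(n, k)) :
  (A *m B) ^t* = B ^t* *m A ^t*.
Proof. by rewrite trmx_mul map_mxM. Qed.

Lemma trmxC_add m n (A B : 'M[C]_(m, n)) : (A + B) ^t* = A ^t* + B ^t*.
Proof. by apply/matrixP => i j; rewrite !mxE rmorphD. Qed.

Lemma trmxC_sum m n (I : finType) (Q : pred I) (A : I -> 'M[C]_(m, n)) :
  (\sum_(i | Q i) A i) ^t* = \sum_(i | Q i) (A i) ^t*.
Proof.
apply/matrixP => i j; rewrite !mxE !summxE rmorph_sum.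
by apply: eq_bigr => l _; rewrite !mxE.
Qed.

Lemma qformD d (A B : 'M[C]_d) u : qform (A + B) u = qform A u + qform B u.
Proof. by rewrite /qform mulmxDr mulmxDl mxE. Qed.

Lemma qform_rank1 d (v u : 'cV[C]_d) :
  qform (v *m v ^t*) u = `|(v ^t* *m u) 0 0| ^+ 2.
Proof.
rewrite /qform mulmxA -mulmxA mxE big_ord_recl big_ord0 addr0 normCK mulrC.
by congr (_ * _); rewrite -[v in LHS]trmxCK -trmxC_mul !mxE.
Qed.

Lemma qform_sum d (I : finType) (Q : pred I) (A : I -> 'M[C]_d) u :
  qform (\sum_(i | Q i) A i) u = \sum_(i | Q i) qform (A i) u.
Proof. by rewrite /qform mulmx_sumr mulmx_suml summxE. Qed.

Lemma psd_gram d (I : finType) (Q : pred I) (v : I -> 'cV[C]_d) :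
  psd (\sum_(i | Q i) v i *m (v i) ^t*).
Proof.
split=> [|u].
  by rewrite trmxC_sum; apply: eq_bigr => i _; rewrite trmxC_mul trmxCK.
rewrite qform_sum; apply: sumr_ge0 => i _.
by rewrite qform_rank1 exprn_ge0.
Qed.

Lemma qform_scalar d (c : C) (u : 'cV[C]_d) : qform c%:M u = c * normsq u.
Proof.
by rewrite /qform mul_mx_scalar -scalemxAl mxE normsqE.
Qed.

Lemma psd_shift d (W : 'M[C]_d) (c : C) : 0 <= c -> psd W -> psd (W + c%:M).
Proof.
move=> c0 [hW pW]; split=> [|u]; last first.
  by rewrite qformD qform_scalar addr_ge0 ?pW // mulr_ge0 ?normsq_ge0.
rewrite trmxC_add hW tr_scalar_mx map_scalar_mx; congr (_ + _%:M).
by apply/CrealP/ger0_real.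
Qed.

(** Functional calculus in a fixed eigenbasis: powers, scalar shifts, traces and quadratic forms are
    read off entrywise from [D]. *)
Definition unitary_diag d (U : 'M[C]_d) (D : 'rV[C]_d) : 'M[C]_d :=
  U ^t* *m diag_mx D *m U.

(** A Hermitian matrix is normal, so the spectral theorem applies; each eigenvalue is the quadratic
    form at its own eigenvector, hence nonnegative. *)
Lemma psd_spectral d (W : 'M[C]_d) : psd W ->
  exists (U : 'M[C]_d) (D : 'rV[C]_d),
    [/\ U \is unitarymx, forall l, 0 <= D 0 l & W = unitary_diag U D].
Proof.
move=> [hW pW].
have nW : W \is normalmx by apply/normalmxP; rewrite hW.
have uU := spectral_unitarymx W.
have WE : W = unitary_diag (spectralmx W) (spectral_diag W).
  by rewrite {1}(orthomx_spectralP nW) invmx_unitary.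
exists (spectralmx W), (spectral_diag W); split => // l.
have := pW ((spectralmx W) ^t* *m delta_mx l 0).
rewrite /qform {2}WE /unitary_diag trmxC_mul trmxCK !mulmxA.
rewrite mulmxtVK // -!mulmxA (mulmxA (spectralmx W)) (unitarymxP uU) mul1mx.
suff -> : ((delta_mx l 0 : 'cV[C]_d)^t* *m
   (diag_mx (spectral_diag W) *m (delta_mx l 0 : 'cV[C]_d))) 0 0 = spectral_diag W 0 l by [].
rewrite mul_diag_mx mxE (bigD1 l) //= big1 ?addr0 => [|i ne].
  by rewrite !mxE !eqxx rmorph1 mul1r mulr1.
by rewrite !mxE (negbTE ne) mulr0 mulr0.
Qed.

Section FunctionalCalculus.
Variables (d : nat) (U : 'M[C]_d).
Hypothesis uU : U \is unitarymx.

Lemma unitary_tV : U ^t* *m U = 1%:M.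
Proof. by rewrite -invmx_unitary // mulVmx // unitarymx_unit. Qed.

Lemma unitary_diagM (D E : 'rV[C]_d) :
  unitary_diag U D *m unitary_diag U E =
  unitary_diag U (\row_l (D 0 l * E 0 l)).
Proof.
rewrite /unitary_diag !mulmxA; congr (_ *m _).
rewrite -!mulmxA (mulmxA U) (unitarymxP uU) mul1mx mulmx_diag.
by congr (_ *m diag_mx _).
Qed.

Lemma unitary_diagX (D : 'rV[C]_d) k :
  (unitary_diag U D) ^+ k = unitary_diag U (\row_l (D 0 l ^+ k)).
Proof.
elim: k => [|k IH].
  rewrite expr0 /unitary_diag (_ : \row_l _ = const_mx 1).
    by rewrite diag_const_mx mulmx1 unitary_tV.
  by apply/rowP => l; rewrite !mxE expr0.
rewrite exprS IH -[_ * _]/(_ *m _) unitary_diagM; congr unitary_diag.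
by apply/rowP => l; rewrite !mxE exprS.
Qed.

Lemma unitary_diag_shift (D : 'rV[C]_d) c :
  unitary_diag U D + c%:M = unitary_diag U (\row_l (D 0 l + c)).
Proof.
have -> : c%:M = unitary_diag U (const_mx c).
  rewrite /unitary_diag diag_const_mx mul_mx_scalar -scalemxAl unitary_tV.
  by rewrite scalemx1.
rewrite /unitary_diag -mulmxDl -mulmxDr -raddfD; congr (_ *m diag_mx _ *m _).
by apply/rowP => l; rewrite !mxE.
Qed.

Lemma qform_unitary_diag (D : 'rV[C]_d) u :
  qform (unitary_diag U D) u = \sum_l D 0 l * `|(U *m u) l 0| ^+ 2.
Proof.
rewrite /qform /unitary_diag !mulmxA -mulmxA -trmxC_mul.
rewrite mxE; apply: eq_bigr => l _.
rewrite mul_mx_diag !mxE normCK -mulrA mulrCA; congr (_ * _).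
by rewrite mulrC.
Qed.

Lemma mxtrace_unitary_diag (D : 'rV[C]_d) :
  \tr (unitary_diag U D) = \sum_l D 0 l.
Proof.
by rewrite /unitary_diag mxtrace_mulC mulmxA (unitarymxP uU) mul1mx
  mxtrace_diag.
Qed.

Lemma normsq_unitary u : normsq (U *m u) = normsq u.
Proof.
by rewrite !normsqE trmxC_mul mulmxA -(mulmxA _ _ U) unitary_tV mulmx1.
Qed.

End FunctionalCalculus.

(** Twice the gap is the double sum [D], all of whose terms are nonnegative. *)
Lemma chebyshev_sum d (w f g : 'I_d -> C) :
  (forall l, 0 <= w l) ->
  (forall k l, 0 <= (f k - f l) * (g k - g l)) ->
  (\sum_l f l * w l) * (\sum_l g l * w l) <=
  (\sum_l w l) * (\sum_l f l * g l * w l).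
Proof.
move=> w0 fg; rewrite -subr_ge0.
pose D := \sum_k \sum_l w k * w l * ((f k - f l) * (g k - g l)).
suff DE : D = ((\sum_l w l) * (\sum_l f l * g l * w l) -
    (\sum_l f l * w l) * (\sum_l g l * w l)) *+ 2.
  rewrite -(pmulrn_lge0 _ (isT : (0 < 2)%N)) -DE.
  apply: sumr_ge0 => k _; apply: sumr_ge0 => l _.
  by apply: mulr_ge0 => //; apply: mulr_ge0.
have E1 (a b : 'I_d -> C) :
    (\sum_l a l) * (\sum_l b l) = \sum_k \sum_l a k * b l.
  by rewrite mulr_suml; apply: eq_bigr => k _; rewrite mulr_sumr.
have E2 (a b : 'I_d -> C) :
    (\sum_l a l) * (\sum_l b l) = \sum_k \sum_l a l * b k.
  by rewrite E1 exchange_big.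
rewrite mulr2n {1}E1 {1}E1 E2 E2 -!sumrB -big_split /=.
apply: eq_bigr => k _; rewrite -!sumrB -big_split /=.
by apply: eq_bigr => l _; ring.
Qed.

(* In the eigenbasis of Z the cross term of the induction step compares a product
   of two averages, of l^k and of (l + eta)^m, with the average of their product:
   Chebyshev's sum inequality, both functions of l being increasing. *)
Lemma qform_rank1_update d (Z : 'M[C]_d) (a : 'cV[C]_d) (eta : C) k m :
  psd Z -> normsq a <= eta ->
  qform (Z ^+ k *m (Z + a *m a ^t*) ^+ m) a <=
  qform (Z ^+ k *m (Z + eta%:M) ^+ m) a.
Proof.
move=> pZ aeta; have eta0 : 0 <= eta := le_trans (normsq_ge0 a) aeta.
elim: m k => [|m IH] k; first by rewrite !expr0.
have [U [D [uU D0 ZE]]] := psd_spectral pZ.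
(* One factor is split off the power: its [Z] part raises [k], which is why [k] is general in the
   induction, and its rank one part makes the form a product of two scalars. *)
have -> : qform (Z ^+ k *m (Z + a *m a ^t*) ^+ m.+1) a =
   qform (Z ^+ k.+1 *m (Z + a *m a ^t*) ^+ m) a +
   qform (Z ^+ k) a * qform (Z ^+ 0 *m (Z + a *m a ^t*) ^+ m) a.
  rewrite exprS -[_ * _ ^+ m]/(_ *m _) mulmxDl mulmxDr qformD; congr (_ + _).
    by rewrite exprSr mulmxA.
  rewrite expr0 mul1mx /qform !mulmxA -mulmxA -mulmxA mxE.
  by rewrite big_ord_recl big_ord0 addr0 !mulmxA.
have -> : qform (Z ^+ k *m (Z + eta%:M) ^+ m.+1) a =
   qform (Z ^+ k.+1 *m (Z + eta%:M) ^+ m) a +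
   eta * qform (Z ^+ k *m (Z + eta%:M) ^+ m) a.
  rewrite exprS -[_ * _ ^+ m]/(_ *m _) mulmxDl mulmxDr qformD; congr (_ + _).
    by rewrite exprSr mulmxA.
  by rewrite mul_scalar_mx -scalemxAr /qform -scalemxAr -scalemxAl mxE.
apply: lerD; first exact: IH.
have qk0 : 0 <= qform (Z ^+ k) a.
  rewrite ZE unitary_diagX // qform_unitary_diag //; apply: sumr_ge0 => l _.
  by rewrite !mxE mulr_ge0 ?exprn_ge0.
apply: le_trans (ler_wpM2l qk0 (IH 0%N)) _.
rewrite expr0 mul1mx.
have -> : (Z + eta%:M) ^+ m = unitary_diag U (\row_l (D 0 l + eta) ^+ m).
  rewrite {1}ZE unitary_diag_shift // unitary_diagX //; congr unitary_diag.
  by apply/rowP => l; rewrite !mxE.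
rewrite ZE unitary_diagX // unitary_diagM // !qform_unitary_diag //.
apply: (@le_trans _ _ (normsq a * (\sum_l (D 0 l ^+ k * (D 0 l + eta) ^+ m) *
    `|(U *m a) l 0| ^+ 2))).
  rewrite -(normsq_unitary uU) /normsq.
  under [X in X * _ <= _]eq_bigr do rewrite mxE.
  under [X in _ * X <= _]eq_bigr do rewrite mxE.
  apply: chebyshev_sum => [l|i j]; first by rewrite exprn_ge0.
  have /orP[ij|ij] : (D 0 i <= D 0 j) || (D 0 j <= D 0 i).
    by apply: real_leVge; rewrite ger0_real.
  - by rewrite mulr_le0 // subr_le0 lerXn2r ?nnegrE ?addr_ge0 // lerD2r.
  - by rewrite mulr_ge0 // subr_ge0 lerXn2r ?nnegrE ?addr_ge0 // lerD2r.
rewrite [X in _ <= _ * X](eq_bigr (fun l => D 0 l ^+ k * (D 0 l + eta) ^+ m *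
    `|(U *m a) l 0| ^+ 2)) => [|l _]; last by rewrite !mxE.
apply: ler_wpM2r => //; apply: sumr_ge0 => l _.
by rewrite !mulr_ge0 ?exprn_ge0 ?addr_ge0.
Qed.

(** The frame inequality is used once per eigenvector of [Z], a conjugated row of [U]; weighting by
    the eigenvalues of [Z ^+ m] and summing gives the trace. *)
Lemma sum_qform_le_trace d (Z : 'M[C]_d) (I : finType) (Q : pred I)
    (v : I -> 'cV[C]_d) (B : C) m :
  psd Z ->
  (forall w : 'cV[C]_d,
     \sum_(i | Q i) `|((v i) ^t* *m w) 0 0| ^+ 2 <= B * normsq w) ->
  \sum_(i | Q i) qform (Z ^+ m) (v i) <= B * \tr (Z ^+ m).
Proof.
move=> pZ vB; have [U [D [uU D0 ->]]] := psd_spectral pZ.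
rewrite unitary_diagX // mxtrace_unitary_diag // mulr_sumr.
under eq_bigr do rewrite qform_unitary_diag //.
rewrite exchange_big; apply: ler_sum => l _.
rewrite mxE -mulr_sumr [leRHS]mulrC; apply: ler_wpM2l; first by rewrite exprn_ge0.
have := vB ((row l U) ^t*).
have -> : normsq ((row l U) ^t*) = 1.
  rewrite normsqE trmxCK.
  have /matrixP/(_ l l) := unitarymxP uU; rewrite !mxE eqxx mulr1n => <-.
  by apply: eq_bigr => i _; rewrite !mxE.
rewrite mulr1; apply: le_trans; apply: ler_sum => i _.
rewrite -trmxC_mul !mxE norm_conjC lerXn2r ?nnegrE //.
rewrite le_eqVlt; apply/orP; left; apply/eqP; congr `|_|.
by apply: eq_bigr => j _; rewrite mxE.
Qed.

(** Each eigenvalue to the power [q.+1] is one term of a sum of nonnegative terms, the trace. Here a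
    moment becomes an operator bound. *)
Lemma qform_le_of_trace d (Z : 'M[C]_d) (tau : C) q :
  psd Z -> 0 <= tau -> \tr (Z ^+ q.+1) <= tau ^+ q.+1 ->
  forall u, qform Z u <= tau * normsq u.
Proof.
move=> pZ tau0; have [U [D [uU D0 ->]]] := psd_spectral pZ.
rewrite unitary_diagX // mxtrace_unitary_diag // => trle u.
rewrite qform_unitary_diag // -(normsq_unitary uU) mulr_sumr.
apply: ler_sum => l _; apply: ler_wpM2r; first by rewrite exprn_ge0.
rewrite -(@ler_pXn2r _ q.+1) ?nnegrE //; apply: le_trans trle.
rewrite (bigD1 l) //= mxE lerDl; apply: sumr_ge0 => i _.
by rewrite mxE exprn_ge0.
Qed.

End PsdMatrices.

(* Conditionally on the restriction of t to D, the value t a is uniform outside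
   t @: D. *)
Lemma sum_perm_exchange (V : nmodType) N (D : {set 'I_N}) (a : 'I_N)
    (phi : {perm 'I_N} -> 'I_N -> V) :
  a \notin D ->
  (forall t u : {perm 'I_N}, {in D, t =1 u} -> phi t =1 phi u) ->
  (\sum_(t : {perm 'I_N}) phi t (t a)) *+ (N - #|D|) =
  \sum_(t : {perm 'I_N}) \sum_(i | i \notin t @: D) phi t i.
Proof.
move=> aD hphi.
have RE (t : {perm 'I_N}) :
    \sum_(i | i \notin t @: D) phi t i = \sum_(b in ~: D) phi t (t b).
  rewrite (reindex_inj (@perm_inj _ t)) /=; apply: eq_bigl => b.
  by rewrite inE mem_imset //; exact: perm_inj.
under [RHS]eq_bigr do rewrite RE.
rewrite exchange_big /=.
have cD : #|~: D| = (N - #|D|)%N by rewrite cardsCs setCK card_ord.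
rewrite -cD -sumr_const; apply: eq_bigr => b; rewrite inE => bD.
(* Composing with the transposition of [a] and [b] gives [a] the value at [b] and changes nothing on
   [D], which contains neither point. *)
rewrite (reindex_inj (mulgI (tperm a b))) /=; apply: eq_bigr => t _.
rewrite permM tpermL; apply: hphi => x xD.
rewrite permM tpermD //; first by apply: contraNneq aD => ->.
by apply: contraNneq bD => ->.
Qed.

(** * Gram matrices sampled by a random permutation *)

Section MatrixMoments.
Variables (C : numClosedFieldType) (N d : nat).
Variable A2 : {set 'I_N}.
Variable v : {perm 'I_N} -> 'I_N -> 'cV[C]_d.
Hypothesis v_dep : forall t u : {perm 'I_N}, {in A2, t =1 u} -> v t =1 v u.

(** The vectors may vary with [t], but by [v_dep] only through its values on [A2]: this encodes
    conditioning on one half of the split while the positions in [A] remain random. *)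
Definition sampled_gram (t : {perm 'I_N}) (A : {set 'I_N}) : 'M[C]_d :=
  \sum_(a in A) v t (t a) *m (v t (t a)) ^t*.

Lemma sampled_gram_psd t A : psd (sampled_gram t A).
Proof. exact: psd_gram. Qed.

Lemma mxtrace_powS (X : 'M[C]_d) (c : C) (t : {perm 'I_N}) A q :
  X = sampled_gram t A + c%:M ->
  \tr (X ^+ q.+1) = c * \tr (X ^+ q) + \sum_(a in A) qform (X ^+ q) (v t (t a)).
Proof.
move=> XE; rewrite exprS -[_ * _]/(_ *m _) {1}XE mulmxDl mxtraceD addrC.
rewrite mul_scalar_mx mxtraceZ; congr (_ + _).
rewrite mulmx_suml raddf_sum; apply: eq_bigr => a _ /=.
by rewrite -mulmxA mxtrace_mulC trace_mx11.
Qed.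

Variables (B b eta : C) (k : nat).
Hypothesis eta0 : 0 <= eta.
Hypothesis kN : (k + #|A2| < N)%N.
Hypothesis v_small : forall (t : {perm 'I_N}) i,
  i \notin t @: A2 -> normsq (v t i) <= eta.
Hypothesis v_frame : forall (t : {perm 'I_N}) (w : 'cV[C]_d),
  \sum_(i | i \notin t @: A2) `|((v t i) ^t* *m w) 0 0| ^+ 2 <= B * normsq w.
Hypothesis B0 : 0 <= B.
Hypothesis b_large : k%:R * B <= b * (N - (k + #|A2|))%:R.

(* Moment method, by induction on q. Splitting off one factor leaves the
   quadratic form of the remaining power at one sampled vector; that vector is
   averaged over the unsampled columns, which costs b, and its own rank one
   contribution to the remaining power is dominated by the scalar eta. *)
Lemma sum_trace_sampled_gram q (A : {set 'I_N}) (c : C) :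
  [disjoint A & A2] -> (#|A| <= k)%N -> 0 <= c ->
  \sum_(t : {perm 'I_N}) \tr ((sampled_gram t A + c%:M) ^+ q) <=
  (N`!)%:R * ((c + b + q%:R * eta) ^+ q *+ d).
Proof.
have n0 : (0 : C) < (N - (k + #|A2|))%:R by rewrite ltr0n subn_gt0.
have b0 : 0 <= b.
  by rewrite -(pmulr_lge0 _ n0); apply: le_trans b_large; rewrite mulr_ge0.
elim: q A c => [|q IH] A c dA Ak c0.
  under eq_bigr do rewrite expr0 mxtrace1.
  by rewrite expr0 sumr_const card_Sn mulr_natl.
(* [bd] is the inductive bound after a shift by [eta], since [(c + eta) + b + q%:R * eta] is
   [c + b + q.+1%:R * eta]. Of the three multiples of [bd] below, those by [c] and [b] are consumed
   and the third is slack. *)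
set bd : C := (N`!)%:R * ((c + b + q.+1%:R * eta) ^+ q *+ d).
have bd0 : 0 <= bd
  by rewrite mulr_ge0 // mulrn_wge0 // exprn_ge0 // !addr_ge0 // mulr_ge0.
under eq_bigr do rewrite (mxtrace_powS _ (erefl _)).
rewrite big_split /= -mulr_sumr [X in _ + X]exchange_big /=.
have -> : (N`!)%:R * ((c + b + q.+1%:R * eta) ^+ q.+1 *+ d) =
  c * bd + b * bd + q.+1%:R * eta * bd by rewrite /bd exprS; ring.
have IH1 : \sum_(t : {perm 'I_N}) \tr ((sampled_gram t A + c%:M) ^+ q) <= bd.
  apply: le_trans (IH A c dA Ak c0) _.
  rewrite ler_wpM2l // lerMn2r; apply/orP; right.
  rewrite lerXn2r ?nnegrE ?addr_ge0 ?mulr_ge0 //.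
  by rewrite lerD2l ler_wpM2r // ler_nat.
rewrite -[leLHS]addr0; apply: lerD; last first.
  by rewrite mulr_ge0 //; apply: mulr_ge0.
apply: lerD; first by rewrite ler_wpM2l.
(* Multiplying by a lower bound for the number of unsampled values prepares the exchange: the
   sampled vector becomes a sum over all unsampled ones, to which the frame bound [B] applies, and
   [b_large] pays for the division. *)
rewrite -(ler_pM2r n0) mulr_suml mulrAC.
apply: (@le_trans _ _ (\sum_(a in A) B * bd)); last first.
  rewrite sumr_const -mulrnAl ler_wpM2r //; apply: le_trans b_large.
  by rewrite -[leLHS]mulr_natl ler_wpM2r // ler_nat.
apply: ler_sum => a aA.
(* [D] is all that [phi] depends on: the other sampled positions and those that determine the
   vectors. *)
pose D := (A :\ a) :|: A2.
have aD : a \notin D by rewrite !inE eqxx /= (disjointFr dA aA).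
have cD : (#|D| <= k + #|A2|)%N.
  apply: leq_trans (leq_card_setU _ _) _; rewrite leq_add2r.
  by apply: leq_trans Ak; rewrite subset_leq_card // subsetDl.
pose Y t := sampled_gram t (A :\ a) + c%:M.
have pY t : psd (Y t) by apply: psd_shift => //; apply: sampled_gram_psd.
have pYe t : psd (Y t + eta%:M) by apply: psd_shift.
pose phi t i := qform ((Y t + eta%:M) ^+ q) (v t i).
have Yq (t : {perm 'I_N}) i : 0 <= phi t i.
  have [U [D' [uU D0 YE]]] := psd_spectral (pYe t).
  rewrite /phi YE unitary_diagX // qform_unitary_diag //.
  by apply: sumr_ge0 => l _; rewrite mxE mulr_ge0 ?exprn_ge0.
have A2D (t u : {perm 'I_N}) : {in D, t =1 u} -> v t =1 v u.
  by move=> tu; apply: v_dep => x xA; apply: tu; rewrite inE xA orbT.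
have Ydep (t u : {perm 'I_N}) : {in D, t =1 u} -> Y t = Y u.
  move=> tu; congr (_ + _); apply: eq_bigr => x xA.
  have xD : x \in D by rewrite in_setU xA.
  by rewrite (tu x xD) (A2D t u tu).
have phi_dep (t u : {perm 'I_N}) : {in D, t =1 u} -> phi t =1 phi u.
  by move=> tu i; rewrite /phi (Ydep _ _ tu) (A2D _ _ tu).
apply: (@le_trans _ _ (\sum_(t : {perm 'I_N}) \sum_(i | i \notin t @: D) phi t i)).
  rewrite -(sum_perm_exchange aD phi_dep) -[leRHS]mulr_natr.
  apply: ler_pM => //.
  - apply: sumr_ge0 => t _.
    have [U [D' [uU D0 YE]]] := psd_spectral (psd_shift c0 (sampled_gram_psd t A)).
    rewrite YE unitary_diagX // qform_unitary_diag //.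
    by apply: sumr_ge0 => l _; rewrite mxE mulr_ge0 ?exprn_ge0.
  - apply: ler_sum => t _; rewrite /phi.
    have -> : sampled_gram t A + c%:M = Y t + v t (t a) *m (v t (t a)) ^t*.
      rewrite /Y /sampled_gram (bigD1 a) //= -addrA [LHS]addrC; congr (_ + _ + _).
      by apply: eq_bigl => x; rewrite !inE andbC.
    have := @qform_rank1_update _ _ (Y t) (v t (t a)) eta 0 q (pY t).
    rewrite !expr0 !mul1mx; apply; apply: v_small.
    by rewrite mem_imset ?(disjointFr dA aA) //; exact: perm_inj.
  - by rewrite ler_nat leq_sub2l.
have dA' : [disjoint A :\ a & A2].
  by apply: disjointWl dA; rewrite subsetDl.
have cA' : (#|A :\ a| <= k)%N.
  by apply: leq_trans Ak; rewrite subset_leq_card // subsetDl.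
apply: (@le_trans _ _ (\sum_(t : {perm 'I_N}) B * \tr ((Y t + eta%:M) ^+ q))); last first.
  rewrite -mulr_sumr ler_wpM2l //.
  under eq_bigr do rewrite /Y -addrA -raddfD.
  apply: le_trans (IH _ _ dA' cA' (addr_ge0 c0 eta0)) _.
  rewrite /bd (_ : c + eta + b + q%:R * eta = c + b + q.+1%:R * eta) //.
  by rewrite -[q.+1]addn1 natrD; ring.
apply: ler_sum => t _.
apply: (@le_trans _ _ (\sum_(i | i \notin t @: A2) phi t i)).
  rewrite big_mkcond [leRHS]big_mkcond; apply: ler_sum => i _.
  case: ifP => iD; case: ifP => // /negP iA; case: iA.
  by move=> iA; move: iD; rewrite imsetU inE iA orbT.
exact: sum_qform_le_trace.
Qed.

End MatrixMoments.

Lemma sampled_gram_dep (C : numClosedFieldType) N d (A A2 : {set 'I_N})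
    (v : {perm 'I_N} -> 'I_N -> 'cV[C]_d) (t u : {perm 'I_N}) :
  (forall t u : {perm 'I_N}, {in A2, t =1 u} -> v t =1 v u) ->
  {in A :|: A2, t =1 u} -> sampled_gram v t A = sampled_gram v u A.
Proof.
move=> v_dep tu; apply: eq_bigr => a aA.
have vE : v t =1 v u.
  by apply: v_dep => x xA; apply: tu; rewrite in_setU xA orbT.
have aD : a \in A :|: A2 by rewrite in_setU aA.
by rewrite (tu a aD) (vE _).
Qed.

(** Markov's inequality for the trace of the power [q.+1], in counting form. The ratio 9 exceeds
    e^2, so a power of order 2 log N gains a factor N^4. The dependence clause allows the
    exceptional set to enter the definition of the vectors of a later application. *)
Lemma sampled_gram_tail (C : numClosedFieldType) N d (A A2 : {set 'I_N})
    (v : {perm 'I_N} -> 'I_N -> 'cV[C]_d) (B b eta tau : C) k q :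
  (forall t u : {perm 'I_N}, {in A2, t =1 u} -> v t =1 v u) ->
  0 <= eta -> 0 <= B -> 0 < tau -> (k + #|A2| < N)%N ->
  (forall (t : {perm 'I_N}) i, i \notin t @: A2 -> normsq (v t i) <= eta) ->
  (forall (t : {perm 'I_N}) (w : 'cV[C]_d),
    \sum_(i | i \notin t @: A2) `|((v t i) ^t* *m w) 0 0| ^+ 2 <=
      B * normsq w) ->
  k%:R * B <= b * (N - (k + #|A2|))%:R ->
  [disjoint A & A2] -> (#|A| <= k)%N ->
  9 * (b + q.+1%:R * eta) <= tau ->
  exists Bad : {set {perm 'I_N}},
    [/\ (#|Bad| * 9 ^ q.+1 <= N`! * d)%N,
        forall t u : {perm 'I_N}, {in A :|: A2, t =1 u} ->
          (t \in Bad) = (u \in Bad)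
      & forall (t : {perm 'I_N}) w, t \notin Bad ->
          \sum_(a in A) `|((v t (t a)) ^t* *m w) 0 0| ^+ 2 <= tau * normsq w].
Proof.
move=> v_dep eta0 B0 tau0 kN v_small v_frame bl dA Ak mtau.
have b0 : 0 <= b.
  have n0 : (0 : C) < (N - (k + #|A2|))%:R by rewrite ltr0n subn_gt0.
  by rewrite -(pmulr_lge0 _ n0); apply: le_trans bl; rewrite mulr_ge0.
pose X t := sampled_gram v t A.
exists [set t | ~~ (\tr ((X t) ^+ q.+1) <= tau ^+ q.+1)]; split.
- have := sum_trace_sampled_gram v_dep eta0 kN v_small v_frame B0 bl q.+1 dA Ak
    (lexx 0).
  set m := 0 + b + _ => H.
  have m0 : 0 <= m by rewrite /m add0r addr_ge0 // mulr_ge0.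
  set Bd := [set _ | _].
  have trX0 (t : {perm 'I_N}) : 0 <= \tr ((X t) ^+ q.+1).
    have [U [D [uU D0 XE]]] := psd_spectral (sampled_gram_psd v t A).
    rewrite /X XE unitary_diagX // mxtrace_unitary_diag //.
    by apply: sumr_ge0 => l _; rewrite mxE exprn_ge0.
  have H1 : #|Bd|%:R * tau ^+ q.+1 <= (N`!)%:R * (m ^+ q.+1 *+ d).
    apply: le_trans H.
    rewrite mulr_natl -sumr_const [leLHS]big_mkcond; apply: ler_sum => t _.
    rewrite -[_ + _]/(X t + 0%:M) raddf0 addr0 inE.
    case: ifP => [|_]; last exact: trX0.
    rewrite -real_ltNge ?realE ?trX0 ?exprn_ge0 ?(ltW tau0) //.
    exact: ltW.
  rewrite -(ler_nat C) -(ler_pM2r (exprn_gt0 q.+1 tau0)) !natrM natrX.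
  rewrite mulrAC; apply: le_trans (ler_wpM2r _ H1) _; first by rewrite exprn_ge0.
  rewrite -!mulrA ler_wpM2l // -[m ^+ _ *+ d]mulr_natl -mulrA ler_wpM2l //.
  rewrite -exprMn lerXn2r ?nnegrE ?mulr_ge0 ?(ltW tau0) //.
  by rewrite mulrC /m add0r.
- by move=> t u tu; rewrite !inE /X (sampled_gram_dep v_dep tu).
- move=> t w; rewrite inE negbK => trle.
  have := qform_le_of_trace (sampled_gram_psd v t A) (ltW tau0) trle w.
  apply: le_trans; rewrite /sampled_gram qform_sum.
  by apply: ler_sum => a _; rewrite qform_rank1.
Qed.

(** * Randomly chosen columns of a frame, and the part of the Gram matrix between two disjoint
    samples *)

Section RandomSubframe.
Variables (C : numClosedFieldType) (M N : nat) (F : 'M[C]_(M, N)).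
Variables (mu B : C).
Hypothesis F_unit : forall i, normsq (col i F) = 1.
Hypothesis F_coh : forall i j, i != j -> `|(F ^t* *m F) i j| <= mu.
Hypothesis F_adj : forall w, normsq (F ^t* *m w) <= B * normsq w.
Hypothesis B0 : 0 <= B.

Lemma col_trmxC_mul (w : 'cV[C]_M) i :
  ((col i F) ^t* *m w) 0 0 = (F ^t* *m w) i 0.
Proof. by rewrite !mxE; apply: eq_bigr => j _; rewrite !mxE. Qed.

Lemma gram_conj i j : (F ^t* *m F) i j = ((F ^t* *m F) j i)^*.
Proof.
rewrite !mxE rmorph_sum; apply: eq_bigr => l _.
by rewrite !mxE rmorphM /= conjCK mulrC.
Qed.

Section FixedSplit.
Variables (A1 A2 : {set 'I_N}).
Variables (b eta tau1 tau : C) (k q : nat).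
Hypothesis dA : [disjoint A1 & A2].
Hypothesis kN : (k < N)%N.
Hypothesis cA : (#|A1| + #|A2| <= k)%N.
Hypothesis bB : k%:R * B <= b * (N - k)%:R.
Hypothesis mu0 : 0 <= mu.
Hypotheses (eta0 : 0 < eta) (tau10 : 0 < tau1) (tau0 : 0 < tau).
Hypothesis q_eta : 9 * (b + q.+1%:R * mu ^+ 2) <= eta.
Hypothesis q_tau1 : 9 * (b + q.+1%:R) <= tau1.
Hypothesis q_tau : 9 * (b * tau1 + q.+1%:R * eta) <= tau.

Let cA2 : (#|A2| <= k)%N.
Proof. exact: leq_trans (leq_addl _ _) cA. Qed.

(** The moment estimate in dimension one. The sampled scalars are the entries of column [i] of the
    Gram matrix, with the diagonal one replaced by 0 so that all are at most [mu] in modulus. *)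
Lemma row_energy_tail i : exists Bad : {set {perm 'I_N}},
  [/\ (#|Bad| * 9 ^ q.+1 <= N`! * 1)%N,
      forall t u : {perm 'I_N}, {in A2 :|: set0, t =1 u} ->
        (t \in Bad) = (u \in Bad)
    & forall t : {perm 'I_N}, t \notin Bad ->
        \sum_(a in A2 | t a != i) `|(F ^t* *m F) (t a) i| ^+ 2 <= eta].
Proof.
pose v (t : {perm 'I_N}) j : 'cV[C]_1 :=
  if j == i then 0 else ((F ^t* *m F) j i)%:M.
have nv (z : C) : normsq (z%:M : 'cV[C]_1) = `|z| ^+ 2.
  by rewrite /normsq big_ord_recl big_ord0 addr0 mxE eqxx mulr1n.
have n0 : normsq (0 : 'cV[C]_1) = 0.
  by rewrite /normsq big_ord_recl big_ord0 addr0 mxE normr0 expr0n.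
have vE t j w : `|((v t j) ^t* *m w) 0 0| ^+ 2 =
   (if j == i then 0 else `|(F ^t* *m F) j i| ^+ 2) * normsq w.
  rewrite mxE big_ord_recl big_ord0 addr0 normrM exprMn.
  rewrite /normsq big_ord_recl big_ord0 addr0; congr (_ * _).
  rewrite mxE [(_ ^T) _ _]mxE norm_conjC /v; case: ifP => _.
    by rewrite mxE normr0 expr0n.
  by rewrite mxE eqxx mulr1n.
have [|||||||||||Bad [c d h]] := @sampled_gram_tail C N 1 A2 set0 v B b
    (mu ^+ 2) eta k q.
- by [].
- by rewrite exprn_ge0.
- by [].
- by [].
- by rewrite cards0 addn0.
- move=> t j _; rewrite /v; case: ifP => [_|/negbT ji].
    by rewrite n0 exprn_ge0.
  by rewrite nv lerXn2r ?nnegrE ?F_coh.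
- move=> t w; under eq_bigr do rewrite vE.
  rewrite -mulr_suml ler_wpM2r ?normsq_ge0 //.
  apply: (@le_trans _ _ (normsq (F ^t* *m col i F))); last first.
    by apply: le_trans (F_adj _) _; rewrite F_unit mulr1.
  rewrite /normsq big_mkcond; apply: ler_sum => j _.
  rewrite [col i F]colE mulmxA -colE [col _ _ _ _]mxE.
  by do 2?[case: ifP => _]; rewrite ?exprn_ge0.
- by rewrite cards0 addn0.
- by rewrite -setI_eq0 setI0.
- by [].
- by [].
exists Bad; split => // t tB.
have := h t 1%:M tB; rewrite nv normr1 expr1n mulr1; apply: le_trans.
rewrite [leRHS](eq_bigr _ (fun a _ => vE t (t a) 1%:M)).
rewrite big_mkcondr; apply: ler_sum => a _.
by rewrite nv normr1 expr1n mulr1; case: eqP.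
Qed.

(** Here the sampled vectors are the columns of [F] themselves, in dimension M; their unit norm is
    the value 1 taken for [eta]. *)
Lemma subframe_tail : exists Bad : {set {perm 'I_N}},
  [/\ (#|Bad| * 9 ^ q.+1 <= N`! * M)%N,
      forall t u : {perm 'I_N}, {in A2 :|: set0, t =1 u} ->
        (t \in Bad) = (u \in Bad)
    & forall (t : {perm 'I_N}) w, t \notin Bad ->
        \sum_(a in A2) `|(F ^t* *m w) (t a) 0| ^+ 2 <= tau1 * normsq w].
Proof.
have [|||||||||||Bad [c d h]] := @sampled_gram_tail C N M A2 set0
  (fun _ i => col i F) B b 1 tau1 k q.
- by [].
- by [].
- by [].
- by [].
- by rewrite cards0 addn0.
- by move=> t i _; rewrite F_unit.
- move=> t w; apply: le_trans (F_adj w).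
  rewrite /normsq big_mkcond; apply: ler_sum => j _.
  by rewrite col_trmxC_mul; case: ifP => _; rewrite ?exprn_ge0.
- by rewrite cards0 addn0.
- by rewrite -setI_eq0 setI0.
- by [].
- by rewrite mulr1.
exists Bad; split => // t w tB; apply: le_trans (h t w tB).
by apply: ler_sum => a _; rewrite col_trmxC_mul.
Qed.

(** Duality, with the same constant on both sides. The squared norm of [z] pairs the adjoint image
    of [z] with [w]; the arithmetic-geometric inequality with weight [c] makes half of it
    absorbable. *)
Lemma normsq_mul_supported (S : {set 'I_N}) (c : C) (w : 'cV[C]_N) :
  0 < c ->
  (forall z, \sum_(j in S) `|(F ^t* *m z) j 0| ^+ 2 <= c * normsq z) ->
  (forall i, i \notin S -> w i 0 = 0) ->
  normsq (F *m w) <= c * normsq w.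
Proof.
move=> c0 hS wS; pose z := F *m w; rewrite -/z.
have zE : normsq z = \sum_(j in S) ((F ^t* *m z) j 0)^* * w j 0.
  rewrite normsqE {2}/z mulmxA mxE [RHS]big_mkcond /=; apply: eq_bigr => j _.
  case: ifP => [_|/negbT jS]; last by rewrite wS // mulr0.
  congr (_ * _); rewrite -[F in LHS]trmxCK -trmxC_mul.
  by rewrite [LHS]mxE [(_ ^T) _ _]mxE.
have : normsq z <= \sum_(j in S)
    (`|(F ^t* *m z) j 0| ^+ 2 / (2 * c) + c / 2 * `|w j 0| ^+ 2).
  rewrite -[leLHS]ger0_norm ?normsq_ge0 // zE.
  apply: le_trans (ler_norm_sum _ _ _) _; apply: ler_sum => j _.
  rewrite normrM norm_conjC.
  move: (normr_ge0 ((F ^t* *m z) j 0)) (normr_ge0 (w j 0)).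
  move: `|_| `|w j 0| => x y x0 y0; rewrite -subr_ge0.
  have -> : x ^+ 2 / (2 * c) + c / 2 * y ^+ 2 - x * y =
     (x - c * y) ^+ 2 / (2 * c) by field; rewrite gt_eqF.
  apply: divr_ge0; last by rewrite mulr_ge0 ?(ltW c0).
  by rewrite -realEsqr realB ?realM // ger0_real // ltW.
rewrite big_split /= -mulr_suml -mulr_sumr => h1.
have h2 : normsq z <= normsq z / 2 + c / 2 * normsq w.
  apply: le_trans h1 _; apply: lerD.
    rewrite ler_pdivrMr ?mulr_gt0 //; apply: le_trans (hS z) _.
    by rewrite [2 * c]mulrC mulrA mulrAC divfK ?pnatr_eq0 // mulrC.
  rewrite ler_wpM2l ?divr_ge0 ?(ltW c0) // /normsq big_mkcond.
  by apply: ler_sum => j _; case: ifP => _; rewrite ?exprn_ge0.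
have h3 : normsq z / 2 <= c / 2 * normsq w.
  by rewrite -(lerD2l (normsq z / 2)) -splitr.
rewrite -(ler_pM2r (_ : 0 < 2^-1)) ?invr_gt0 //.
by rewrite mulrAC.
Qed.

(** The second layer. [sampled_gram_tail] wants its bounds for every permutation, whereas the first
    layer gives them outside [Bad1 :|: Bad2]; so [v t i], the column [i] of the Gram matrix cut down
    to [t @: A2], is set to zero on that set. In the count, N stands for the N row energies, M for
    the dimension of the columns, and the last N for the dimension of [v]. *)
Lemma split_tail : exists Bad : {set {perm 'I_N}},
  (#|Bad| * 9 ^ q.+1 <= N`! * (N + M + N))%N /\
  forall (t : {perm 'I_N}) (w : 'cV[C]_N), t \notin Bad ->
    (forall i, i \notin t @: A2 -> w i 0 = 0) ->
    \sum_(a in A1) `|(F ^t* *m (F *m w)) (t a) 0| ^+ 2 <= tau * normsq w.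
Proof.
have /fin_all_exists[BadR hR] := row_energy_tail.
have [Bad2 [c2 d2 h2]] := subframe_tail.
pose Bad1 := \bigcup_i BadR i.
have c1 : (#|Bad1| * 9 ^ q.+1 <= N`! * N)%N.
  have : (#|Bad1| <= \sum_i #|BadR i|)%N.
    rewrite /Bad1; elim/big_rec2: _ => [|i n D _ IH]; first by rewrite cards0.
    by apply: leq_trans (leq_card_setU _ _) _; rewrite leq_add2l.
  rewrite -(leq_pmul2r (expn_gt0 9 q.+1)) => h; apply: leq_trans h _.
  rewrite big_distrl /=; apply: (@leq_trans (\sum_(i < N) N`!)).
    by apply: leq_sum => i _; have [h _ _] := hR i; rewrite muln1 in h.
  by rewrite sum_nat_const card_ord mulnC.
pose v (t : {perm 'I_N}) i : 'cV[C]_N :=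
  \col_j (if (t \notin Bad1 :|: Bad2) && (j \in t @: A2)
          then (F ^t* *m F) j i else 0).
(* The truncation of [v] is transferred to the test vector, so that pairing with [v t i] becomes an
   entry of the full Gram matrix applied to [rs t w]. *)
pose rs (t : {perm 'I_N}) (w : 'cV[C]_N) : 'cV[C]_N :=
  \col_j (if (t \notin Bad1 :|: Bad2) && (j \in t @: A2) then w j 0 else 0).
have vE t i w : ((v t i) ^t* *m w) 0 0 = (F ^t* *m (F *m rs t w)) i 0.
  rewrite mulmxA !mxE; apply: eq_bigr => j _; rewrite [(_ ^ _) _ _]mxE.
  rewrite [(_ ^T) _ _]mxE [v _ _ _ _]mxE [rs _ _ _ _]mxE.
  by case: ifP => _; rewrite ?conjC0 ?mul0r ?mulr0 // gram_conj conjCK.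
have rs_le t w : normsq (rs t w) <= normsq w.
  apply: ler_sum => j _; rewrite mxE; case: ifP => // _.
  by rewrite normr0 expr0n exprn_ge0.
have Bad_dep (t u : {perm 'I_N}) : {in A2, t =1 u} ->
    (t \in Bad1 :|: Bad2) = (u \in Bad1 :|: Bad2).
  move=> tu; have tu' : {in A2 :|: set0, t =1 u} by rewrite setU0.
  rewrite !in_setU (d2 _ _ tu'); congr (_ || _).
  by apply/bigcupP/bigcupP => -[i _ ti]; exists i => //;
    have [_ h _] := hR i; rewrite -?(h _ _ tu') // (h _ _ tu').
have v_dep (t u : {perm 'I_N}) : {in A2, t =1 u} -> v t =1 v u.
  move=> tu i; apply/matrixP => j l; rewrite !mxE (Bad_dep t u tu).
  by rewrite (eq_in_imset tu).
(* The sample size [k - #|A2|] leaves [N - k] values unsampled. The frame constant [B * tau1]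
   composes the bound for the adjoint with the bound for [F] on the columns in [t @: A2]. *)
have [|||||||||||Bad [c _ h]] := @sampled_gram_tail C N N A1 A2 v
    (B * tau1) (b * tau1) eta tau (k - #|A2|) q.
- exact: v_dep.
- exact: ltW.
- by rewrite mulr_ge0 // ltW.
- by [].
- by rewrite subnK.
- move=> t i itA; rewrite /normsq; under eq_bigr do rewrite mxE.
  have [tB|tB] := boolP (t \in Bad1 :|: Bad2).
    by rewrite big1 ?(ltW eta0) // => j _; rewrite normr0 expr0n.
  have ti : t \notin BadR i.
    apply: contra tB => tB; rewrite in_setU; apply/orP; left.
    by apply/bigcupP; exists i.
  have [_ _ /(_ t ti)] := hR i; apply: le_trans.
  rewrite (reindex_inj (@perm_inj _ t)) /= [leRHS]big_mkcond /=.
  apply: ler_sum => a _; rewrite mem_imset; last exact: perm_inj.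
  case: (boolP (a \in A2)) => [aA|_] /=; last by rewrite normr0 expr0n.
  by rewrite (_ : t a != i) //; apply: contraNneq itA => <-; rewrite imset_f.
- move=> t w; have [tB|tB] := boolP (t \in Bad1 :|: Bad2).
    rewrite big1; first by rewrite !mulr_ge0 ?normsq_ge0 // ltW.
    move=> i _; rewrite vE (_ : rs t w = 0) ?mulmx0 ?mxE ?normr0 ?expr0n //.
    by apply/matrixP => j l; rewrite !mxE tB.
  apply: (@le_trans _ _ (normsq (F ^t* *m (F *m rs t w)))).
    rewrite /normsq big_mkcond; apply: ler_sum => i _; rewrite vE.
    by case: ifP => _; rewrite ?exprn_ge0.
  apply: le_trans (F_adj _) _; rewrite -mulrA ler_wpM2l //.
  apply: (@le_trans _ _ (tau1 * normsq (rs t w))); last first.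
    by rewrite ler_wpM2l // ltW.
  apply: (@normsq_mul_supported (t @: A2)) => // [z|j jA]; last first.
    by rewrite mxE (negbTE jA) andbF.
  have t2 : t \notin Bad2.
    by apply: contra tB => tB; rewrite in_setU tB orbT.
  apply: le_trans (h2 t z t2).
  by rewrite big_imset //=; move=> a a' _ _; apply: perm_inj.
- rewrite subnK // mulrA [leRHS]mulrAC ler_wpM2r ?(ltW tau10) //.
  by apply: le_trans bB; rewrite ler_wpM2r // ler_nat leq_subr.
- by [].
- by rewrite leq_subRL ?cA2 // addnC.
- by [].
exists (Bad1 :|: Bad2 :|: Bad); split.
  rewrite !mulnDr; apply: (@leq_trans ((#|Bad1| + #|Bad2| + #|Bad|) * 9 ^ q.+1)).
    rewrite leq_mul2r; apply/orP; right.
    apply: leq_trans (leq_card_setU _ _) _; rewrite leq_add2r.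
    exact: leq_card_setU.
  by rewrite !mulnDl !leq_add.
move=> t w; rewrite in_setU negb_or => /andP[t12 tB] wS.
have := h t w tB; apply: le_trans; apply: ler_sum => a _.
rewrite vE (_ : rs t w = w) //; apply/matrixP => j l; rewrite !mxE t12 /=.
by rewrite (ord1 l); case: ifP => // /negbT /wS ->.
Qed.

End FixedSplit.
End RandomSubframe.

(** * Counting the subsets that contain or separate given points *)

Section Splits.
Variable T : finType.

Lemma card_all_sets : #|{: {set T}}| = (2 ^ #|T|)%N.
Proof. by rewrite -[in RHS]cardsT -card_powerset powersetT cardsT. Qed.

Lemma card_sets_with (a : T) : (#|[set E : {set T} | a \in E]| * 2 = 2 ^ #|T|)%N.
Proof.
rewrite -card_all_sets -(cardsC [set E : {set T} | a \in E]) muln2 -addnn.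
congr (_ + _)%N.
rewrite -(card_imset _ (@setC_inj T)); apply: eq_card => E.
apply/imsetP/idP => [[D]|]; rewrite !inE.
  by move=> aD ->; rewrite !inE aD.
by move=> aE; exists (~: E); rewrite ?inE ?setCK.
Qed.

Lemma card_splits (a b : T) : a != b ->
  (#|[set E : {set T} | (a \in E) && (b \notin E)]| * 4 = 2 ^ #|T|)%N.
Proof.
move=> ab.
have -> : [set E : {set T} | (a \in E) && (b \notin E)] =
    [set a |: E | E in powerset (~: [set a; b])].
  apply/setP => E; apply/idP/imsetP => [|[D]]; rewrite !inE.
    move=> /andP[aE bE]; exists (E :\ a); last by rewrite setD1K.
    rewrite inE; apply/subsetP => x; rewrite !inE negb_or => /andP[-> xE] /=.
    by apply: contraNneq bE => <-.
  move=> /subsetP DS ->; rewrite !inE eqxx /= negb_or eq_sym ab /=.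
  by apply/negP => /DS; rewrite !inE eqxx orbT.
rewrite card_in_imset => [|D E]; last first.
  rewrite !inE => /subsetP DS /subsetP ES DE; apply/setP => x.
  have := congr1 (fun A : {set T} => x \in A) DE; rewrite !inE.
  case: eqVneq => //= -> _.
  by apply/idP/idP => [/DS|/ES]; rewrite !inE eqxx.
rewrite card_powerset (_ : 4 = 2 ^ 2)%N // -expnD; congr (_ ^ _)%N.
by rewrite -(cardsC [set a; b]) cards2 ab addnC.
Qed.

End Splits.

(** * Decoupling the hollow Gram form over all splits of the support *)

Section Decoupling.
Variables (C : numClosedFieldType) (M N : nat) (F : 'M[C]_(M, N)).
Variables (mu B : C).
Hypothesis F_unit : forall i, normsq (col i F) = 1.
Hypothesis F_coh : forall i j, i != j -> `|(F ^t* *m F) i j| <= mu.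
Hypothesis F_adj : forall w, normsq (F ^t* *m w) <= B * normsq w.
Hypothesis B0 : 0 <= B.
Variables (A : {set 'I_N}).
Variables (b eta tau1 kappa : C) (q Theta : nat).
Hypothesis kN : (#|A| < N)%N.
Hypothesis bB : #|A|%:R * B <= b * (N - #|A|)%:R.
Hypothesis mu0 : 0 <= mu.
Hypothesis mu1 : mu <= 1.
Hypotheses (eta0 : 0 < eta) (tau10 : 0 < tau1) (kappa0 : 0 < kappa).
Hypothesis q_eta : 9 * (b + q.+1%:R * mu ^+ 2) <= eta.
Hypothesis q_tau1 : 9 * (b + q.+1%:R) <= tau1.
Hypothesis q_tau : 9 * (b * tau1 + q.+1%:R * eta) <= kappa ^+ 2.
Hypothesis Theta0 : (0 < Theta)%N.

Lemma amgm_weighted (x y : C) : 0 <= x -> 0 <= y ->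
  x * y <= kappa / 2 * x ^+ 2 + (2 * kappa)^-1 * y ^+ 2.
Proof.
move=> x0 y0; rewrite -subr_ge0.
have -> : kappa / 2 * x ^+ 2 + (2 * kappa)^-1 * y ^+ 2 - x * y =
   (kappa * x - y) ^+ 2 / (2 * kappa) by field; rewrite gt_eqF.
apply: divr_ge0; last by rewrite mulr_ge0 ?(ltW kappa0).
by rewrite -realEsqr realB ?realM // ger0_real // ltW.
Qed.

Lemma amgm (x y : C) : 0 <= x -> 0 <= y -> x * y <= (x ^+ 2 + y ^+ 2) / 2.
Proof.
move=> x0 y0; rewrite -subr_ge0.
have -> : (x ^+ 2 + y ^+ 2) / 2 - x * y = (x - y) ^+ 2 / 2 by field.
by apply: divr_ge0 => //; rewrite -realEsqr realB ?ger0_real.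
Qed.

(* Decoupling: each ordered pair of distinct positions is separated by a quarter
   of the subsets E, and [split_tail] bounds the part of the form going from
   A :&: E to A :\: E. A permutation is bad when more than a fraction 1/Theta of
   the subsets are bad for it; the bad subsets of a good permutation are bounded
   trivially, whence the term 2 N / Theta. *)
Lemma hollow_gram_tail : exists Bad : {set {perm 'I_N}},
  (#|Bad| * 9 ^ q.+1 <= N`! * (N + M + N) * Theta)%N /\
  forall (t : {perm 'I_N}) (u w : 'cV[C]_N), t \notin Bad ->
    (forall i, i \notin t @: A -> u i 0 = 0) ->
    (forall i, i \notin t @: A -> w i 0 = 0) ->
    `|\sum_i \sum_(j | j != i) (u i 0)^* * (F ^t* *m F) i j * w j 0| <=
    (kappa + 2 * N%:R / Theta%:R) * (normsq u + normsq w).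
Proof.
have /fin_all_exists[BadE hE] : forall E : {set 'I_N},
    exists Bad : {set {perm 'I_N}},
    (#|Bad| * 9 ^ q.+1 <= N`! * (N + M + N))%N /\
    forall (t : {perm 'I_N}) (w : 'cV[C]_N), t \notin Bad ->
      (forall i, i \notin t @: (A :\: E) -> w i 0 = 0) ->
      \sum_(a in A :&: E) `|(F ^t* *m (F *m w)) (t a) 0| ^+ 2 <=
        kappa ^+ 2 * normsq w.
  move=> E; apply: (split_tail F_unit F_coh F_adj B0 _ kN _ bB mu0 eta0 tau10
    (exprn_gt0 2 kappa0) q_eta q_tau1 q_tau).
    by rewrite -setI_eq0 setIDA setIAC setDIl setDv setI0 ?set0I.
  by rewrite cardsID.
pose nb (t : {perm 'I_N}) := #|[set E | t \in BadE E]|.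
(* Markov's inequality over the permutations, after exchanging the sums over permutations and
   subsets. *)
exists [set t | (2 ^ N < nb t * Theta)%N]; split.
  set Bad := [set _ | _].
  have h1 : (#|Bad| * 2 ^ N <= \sum_t nb t * Theta)%N.
    rewrite -sum_nat_const big_mkcond; apply: leq_sum => t _.
    by rewrite inE; case: ifP => // /ltnW.
  have h2 : (\sum_t nb t = \sum_E #|BadE E|)%N.
    transitivity (\sum_t \sum_E (t \in BadE E : nat))%N.
      apply: eq_bigr => t _; rewrite /nb -sum1_card big_mkcond.
      by apply: eq_bigr => E _; rewrite inE; case: (_ \in _).
    rewrite exchange_big; apply: eq_bigr => E _.
    by rewrite -sum1_card [RHS]big_mkcond; apply: eq_bigr => t _; case: (_ \in _).
  have h3 : ((\sum_E #|BadE E|) * 9 ^ q.+1 <= 2 ^ N * (N`! * (N + M + N)))%N.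
    rewrite big_distrl /=.
    apply: (@leq_trans (\sum_(E : {set 'I_N}) (N`! * (N + M + N)))%N).
      by apply: leq_sum => E _; have [] := hE E.
    by rewrite sum_nat_const card_all_sets card_ord.
  rewrite -(leq_pmul2r (expn_gt0 2 N)) mulnAC.
  apply: leq_trans (leq_mul h1 (leqnn _)) _.
  rewrite -big_distrl /= h2 mulnAC; apply: leq_trans (leq_mul h3 (leqnn _)) _.
  by rewrite -!mulnA mulnC -!mulnA.
move=> t u w; rewrite inE -leqNgt => nbt uS wS.
pose G := F ^t* *m F; pose S := normsq u + normsq w.
pose h a a' := (u (t a) 0)^* * G (t a) (t a') * w (t a') 0.
have tA a : (t a \in t @: A) = (a \in A) by rewrite mem_imset //; apply: perm_inj.
have h0l a a' : a \notin A -> h a a' = 0.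
  by move=> aA; rewrite /h uS ?tA // conjC0 !mul0r.
have h0r a a' : a' \notin A -> h a a' = 0.
  by move=> aA; rewrite /h wS ?tA // mulr0.
have QE : \sum_i \sum_(j | j != i) (u i 0)^* * (F ^t* *m F) i j * w j 0 =
    \sum_a \sum_(a' | a' != a) h a a'.
  rewrite (reindex_inj (@perm_inj _ t)); apply: eq_bigr => a _.
  rewrite (reindex_inj (@perm_inj _ t)); apply: eq_bigl => a'.
  by rewrite (inj_eq perm_inj).
rewrite {}QE; set Q := \sum_a _.
pose qE (E : {set 'I_N}) := \sum_(a in E) \sum_(a' | a' \notin E) h a a'.
have NE : #|{: 'I_N}| = N by rewrite card_ord.
have sumq : (\sum_E qE E) * 4 = 2 ^+ N * Q.
  transitivity ((\sum_a \sum_a' \sum_(E : {set 'I_N})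
      (if (a \in E) && (a' \notin E) then h a a' else 0)) * 4).
    congr (_ * _); rewrite [RHS](eq_bigr _ (fun a _ => exchange_big _ _ _ _ _ _)).
    rewrite exchange_big /=; apply: eq_bigr => E _.
    rewrite /qE big_mkcond; apply: eq_bigr => a _; case: ifP => aE /=.
      by rewrite big_mkcond.
    by rewrite big1.
  rewrite mulr_suml /Q mulr_sumr; apply: eq_bigr => a _.
  rewrite mulr_suml mulr_sumr [RHS]big_mkcond; apply: eq_bigr => a' _.
  rewrite -big_mkcond sumr_const -(mulr_natr (h a a')) -mulrA -natrM.
  case: eqVneq => [->|ne] /=.
    by rewrite (eq_card0 (_ : _ =i pred0)) ?mulr0 // => E; exact: andbN.
  have := card_splits (_ : a != a'); rewrite NE => cs.
  rewrite mulrC -natrX -cs; last by rewrite eq_sym.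
  by rewrite cardsE.
have nS0 : 0 <= S by rewrite addr_ge0 ?normsq_ge0.
have uE : normsq u = \sum_a `|u (t a) 0| ^+ 2.
  exact: (reindex_inj (@perm_inj _ t)).
have wE : normsq w = \sum_a `|w (t a) 0| ^+ 2.
  exact: (reindex_inj (@perm_inj _ t)).
have bad_le E : `|qE E| <= N%:R / 2 * S.
  apply: le_trans (ler_norm_sum _ _ _) _.
  apply: (@le_trans _ _ (\sum_a \sum_a' (`|u (t a) 0| ^+ 2 + `|w (t a') 0| ^+ 2) / 2)).
    rewrite big_mkcond; apply: ler_sum => a _; case: ifP => aE; last first.
      apply: sumr_ge0 => a' _.
      by apply: divr_ge0 => //; apply: addr_ge0; apply: exprn_ge0.
    apply: le_trans (ler_norm_sum _ _ _) _.
    rewrite big_mkcond; apply: ler_sum => a' _; case: ifP => a'E; last first.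
      by apply: divr_ge0 => //; apply: addr_ge0; apply: exprn_ge0.
    apply: le_trans (amgm _ _) => //; rewrite !normrM norm_conjC mulrAC.
    rewrite ler_piMr ?mulr_ge0 //; apply: le_trans mu1; apply: F_coh.
    by rewrite (inj_eq perm_inj); apply: contraNneq a'E => <-.
  under eq_bigr do rewrite -mulr_suml big_split /= -wE sumr_const card_ord.
  rewrite -mulr_suml big_split /= sumrMnl -uE sumr_const card_ord /S.
  by rewrite -mulrnDl -[_ *+ N]mulr_natl mulrAC.
(* The weight [kappa] balances the two halves: the energy of the Gram image is at most [kappa ^+ 2]
   times that of [w2], and the factor [(2 * kappa)^-1] brings this back to [kappa / 2]. *)
have good_le E : t \notin BadE E -> `|qE E| <=
    kappa / 2 * (\sum_(a in E) `|u (t a) 0| ^+ 2 +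
                 \sum_(a | a \notin E) `|w (t a) 0| ^+ 2).
  move=> tE; pose w2 : 'cV[C]_N := \col_i (if i \in t @: (A :\: E) then w i 0 else 0).
  have [_ /(_ t w2 tE)] := hE E.
  have w2S i : i \notin t @: (A :\: E) -> w2 i 0 = 0.
    by move=> iS; rewrite mxE (negbTE iS).
  move=> /(_ w2S) h1.
  have qEE : qE E = \sum_(a in A :&: E) (u (t a) 0)^* * (F ^t* *m (F *m w2)) (t a) 0.
    rewrite /qE big_mkcond [RHS]big_mkcond; apply: eq_bigr => a _.
    rewrite inE; case: (boolP (a \in A)) => aA /=; last first.
      by case: ifP => // _; rewrite big1 // => a' _; rewrite h0l.
    case: ifP => // aE; rewrite mulmxA [(_ *m w2) _ _]mxE mulr_sumr.
    rewrite [RHS](reindex_inj (@perm_inj _ t)) big_mkcond; apply: eq_bigr => a' _.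
    rewrite [w2 _ _]mxE mem_imset ?inE; last exact: perm_inj.
    rewrite /h mulrA; case: (boolP (a' \in E)) => //= _; first by rewrite mulr0.
    by case: (boolP (a' \in A)) => //= aA'; rewrite wS ?tA.
  rewrite qEE; apply: le_trans (ler_norm_sum _ _ _) _.
  apply: (@le_trans _ _ (\sum_(a in A :&: E) (kappa / 2 * `|u (t a) 0| ^+ 2 +
      (2 * kappa)^-1 * `|(F ^t* *m (F *m w2)) (t a) 0| ^+ 2))).
    by apply: ler_sum => a _; rewrite normrM norm_conjC amgm_weighted.
  rewrite big_split /= -!mulr_sumr mulrDr; apply: lerD.
    rewrite ler_wpM2l ?divr_ge0 ?(ltW kappa0) //.
    rewrite big_mkcond [leRHS]big_mkcond; apply: ler_sum => a _.
    by rewrite inE andbC; case: (a \in E) => //=; case: ifP => _; rewrite ?exprn_ge0.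
  apply: (@le_trans _ _ ((2 * kappa)^-1 * (kappa ^+ 2 * normsq w2))).
    by rewrite ler_wpM2l // invr_ge0 mulr_ge0 ?(ltW kappa0).
  have -> : (2 * kappa)^-1 * (kappa ^+ 2 * normsq w2) = kappa / 2 * normsq w2.
    by field; rewrite gt_eqF.
  rewrite ler_wpM2l ?divr_ge0 ?(ltW kappa0) //.
  rewrite /normsq (reindex_inj (@perm_inj _ t)) [leRHS]big_mkcond.
  apply: ler_sum => a _; rewrite mxE mem_imset ?inE; last exact: perm_inj.
  case: (a \in E) => /=; first by rewrite normr0 expr0n.
  by case: ifP => // _; rewrite normr0 expr0n exprn_ge0.
have half_l : (\sum_(E : {set 'I_N}) \sum_(a in E) `|u (t a) 0| ^+ 2) =
    2 ^+ N / 2 * normsq u.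
  rewrite (exchange_big_dep xpredT) //= uE mulr_sumr; apply: eq_bigr => a _.
  rewrite sumr_const -[LHS]mulr_natl; congr (_ * _).
  have := card_sets_with a; rewrite cardsE NE => cs.
  by apply: (mulIf (_ : 2 != 0)); rewrite ?pnatr_eq0 // divfK ?pnatr_eq0 // -natrM cs natrX.
have half_r : (\sum_(E : {set 'I_N}) \sum_(a | a \notin E) `|w (t a) 0| ^+ 2) =
    2 ^+ N / 2 * normsq w.
  rewrite (exchange_big_dep xpredT) //= wE mulr_sumr; apply: eq_bigr => a _.
  rewrite sumr_const -[LHS]mulr_natl; congr (_ * _).
  have cs := card_sets_with a; rewrite NE in cs.
  have cC := cardsC [set E : {set 'I_N} | a \in E].
  have E2 : #|{: {set 'I_N}}| = (2 ^ N)%N.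
    by rewrite card_all_sets card_ord.
  have -> : #|[pred E : {set 'I_N} | a \notin E]| = #|~: [set E : {set 'I_N} | a \in E]|.
    by apply: eq_card => E; rewrite !inE.
  apply: (mulIf (_ : 2 != 0)); rewrite ?pnatr_eq0 // divfK ?pnatr_eq0 // -natrM -natrX.
  congr (_%:R); move: cC; rewrite E2 -cs muln2 -addnn => /addnI ->; rewrite addnn muln2 //.
(* Each index lies in half of the subsets and outside the other half, which gives [kappa / 4]; the
   factor 4 of [sumq] then restores [kappa]. *)
have sum_le : \sum_E `|qE E| <= 2 ^+ N * S * (kappa / 4 + N%:R / (2 * Theta%:R)).
  apply: (@le_trans _ _ (\sum_(E : {set 'I_N}) (kappa / 2 *
      (\sum_(a in E) `|u (t a) 0| ^+ 2 +
       \sum_(a | a \notin E) `|w (t a) 0| ^+ 2) +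
      (if t \in BadE E then N%:R / 2 * S else 0)))).
    apply: ler_sum => E _; case: ifP => [_|/negbT tE]; last first.
      by rewrite addr0 good_le.
    rewrite -[leLHS]add0r; apply: lerD => //.
    apply: mulr_ge0; first by rewrite divr_ge0 // ltW.
    by apply: addr_ge0; apply: sumr_ge0 => ? _; rewrite exprn_ge0.
  rewrite big_split /= -mulr_sumr big_split /= half_l half_r -mulrDr -/S.
  rewrite -big_mkcond sumr_const (_ : #|_| = nb t); last first.
    by apply: eq_card => E; rewrite !inE.
  have nbR : (nb t)%:R * Theta%:R <= 2 ^+ N :> C by rewrite -natrM -natrX ler_nat.
  have Th0 : (0 : C) < Theta%:R by rewrite ltr0n.
  rewrite [leRHS]mulrDr; apply: lerD.
    by rewrite le_eqVlt; apply/orP; left; apply/eqP; field.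
  rewrite -(ler_pM2r Th0).
  have -> : 2 ^+ N * S * (N%:R / (2 * Theta%:R)) * Theta%:R =
     2 ^+ N * (N%:R / 2 * S) by field; rewrite pnatr_eq0 -lt0n.
  rewrite -[_ *+ nb t]mulr_natl mulrAC ler_wpM2r // mulr_ge0 // divr_ge0 //.
have N2 : (0 : C) < 2 ^+ N by rewrite exprn_gt0.
rewrite -(ler_pM2l N2) -[X in X * `|Q|]ger0_norm ?(ltW N2) // -normrM -sumq.
rewrite normrM [`|4|]ger0_norm //.
apply: (@le_trans _ _ ((2 ^+ N * S * (kappa / 4 + N%:R / (2 * Theta%:R))) * 4)).
  by rewrite ler_wpM2r //; apply: le_trans (ler_norm_sum _ _ _) sum_le.
rewrite le_eqVlt; apply/orP; left; apply/eqP; rewrite /S; field.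
by rewrite pnatr_eq0 -lt0n.
Qed.

End Decoupling.

(** * Linear statistics of a random permutation *)

Section PermutationMgf.
Variable R : realType.

(** For [x <= 1 / 2] compare with [(1 - x)^-1]; beyond that already x <= 2 x^2. The linear term
    stays outside the exponential so that it cancels when summed over centred values. *)
Lemma expR_le_add_sqr (x : R) : expR x <= x + expR (2 * x ^+ 2).
Proof.
have h1 := expR_ge1Dx (2 * x ^+ 2).
have [x2|x2] := lerP x (1 / 2); last first.
  have : expR x <= expR (2 * x ^+ 2) by rewrite ler_expR; nra.
  lra.
suff : expR x <= 1 + x + 2 * x ^+ 2 by lra.
have h2 := expR_ge1Dx (- x).
have x1 : 0 < 1 - x by lra.
have -> : expR x = (expR (- x))^-1 by rewrite expRN invrK.
apply: (@le_trans _ _ (1 - x)^-1).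
  by rewrite lef_pV2 ?posrE ?expR_gt0.
rewrite -[leLHS]mul1r ler_pdivrMr //.
have := sqr_ge0 x; nra.
Qed.

(** Hoeffding's lemma for the uniform law on [J], with the crude constant 2: values of oscillation
    at most [g] lie within [g] of their mean. *)
Lemma sum_expR_le (I : finType) (J : pred I) (f : I -> R) (g : R) (j0 : I) :
  J j0 -> 0 <= g ->
  (forall i j, J i -> J j -> `|f i - f j| <= g) ->
  \sum_(i | J i) expR (f i) <=
  #|J|%:R * expR ((\sum_(i | J i) f i) / #|J|%:R + 2 * g ^+ 2).
Proof.
move=> Jj0 g0 fg; set m := _ / _.
have J0 : (0 : R) < #|J|%:R by rewrite ltr0n; apply/card_gt0P; exists j0.
have dev i : J i -> `|f i - m| <= g.
  move=> Ji; rewrite -(ler_pM2r J0) -[X in _ * X <= _]ger0_norm ?(ltW J0) //.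
  rewrite -normrM mulrBl /m divfK ?gt_eqF // mulr_natr -sumr_const.
  rewrite -[X in `|X - _|]/(\sum_(i0 in J) f i) (_ : \sum_(i0 in J) f i = \sum_(i0 | J i0) f i) //.
  rewrite -sumrB; apply: le_trans (ler_norm_sum _ _ _) _.
  by rewrite mulr_natr -sumr_const; apply: ler_sum => j Jj; apply: fg.
have mean0 : \sum_(i | J i) (f i - m) = 0.
  rewrite sumrB; apply/eqP; rewrite subr_eq0; apply/eqP.
  by rewrite -[RHS]/(\sum_(i in J) m) sumr_const -mulr_natr /m divfK ?gt_eqF.
rewrite expRD mulrCA.
have -> : \sum_(i | J i) expR (f i) = expR m * \sum_(i | J i) expR (f i - m).
  by rewrite mulr_sumr; apply: eq_bigr => i _; rewrite -expRD addrC subrK.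
rewrite ler_wpM2l ?expR_ge0 //.
apply: (@le_trans _ _ (\sum_(i | J i) ((f i - m) + expR (2 * g ^+ 2)))).
  apply: ler_sum => i Ji; apply: le_trans (expR_le_add_sqr _) _.
  rewrite lerD2l ler_expR ler_wpM2l // -[leLHS]real_normK ?num_real //.
  by rewrite lerXn2r ?nnegrE ?dev.
rewrite big_split /= mean0 add0r [leRHS]mulr_natl.
by rewrite -[leLHS]/(\sum_(i in J) expR (2 * g ^+ 2)) sumr_const.
Qed.

Variables (N : nat) (r s : 'I_N -> R) (g zeta C0 : R) (k : nat).
Hypothesis r0 : \sum_i r i = 0.
Hypothesis s0 : \sum_i s i = 0.
Hypothesis g0 : 0 <= g.
Hypothesis rs_osc : forall i j, (r i - r j) ^+ 2 + (s i - s j) ^+ 2 <= g.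
Hypothesis zeta0 : 0 < zeta.
Hypothesis kN : (k < N)%N.
Hypothesis C00 : 0 <= C0.
Hypothesis C0_large :
  2 + C0 * ((1 + zeta^-1) * k%:R / (N - k)%:R ^+ 2) <= C0.

(* Revealing t on all of A but a recenters the law of t a; the drift is itself
   a linear statistic of the revealed part and is absorbed by shifting the
   other coefficients by (p a, q a) / (N - #|A| + 1). *)
Lemma perm_linear_mgf (A : {set 'I_N}) (p q : 'I_N -> R) :
  (#|A| <= k)%N ->
  \sum_(t : {perm 'I_N}) expR (\sum_(a in A) (p a * r (t a) + q a * s (t a))) <=
  (N`!)%:R *
  expR (C0 * g * (1 + zeta) ^+ #|A| * \sum_(a in A) (p a ^+ 2 + q a ^+ 2)).
Proof.
move: {2}#|A| (erefl #|A|) => n; elim: n A p q => [|n IH] A p q.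
  move=> /eqP; rewrite cards_eq0 => /eqP -> _.
  under eq_bigr do rewrite big_set0 expR0.
  by rewrite big_set0 mulr0 expR0 sumr_const card_Sn mulr1.
move=> An Ak; have /card_gt0P[a aA] : (0 < #|A|)%N by rewrite An.
pose D := A :\ a; have Dn : #|D| = n.
  by apply/eqP; rewrite -eqSS -An (cardsD1 a A) aA.
have aD : a \notin D by rewrite !inE eqxx.
have nk : (n < k)%N by rewrite -An.
pose nu : R := (N - n)%:R.
have nu0 : 0 < nu by rewrite ltr0n subn_gt0 (ltn_trans nk).
have nukN : (N - k)%:R <= nu by rewrite ler_nat leq_sub2l // ltnW.
have Nk0 : 0 < (N - k)%:R :> R by rewrite ltr0n subn_gt0.
pose S (t : {perm 'I_N}) := \sum_(a in D) (p a * r (t a) + q a * s (t a)).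
pose f i := p a * r i + q a * s i.
pose phi t i := expR (S t) * expR (f i).
have phi_dep (t u : {perm 'I_N}) : {in D, t =1 u} -> phi t =1 phi u.
  move=> tu i; rewrite /phi; congr (expR _ * _); apply: eq_bigr => x xD.
  by rewrite (tu x xD).
have splitA (h : 'I_N -> R) : \sum_(x in A) h x = h a + \sum_(x in D) h x.
  rewrite (bigD1 a) //=; congr (_ + _); apply: eq_bigl => x.
  by rewrite !inE andbC.
rewrite (eq_bigr (fun t : {perm 'I_N} => phi t (t a))); last first.
  by move=> t _; rewrite splitA expRD mulrC.
rewrite -(ler_pM2r nu0) mulr_natr -{1}Dn (sum_perm_exchange aD phi_dep).
pose gam := Num.sqrt (g * (p a ^+ 2 + q a ^+ 2)).
have gam2 : gam ^+ 2 = g * (p a ^+ 2 + q a ^+ 2).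
  by rewrite sqr_sqrtr // mulr_ge0 // addr_ge0 ?sqr_ge0.
have f_osc i j : `|f i - f j| <= gam.
  rewrite -(@ler_pXn2r _ 2) ?nnegrE ?sqrtr_ge0 // gam2 real_normK ?num_real //.
  apply: (@le_trans _ _ (((r i - r j) ^+ 2 + (s i - s j) ^+ 2) *
      (p a ^+ 2 + q a ^+ 2))); last first.
    by rewrite ler_wpM2r ?rs_osc // addr_ge0 ?sqr_ge0.
  rewrite -subr_ge0 /f (_ : _ - _ =
    (p a * (s i - s j) - q a * (r i - r j)) ^+ 2) ?sqr_ge0 //; ring.
pose p' x := p x - p a / nu; pose q' x := q x - q a / nu.
(* As [r] and [s] sum to zero, [f] sums over the unrevealed values to minus its sum over the
   revealed ones; divided by [nu], this is the drift. *)
have mean (t : {perm 'I_N}) :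
    S t + (\sum_(i | i \notin t @: D) f i) / nu =
    \sum_(x in D) (p' x * r (t x) + q' x * s (t x)).
  have fall : \sum_i f i = 0 by rewrite big_split /= -!mulr_sumr r0 s0; lra.
  have -> : \sum_(i | i \notin t @: D) f i = - \sum_(x in D) f (t x).
    apply/eqP; rewrite -addr_eq0; apply/eqP; rewrite -[RHS]fall.
    rewrite [RHS](bigID (mem (t @: D))) /= addrC; congr (_ + _).
    by rewrite big_imset //=; move=> x y _ _; apply: perm_inj.
  rewrite mulNr mulr_suml -sumrB; apply: eq_bigr => x _.
  by rewrite /f /p' /q'; field; rewrite gt_eqF.
have cJ (t : {perm 'I_N}) : #|[pred i | i \notin t @: D]|%:R = nu.
  have -> : #|[pred i | i \notin t @: D]| = #|~: (t @: D)|.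
    by apply: eq_card => i; rewrite !inE.
  by rewrite cardsCs setCK card_ord card_imset ?Dn //; apply: perm_inj.
have step (t : {perm 'I_N}) : \sum_(i | i \notin t @: D) phi t i <=
   nu * expR (2 * gam ^+ 2) *
   expR (\sum_(x in D) (p' x * r (t x) + q' x * s (t x))).
  rewrite -mulr_sumr.
  have taD : t a \notin t @: D by rewrite mem_imset //; apply: perm_inj.
  have := @sum_expR_le _ (fun i => i \notin t @: D) f gam (t a) taD
    (sqrtr_ge0 _) (fun i j _ _ => f_osc i j).
  rewrite cJ => h; apply: le_trans (ler_wpM2l (expR_ge0 _) h) _.
  rewrite -mean [expR (S t + _)]expRD [expR (_ / _ + _)]expRD.
  by rewrite le_eqVlt; apply/orP; left; apply/eqP; ring.
apply: le_trans (ler_sum _ (fun t _ => step t)) _.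
rewrite -mulr_sumr; have Dk : (#|D| <= k)%N by rewrite Dn ltnW.
apply: le_trans (ler_wpM2l _ (IH D p' q' Dn Dk)) _.
  by rewrite mulr_ge0 ?expR_ge0 // ltW.
have mE (x y z : R) : nu * x * (y * z) = y * (x * z) * nu by ring.
rewrite mE -expRD ler_pM2r // ler_wpM2l // ler_expR gam2 Dn An splitA.
set X := p a ^+ 2 + q a ^+ 2; set Y := \sum_(x in D) _; set Y' := \sum_(x in D) _.
have X0 : 0 <= X by rewrite addr_ge0 ?sqr_ge0.
(* Young's inequality with parameter [zeta] separates the drift. One part inflates the constant by
   [1 + zeta] per revealed position; the other returns a multiple of [X], which [C0_large] absorbs
   together with the 2 of [sum_expR_le]. *)
have YY : Y <= (1 + zeta) * Y' + (1 + zeta^-1) * (n%:R * (X / nu ^+ 2)).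
  have zi0 : 0 < zeta^-1 by rewrite invr_gt0.
  have -> : (1 + zeta) * Y' + (1 + zeta^-1) * (n%:R * (X / nu ^+ 2)) =
     \sum_(x in D) ((1 + zeta) * (p x ^+ 2 + q x ^+ 2) +
                    (1 + zeta^-1) * (X / nu ^+ 2)).
    rewrite big_split /= -mulr_sumr sumr_const Dn; congr (_ + _).
    by rewrite -[RHS]mulr_natl mulrCA.
  have sq1 (y z : R) : (y - z) ^+ 2 <= (1 + zeta) * y ^+ 2 + (1 + zeta^-1) * z ^+ 2.
    have -> : (1 + zeta) * y ^+ 2 + (1 + zeta^-1) * z ^+ 2 =
       (y - z) ^+ 2 + (zeta * y + z) ^+ 2 / zeta by field; rewrite gt_eqF.
    by rewrite lerDl divr_ge0 ?sqr_ge0 // ltW.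
  apply: ler_sum => x _; apply: le_trans (lerD (sq1 _ _) (sq1 _ _)) _.
  rewrite !expr_div_n /X le_eqVlt; apply/orP; left; apply/eqP.
  by field; rewrite !gt_eqF.
have z1 : 1 <= (1 + zeta) ^+ n by rewrite exprn_ege1 // lerDl ltW.
have Cg : 0 <= C0 * g * (1 + zeta) ^+ n.
  by rewrite !mulr_ge0 // (le_trans ler01).
apply: (@le_trans _ _ (2 * (g * X) + C0 * g * (1 + zeta) ^+ n *
    ((1 + zeta) * Y' + (1 + zeta^-1) * (n%:R * (X / nu ^+ 2))))).
  by rewrite lerD2l ler_wpM2l.
have tiny : (1 + zeta^-1) * (n%:R / nu ^+ 2) <=
    (1 + zeta^-1) * k%:R / (N - k)%:R ^+ 2.
  rewrite -[leRHS]mulrA ler_wpM2l ?addr_ge0 ?invr_ge0 ?(ltW zeta0) //.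
  apply: ler_pM; rewrite ?invr_ge0 ?exprn_ge0 ?(ltW nu0) ?ler_nat 1?ltnW //.
  by rewrite lef_pV2 ?posrE ?exprn_gt0 // lerXn2r ?nnegrE ?(ltW nu0) ?(ltW Nk0).
set d := (1 + zeta^-1) * (n%:R / nu ^+ 2) in tiny.
have -> : (1 + zeta^-1) * (n%:R * (X / nu ^+ 2)) = d * X by rewrite /d; ring.
set Z := (1 + zeta) ^+ n in z1 Cg *; rewrite exprS -/Z.
have gX : 0 <= g * X by rewrite mulr_ge0.
have : 2 + C0 * d <= C0.
  by apply: le_trans C0_large; rewrite lerD2l ler_wpM2l.
have d0 : 0 <= d.
  by rewrite mulr_ge0 ?addr_ge0 ?invr_ge0 ?divr_ge0 ?exprn_ge0 ?(ltW zeta0) ?(ltW nu0).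
move=> hC.
have h2 : 2 + C0 * Z * d <= C0 * Z by nra.
have h3 : C0 * Z <= C0 * ((1 + zeta) * Z).
  by rewrite ler_wpM2l // ler_peMl ?lerDl ?(ltW zeta0) // (le_trans ler01).
have h4 := ler_wpM2r gX (le_trans h2 h3).
rewrite -subr_ge0 in h4; rewrite -subr_ge0; apply: le_trans h4 _.
by rewrite le_eqVlt; apply/orP; left; apply/eqP; ring.
Qed.

End PermutationMgf.

From mathcomp Require Import complex.
From mathcomp Require Import all_classical all_reals all_analysis.
From mathcomp Require Import measurable_realfun.
Require Import Defs.

Import numFieldNormedType.Exports.
Import ComplexField.Normc.

Local Open Scope classical_set_scope.
Local Open Scope ring_scope.
Local Open Scope sesquilinear_scope.

(** * Complex Gaussian noise *)

Section WeightedIntegral.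
Context d1 d2 (X : measurableType d1) (Y : measurableType d2) (R : realType).
Variables (mu : {measure set X -> \bar R}) (nu : {measure set Y -> \bar R}).
Variables (phi : X -> Y) (h : X -> R) (c : R).
Hypothesis mphi : measurable_fun setT phi.
Hypothesis mh : measurable_fun setT h.
Hypothesis h0 : forall x, 0 <= h x.
Hypothesis hnu : forall A, measurable A ->
  (\int[mu]_(x in phi @^-1` A) (h x)%:E = c%:E * nu A)%E.
Local Open Scope ereal_scope.

Import HBNNSimple.

Let integral_weighted_nnsfun (f : {nnsfun Y >-> R}) :
  \int[mu]_x ((h x)%:E * (f (phi x))%:E) = c%:E * \int[nu]_y (f y)%:E.
Proof.
have mpre (r : R) : measurable (phi @^-1` (f @^-1` [set r])).
  by rewrite -[X in measurable X]setTI; apply: mphi.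
have mi (r : R) : measurable_fun [set: X] (\1_(f @^-1` [set r]) \o phi : X -> R).
  by apply: measurableT_comp => //; exact: measurable_indic.
have -> : \int[nu]_y (f y)%:E =
    \sum_(r \in range f) r%:E * nu (f @^-1` [set r]).
  under eq_integral do rewrite fimfunE -fsumEFin//.
  rewrite ge0_integral_fsum//; last 2 first.
  - by move=> r; apply/measurable_EFinP/measurableT_comp.
  - by move=> r y _; rewrite EFinM nnfun_muleindic_ge0.
  by apply: eq_fsbigr => r _; rewrite integralZl_indic_nnsfun// integral_indic// setIT.
have rge (r : R) : r \in range f -> (0 <= r)%R.
  by rewrite inE => -[y _ <-].
transitivity (\int[mu]_x \sum_(r \in range f)
    (r%:E * ((h x)%:E * (\1_(f @^-1` [set r]) (phi x))%:E))).
  apply: eq_integral => x _; rewrite [in LHS]fimfunE -EFinM mulr_fsumr.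
  rewrite -fsumEFin//; apply: eq_fsbigr => r _.
  by rewrite -!EFinM mulrCA.
rewrite ge0_integral_fsum//; last 2 first.
- move=> r; apply/measurable_EFinP; apply: measurable_funM => //.
  exact: (measurable_funM mh (mi r)).
- move=> r x _; case: (boolP (r \in range f)) => [/rge r0|rf].
    by rewrite -!EFinM lee_fin !mulr_ge0.
  rewrite indicE (_ : (phi x \in f @^-1` [set r]) = false) ?mule0 //.
  by apply/negP; rewrite !inE => fr; case/negP: rf; rewrite inE; exists (phi x).
have fin_pos (r : R) : 0 <= r%:E * nu (f @^-1` [set r]).
  case: (boolP (r \in range f)) => [/rge r0|rf].
    by rewrite mule_ge0 // lee_fin.
  rewrite (_ : f @^-1` [set r] = set0) ?measure0 ?mule0 //.
  apply/seteqP; split => // y /= yr; case/negP: rf; rewrite inE; by exists y.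
rewrite ge0_mule_fsumr //; apply: eq_fsbigr => r /rge r0.
rewrite ge0_integralZl//; last 2 first.
- by apply/measurable_EFinP; exact: (measurable_funM mh (mi r)).
- by move=> x _; rewrite -EFinM lee_fin mulr_ge0.
rewrite muleCA -hnu //; congr (_ * _).
rewrite [RHS]integral_mkcond; apply: eq_integral => x _.
rewrite patchE indicE.
have -> : (phi x \in f @^-1` [set r]) = (x \in phi @^-1` (f @^-1` [set r])).
  by apply/idP/idP; rewrite !inE.
by case: ifP; rewrite ?mule1 ?mule0.
Qed.

(** Change of variables for the image under [phi] of the measure with density [h], known on sets by
    [hnu] and extended through simple functions and monotone convergence. It serves three times: for
    the normal density, for the law of a complex Gaussian, and for isolating one factor of a product
    of independent entries. *)
Lemma ge0_integral_weighted (f : Y -> \bar R) :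
  measurable_fun setT f -> (forall y, 0 <= f y) ->
  \int[mu]_x ((h x)%:E * f (phi x)) = c%:E * \int[nu]_y f y.
Proof.
move=> mf f0; pose f_ := nnsfun_approx measurableT mf.
transitivity (lim (\int[mu]_x ((h x)%:E * (f_ n (phi x))%:E) @[n --> \oo])).
  rewrite -monotone_convergence//=.
  - apply: eq_integral => x _; apply/esym/cvg_lim => //.
    by apply: cvgeZl => //; exact: cvg_nnsfun_approx.
  - move=> n; apply/measurable_EFinP/measurable_funM => //.
    exact: measurableT_comp.
  - by move=> n x _; rewrite -EFinM lee_fin mulr_ge0.
  - move=> x _ m n mn; rewrite -!EFinM lee_fin ler_wpM2l //.
    exact/lefP/nd_nnsfun_approx.
have -> : \int[nu]_y f y = lim (\int[nu]_y (f_ n y)%:E @[n --> \oo]).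
  rewrite -monotone_convergence//=.
  - apply: eq_integral => y _; apply/esym/cvg_lim => //.
    exact: cvg_nnsfun_approx.
  - by move=> n; exact/measurable_EFinP/measurable_funTS.
  - by move=> n ? _; rewrite lee_fin.
  - by move=> ? _ ? ? ?; rewrite lee_fin; exact/lefP/nd_nnsfun_approx.
rewrite -limeMl//.
  by apply: congr_lim; apply/funext => n /=; exact: integral_weighted_nnsfun.
apply/ereal_nondecreasing_is_cvgn => x y xy; apply: ge0_le_integral => //=.
- by move=> ? _; rewrite lee_fin.
- exact/measurable_EFinP/measurable_funTS.
- exact/measurable_EFinP/measurable_funTS.
- by move=> ? _; rewrite lee_fin; exact/lefP/nd_nnsfun_approx.
Qed.

End WeightedIntegral.

Section IntegralLin.
Context d (T : measurableType d) (R : realType) (mu : {measure set T -> \bar R}).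

Lemma ge0_integral_lin (f g : T -> R) (k l : R) :
  measurable_fun setT f -> measurable_fun setT g ->
  (forall x, 0 <= f x) -> (forall x, 0 <= g x) -> 0 <= k -> 0 <= l ->
  (\int[mu]_x (k * f x + l * g x)%:E =
   k%:E * \int[mu]_x (f x)%:E + l%:E * \int[mu]_x (g x)%:E)%E.
Proof.
move=> mf mg f0 g0 k0 l0.
have mk (h : T -> R) (c : R) : measurable_fun setT h ->
    measurable_fun setT (fun x => (c%:E * (h x)%:E)%E).
  by move=> mh; apply: measurable_funeM; apply/measurable_EFinP.
have pos (h : T -> R) (c : R) : 0 <= c -> (forall x, 0 <= h x) ->
    forall x, [set: T] x -> (0 <= c%:E * (h x)%:E)%E.
  by move=> c0 h0 x _; rewrite -EFinM lee_fin mulr_ge0.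
have scale (h : T -> R) (c : R) : measurable_fun setT h -> 0 <= c ->
    (forall x, 0 <= h x) ->
    (\int[mu]_x (c%:E * (h x)%:E) = c%:E * \int[mu]_x (h x)%:E)%E.
  move=> mh c0 h0; apply: ge0_integralZl_EFin => //.
    by move=> x _; rewrite lee_fin.
  exact/measurable_EFinP.
rewrite -!scale // -(ge0_integralD mu measurableT (pos _ _ k0 f0) (mk _ _ mf)
  (pos _ _ l0 g0) (mk _ _ mg)).
by apply: eq_integral => x _; rewrite -!EFinM -EFinD.
Qed.

Lemma le_ge0_integral_lin (f g f' g' : T -> R) (k l k' l' : R) :
  measurable_fun setT f -> measurable_fun setT g ->
  measurable_fun setT f' -> measurable_fun setT g' ->
  (forall x, 0 <= f x) -> (forall x, 0 <= g x) ->
  (forall x, 0 <= f' x) -> (forall x, 0 <= g' x) ->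
  0 <= k -> 0 <= l -> 0 <= k' -> 0 <= l' ->
  (forall x, k * f x + l * g x <= k' * f' x + l' * g' x) ->
  (k%:E * \int[mu]_x (f x)%:E + l%:E * \int[mu]_x (g x)%:E <=
   k'%:E * \int[mu]_x (f' x)%:E + l'%:E * \int[mu]_x (g' x)%:E)%E.
Proof.
move=> mf mg mf' mg' f0 g0 f'0 g'0 k0 l0 k'0 l'0 le.
rewrite -!ge0_integral_lin //.
have mlin (h h' : T -> R) (a b : R) : measurable_fun setT h ->
    measurable_fun setT h' ->
    measurable_fun setT (fun x => (a * h x + b * h' x)%:E).
  move=> mh mh'; apply/measurable_EFinP/measurable_funD.
    exact: (measurable_funM (measurable_cst a) mh).
  exact: (measurable_funM (measurable_cst b) mh').
apply: ge0_le_integral => //; try exact: mlin.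
- by move=> x _; rewrite lee_fin addr_ge0 ?mulr_ge0.
- by move=> x _; rewrite lee_fin le.
Qed.

End IntegralLin.

(** After division by [rho - 1], each family compares [w] with 2 s^2 rho^2 / (rho + 1), which tends
    to s^2 as [rho] tends to 1 from either side. *)
Lemma eq_of_scale_bounds (R : realType) (s w : R) : 0 < s -> 0 <= w ->
  (forall rho : R, 1 < rho ->
     1 + (1 - rho ^- 2) / (2 * s ^+ 2) * w <= rho) ->
  (forall rho : R, 0 < rho -> rho < 1 ->
     1 <= rho + (rho ^- 2 - 1) / (2 * s ^+ 2) * w) ->
  w = s ^+ 2.
Proof.
move=> s0 w0 up down; have s2 : 0 < 2 * s ^+ 2 by rewrite mulr_gt0 ?exprn_gt0.
have v0 : s ^+ 2 != 0 by rewrite gt_eqF ?exprn_gt0.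
have up' rho : 1 < rho -> w <= 2 * s ^+ 2 * (rho ^+ 2 / (rho + 1)).
  move=> r1; have h := up _ r1.
  have r0 : 0 < rho by apply: lt_trans r1.
  have r11 : 0 < (rho - 1) * (rho + 1) by rewrite mulr_gt0; lra.
  have : (1 - rho ^- 2) / (2 * s ^+ 2) * w <= rho - 1 by lra.
  have -> : (1 - rho ^- 2) / (2 * s ^+ 2) * w =
     ((rho - 1) * (rho + 1)) * (w / (2 * s ^+ 2 * rho ^+ 2)).
    by field; rewrite (gt_eqF s0) (gt_eqF r0).
  rewrite -ler_pdivlMl // ler_pdivrMr ?mulr_gt0 ?exprn_gt0 // => /le_trans; apply.
  rewrite le_eqVlt; apply/orP; left; apply/eqP; field.
  by rewrite !gt_eqF //; lra.
have down' rho : 0 < rho -> rho < 1 -> 2 * s ^+ 2 * (rho ^+ 2 / (rho + 1)) <= w.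
  move=> r0 r1; have h := down _ r0 r1.
  have r11 : 0 < (1 - rho) * (rho + 1) by rewrite mulr_gt0; lra.
  have : 1 - rho <= (rho ^- 2 - 1) / (2 * s ^+ 2) * w by lra.
  have -> : (rho ^- 2 - 1) / (2 * s ^+ 2) * w =
     ((1 - rho) * (rho + 1)) * (w / (2 * s ^+ 2 * rho ^+ 2)).
    by field; rewrite (gt_eqF s0) (gt_eqF r0).
  rewrite -ler_pdivrMl // ler_pdivlMr ?mulr_gt0 ?exprn_gt0 //; apply: le_trans.
  rewrite le_eqVlt; apply/orP; left; apply/eqP; field.
  by rewrite !gt_eqF //; lra.
have sq0 : 0 < s ^+ 2 by rewrite exprn_gt0.
apply/eqP; rewrite eq_le; apply/andP; split.
  apply/ler_addgt0Pr => eps eps0.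
  pose h := eps / (2 * s ^+ 2); have h0 : 0 < h by rewrite divr_gt0.
  have -> : eps = 2 * s ^+ 2 * h by rewrite /h mulrC divfK // gt_eqF.
  have := up' (1 + h); rewrite ltrDl => /(_ h0) /le_trans; apply.
  have -> : s ^+ 2 + 2 * s ^+ 2 * h = 2 * s ^+ 2 * (2^-1 + h) by field.
  rewrite ler_pM2l // ler_pdivrMr; last by lra.
  nra.
rewrite leNgt; apply/negP => ws.
(* [h] is the relative defect of [w]; taking [rho] to be [1 - h / 2] is already close enough to 1
   for a contradiction. *)
pose h := (s ^+ 2 - w) / (2 * s ^+ 2).
have h0 : 0 < h by rewrite divr_gt0 // subr_gt0.
have h1 : h <= 1 / 2.
  by rewrite /h ler_pdivrMr //; lra.
have r0 : 0 < 1 - h / 2 by lra.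
have r1 : 1 - h / 2 < 1 by lra.
have := down' _ r0 r1; apply/negP; rewrite -ltNge.
have wE : w = 2 * s ^+ 2 * (2^-1 - h).
  by rewrite /h; field; rewrite gt_eqF.
rewrite [X in X < _]wE.
rewrite ltr_pM2l // ltr_pdivlMr; last by lra.
nra.
Qed.

(** * Exponential and second moments of the centred normal law *)

Section NormalMoments.
Context {R : realType}.
Variable s : R.
Hypothesis s0 : 0 < s.
Notation mu := (@lebesgue_measure R).

Lemma ge0_integral_normal (m : R) (f : R -> \bar R) :
  measurable_fun setT f -> (forall x, 0 <= f x)%E ->
  (\int[normal_prob m s]_x f x =
   \int[mu]_x ((normal_pdf m s x)%:E * f x))%E.
Proof.
move=> mf f0; rewrite -[LHS]mul1e; apply/esym.
apply: (@ge0_integral_weighted _ _ _ _ _ mu (normal_prob m s) idfun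
  (normal_pdf m s) 1) => //.
- exact: measurable_id.
- exact: measurable_normal_pdf.
- by move=> x; apply: normal_pdf_ge0.
- by move=> A mA; rewrite mul1e.
Qed.

(** Completing the square: an exponential tilt shifts the mean by [theta * s ^+ 2]. *)
Lemma normal_pdf_prod (theta x : R) :
  normal_pdf 0 s x * expR (theta * x) =
  expR (theta ^+ 2 * s ^+ 2 / 2) * normal_pdf (theta * s ^+ 2) s x.
Proof.
rewrite !normal_pdfE ?gt_eqF // /normal_fun.
rewrite -[LHS]mulrA -expRD [RHS]mulrCA -expRD; congr (_ * expR _).
rewrite subr0 -[s ^+ 2 *+ 2]mulr_natl; field.
by rewrite gt_eqF.
Qed.

Lemma normal_mgf (theta : R) :
  (\int[normal_prob 0 s]_x (expR (theta * x))%:E =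
   (expR (theta ^+ 2 * s ^+ 2 / 2))%:E)%E.
Proof.
rewrite ge0_integral_normal; last 2 first.
- apply/measurable_EFinP; apply: measurableT_comp => //.
- by move=> x; rewrite lee_fin expR_ge0.
under eq_integral do rewrite -EFinM normal_pdf_prod EFinM.
rewrite ge0_integralZl //; last 2 first.
- by apply/measurable_EFinP; apply: measurable_normal_pdf.
- by move=> x _; rewrite lee_fin normal_pdf_ge0.
by rewrite integral_normal_pdf mule1.
Qed.

(* Tangent line of exp at 0 in the ratio of two centred normal densities. *)
Lemma normal_pdf_scale (rho x : R) : 0 < rho ->
  normal_pdf 0 s x + (1 - rho ^- 2) / (2 * s ^+ 2) * (normal_pdf 0 s x * x ^+ 2)
  <= rho * normal_pdf 0 (rho * s) x.
Proof.
move=> r0; have rs0 : 0 < rho * s by rewrite mulr_gt0.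
have -> : rho * normal_pdf 0 (rho * s) x =
    normal_pdf 0 s x * expR ((1 - rho ^- 2) / (2 * s ^+ 2) * x ^+ 2).
  rewrite !normal_pdfE ?gt_eqF // /normal_fun -[RHS]mulrA -expRD mulrA; congr (_ * expR _).
    rewrite /normal_peak exprMn -mulrA -mulrnAr sqrtrM ?sqr_ge0 // sqrtr_sqr.
    by rewrite gtr0_norm // invfM mulrA divff ?mul1r // gt_eqF.
  rewrite subr0 -[s ^+ 2 *+ 2]mulr_natl -[(rho * s) ^+ 2 *+ 2]mulr_natl; field.
  by rewrite !gt_eqF.
have := expR_ge1Dx ((1 - rho ^- 2) / (2 * s ^+ 2) * x ^+ 2).
move=> /(ler_wpM2l (normal_pdf_ge0 0 s x)); apply: le_trans.
by rewrite mulrDr mulr1 mulrCA.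
Qed.

(* Integrating [normal_pdf_scale] bounds the second moment on both sides by
   difference quotients at rho = 1. *)
Lemma normal_second_moment :
  (\int[normal_prob 0 s]_x (x ^+ 2)%:E = (s ^+ 2)%:E)%E.
Proof.
have mX : measurable_fun [set: R] (fun x : R => (x ^+ 2)%:E).
  by apply/measurable_EFinP; apply: measurable_funX.
have mP (u : R) : measurable_fun [set: R] (fun x => (normal_pdf 0 u x)%:E).
  by apply/measurable_EFinP; apply: measurable_normal_pdf.
have mPX : measurable_fun [set: R] (fun x => (normal_pdf 0 s x * x ^+ 2)%:E).
  apply/measurable_EFinP; apply: measurable_funM; last exact: measurable_funX.
  exact: measurable_normal_pdf.
rewrite ge0_integral_normal //; last by move=> x; rewrite lee_fin sqr_ge0.
under eq_integral do rewrite -EFinM.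
have PX0 x : 0 <= normal_pdf 0 s x * x ^+ 2.
  by rewrite mulr_ge0 ?sqr_ge0 ?normal_pdf_ge0.
have P0 (u x : R) : 0 <= normal_pdf 0 u x by exact: normal_pdf_ge0.
set I := (\int[mu]_x _)%E.
have I0 : (0 <= I)%E by apply: integral_ge0 => x _; rewrite lee_fin.
have s2 : 0 < 2 * s ^+ 2 by rewrite mulr_gt0 ?exprn_gt0.
have int1 u : (\int[mu]_x (normal_pdf 0 u x)%:E = 1)%E := integral_normal_pdf 0 u.
have q0 x : 0 <= normal_pdf 0 s x * x ^+ 2 by [].
have mp u : measurable_fun [set: R] (normal_pdf 0 u : R -> R).
  exact: measurable_normal_pdf.
have mq : measurable_fun [set: R] (fun x : R => normal_pdf 0 s x * x ^+ 2).
  exact/measurable_EFinP.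
have cmp (u u' k k' l l' : R) : 0 <= k -> 0 <= k' -> 0 <= l -> 0 <= l' ->
    (forall x, k * normal_pdf 0 u x + l * (normal_pdf 0 s x * x ^+ 2) <=
               k' * normal_pdf 0 u' x + l' * (normal_pdf 0 s x * x ^+ 2)) ->
    (k%:E + l%:E * I <= k'%:E + l'%:E * I)%E.
  move=> k0 k'0 l0 l'0; have := @le_ge0_integral_lin _ _ _ mu
    (normal_pdf 0 u) (fun x => normal_pdf 0 s x * x ^+ 2)
    (normal_pdf 0 u') (fun x => normal_pdf 0 s x * x ^+ 2) k l k' l' (mp u) mq
    (mp u') mq (P0 u) q0 (P0 u') q0 k0 l0 k'0 l'0.
  by rewrite !int1 !mule1.
have up (rho : R) : 1 < rho ->
    (1 + ((1 - rho ^- 2) / (2 * s ^+ 2))%:E * I <= rho%:E)%E.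
  move=> r1; have r0 : 0 < rho by apply: lt_trans r1.
  rewrite -[leRHS]adde0 -[X in (_ <= _ + X)%E](mul0e I).
  apply: (cmp s (rho * s)) => //; first exact: ltW.
    rewrite divr_ge0 ?(ltW s2) // subr_ge0 invf_le1 ?exprn_gt0 //.
    by rewrite exprn_ege1 // ltW.
  by move=> x; rewrite mul1r mul0r addr0 normal_pdf_scale.
(* For [rho < 1] the coefficient of the second moment is negative and changes sides, so that only
   nonnegative functions are integrated. *)
have down (rho : R) : 0 < rho -> rho < 1 ->
    (1 <= rho%:E + ((rho ^- 2 - 1) / (2 * s ^+ 2))%:E * I)%E.
  move=> r0 r1; rewrite -[leLHS]adde0 -[X in (_ + X <= _)%E](mul0e I).
  apply: (cmp s (rho * s)) => //; first exact: ltW.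
    rewrite divr_ge0 ?(ltW s2) // subr_ge0 invf_ge1 ?exprn_gt0 //.
    by rewrite exprn_ile1 // ltW.
  move=> x; rewrite mul1r mul0r addr0; have := normal_pdf_scale x r0.
  rewrite -lerBrDr => /le_trans; apply.
  by rewrite le_eqVlt; apply/orP; left; apply/eqP; ring.
(* The upper comparison at [rho = 2] excludes an infinite second moment. *)
have Ifin : I = (fine I)%:E.
  apply/esym/fineK; rewrite ge0_fin_numE //.
  have := up 2; rewrite ltr1n => /(_ isT).
  case: (I) I0 => [r|//|//] _ h; first by rewrite ltry.
  move: h; rewrite gt0_muley ?adde_ge0 // lte_fin divr_gt0 // subr_gt0.
  by rewrite invf_lt1 // expr2; lra.
rewrite Ifin; congr EFin; apply: (eq_of_scale_bounds s0).
- exact: fine_ge0.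
- by move=> rho /up; rewrite Ifin -EFinM -EFinD lee_fin.
- by move=> rho r0 /(down _ r0); rewrite Ifin -EFinM -EFinD lee_fin.
Qed.

End NormalMoments.

Section ComplexGaussian.
Context {d : measure_display} {T : measurableType d} {R : realType}.
Variables (P : probability T R) (v : R) (X : T -> R[i]).
Hypothesis v0 : 0 < v.
Hypothesis gX : complex_gaussian P v X.

Let s := Num.sqrt (v / 2).

Let s0 : 0 < s.
Proof. by rewrite sqrtr_gt0 divr_gt0. Qed.

Let s2 : s ^+ 2 = v / 2.
Proof. by rewrite sqr_sqrtr // ltW // divr_gt0. Qed.

Lemma complex_gaussian_law (f : R * R -> \bar R) :
  measurable_fun setT f -> (forall z, 0 <= f z)%E ->
  (\int[P]_w f (re_im (X w)) =
   \int[normal_prob 0 s \x normal_prob 0 s]_z f z)%E.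
Proof.
move=> mf f0; have [mX lX] := gX.
have := @ge0_integral_weighted _ _ _ _ _ P
  (normal_prob 0 s \x normal_prob 0 s)%E (re_im \o X) (cst 1) 1 mX
  (measurable_cst _) (fun=> ler01).
move=> /(_ _ f mf f0); rewrite mul1e => <-.
  by apply: eq_integral => w _; rewrite mul1e.
move=> A mA; rewrite mul1e; transitivity (P ((re_im \o X) @^-1` A)).
  have mA' : measurable ((re_im \o X) @^-1` A).
    by rewrite -[X in measurable X]setTI; apply: mX.
  by have := integral_cst P mA' 1; rewrite mul1e.
exact: lX.
Qed.

Lemma complex_gaussian_integral (f : R * R -> \bar R) :
  measurable_fun setT f -> (forall z, 0 <= f z)%E ->
  (\int[P]_w f (re_im (X w)) =
   \int[normal_prob 0 s]_x \int[normal_prob 0 s]_y f (x, y))%E.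
Proof.
by move=> mf f0; rewrite complex_gaussian_law // fubini_tonelli1.
Qed.

Lemma complex_gaussian_mgf (a b : R) :
  (\int[P]_w (expR (a * (re_im (X w)).1 + b * (re_im (X w)).2))%:E =
   (expR ((a ^+ 2 + b ^+ 2) * v / 4))%:E)%E.
Proof.
rewrite (complex_gaussian_integral (f := fun z => (expR (a * z.1 + b * z.2))%:E)) /=.
- have me (c : R) : measurable_fun [set: R] (fun y => (expR (c * y))%:E).
    by apply/measurable_EFinP; apply: measurableT_comp.
  have pe (c : R) (y : R) : [set: R] y -> (0 <= (expR (c * y))%:E)%E.
    by rewrite lee_fin expR_ge0.
  transitivity (\int[normal_prob 0 s]_x
      ((expR (b ^+ 2 * s ^+ 2 / 2))%:E * (expR (a * x))%:E))%E.
    apply: eq_integral => x _; under eq_integral do rewrite expRD EFinM.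
    rewrite (ge0_integralZl_EFin (normal_prob 0 s) measurableT (pe b) (me b)
      (expR_ge0 _)).
    by rewrite normal_mgf // muleC.
  rewrite (ge0_integralZl_EFin (normal_prob 0 s) measurableT (pe a) (me a)
      (expR_ge0 _)).
  by rewrite normal_mgf // -EFinM -expRD s2; congr (expR _)%:E; field.
- apply/measurable_EFinP; apply: measurableT_comp => //.
  by apply: measurable_funD; apply: measurable_funM.
- by move=> z; rewrite lee_fin expR_ge0.
Qed.

Lemma complex_gaussian_sqr :
  (\int[P]_w ((re_im (X w)).1 ^+ 2 + (re_im (X w)).2 ^+ 2)%:E = v%:E)%E.
Proof.
rewrite (complex_gaussian_integral (f := fun z => (z.1 ^+ 2 + z.2 ^+ 2)%:E)) /=.
- have msq : measurable_fun [set: R] (fun y : R => (y ^+ 2)%:E).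
    by apply/measurable_EFinP; apply: measurable_funX.
  have psq (y : R) : [set: R] y -> (0 <= (y ^+ 2)%:E)%E.
    by rewrite lee_fin sqr_ge0.
  have pc (c y : R) : [set: R] y -> (0 <= (c ^+ 2)%:E)%E.
    by rewrite lee_fin sqr_ge0.
  have intc (c : R) : (\int[normal_prob 0 s]_(_ in [set: R]) c%:E = c%:E)%E.
    transitivity (c%:E * normal_prob 0 s [set: R])%E.
      exact: (integral_cst (normal_prob 0 s) measurableT c%:E).
    by rewrite -[RHS]mule1; congr (_ * _)%E; exact: (probability_setT (normal_prob 0 s)).
  transitivity (\int[normal_prob 0 s]_x ((x ^+ 2)%:E + (s ^+ 2)%:E))%E.
    apply: eq_integral => x _; under eq_integral do rewrite EFinD.
    rewrite (ge0_integralD (normal_prob 0 s) measurableT (pc x) _ psq msq) //.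
    by rewrite intc normal_second_moment.
  rewrite (ge0_integralD (normal_prob 0 s) measurableT psq msq (pc s)) //.
  by rewrite intc normal_second_moment // -EFinD s2 -splitr.
- apply/measurable_EFinP; apply: measurable_funD; apply: measurable_funX => //.
- by move=> z; rewrite lee_fin addr_ge0 ?sqr_ge0.
Qed.

End ComplexGaussian.

Lemma measurable_bigprod d (T : measurableType d) (R : realType) (I : Type)
    (r : seq I) (Q : pred I) (h : I -> T -> R) :
  (forall i, measurable_fun setT (h i)) ->
  measurable_fun setT (fun w => \prod_(i <- r | Q i) h i w).
Proof.
move=> mh; elim: r => [|i r IH].
  by under eq_fun do rewrite big_nil; exact: measurable_cst.
under eq_fun do rewrite big_cons.
by case: (Q i) => //; exact: (measurable_funM (mh i) IH).
Qed.

Section GaussianNoise.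
Context {d : measure_display} {T : measurableType d} {R : realType}.
Variables (P : probability T R) (M : nat) (sigma : R) (e : T -> 'cV[R[i]]_M).
Hypothesis sigma0 : 0 < sigma.
Hypothesis he : gaussian_noise P sigma e.

Let ee (w : T) (m : 'I_M) : R * R := re_im (e w m 0).

Let sg0 : 0 < sigma ^+ 2. Proof. by rewrite exprn_gt0. Qed.

Lemma measurable_entry m : measurable_fun setT (fun w => ee w m).
Proof. by have [/(_ m)[]] := he. Qed.

Let measurable_comp_entry (g : R * R -> R) m :
  measurable_fun setT g -> measurable_fun setT (fun w => g (ee w m)).
Proof. by move=> mg; apply: (measurableT_comp mg (measurable_entry m)). Qed.

(* Independence is only given for rectangles; by induction on #|J| the indicators
   are replaced one at a time by arbitrary nonnegative functions. *)
Lemma integral_prod_entries (J : {set 'I_M}) (G : 'I_M -> R * R -> R)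
    (r : 'I_M -> R) :
  (forall m, measurable_fun setT (G m)) -> (forall m z, 0 <= G m z) ->
  (forall m, (\int[P]_w (G m (ee w m))%:E = (r m)%:E)%E) ->
  (forall m, m \notin J ->
     exists A : set (R * R), measurable A /\ G m = \1_A) ->
  (\int[P]_w (\prod_m G m (ee w m))%:E = (\prod_m r m)%:E)%E.
Proof.
move: {2}#|J| (erefl #|J|) => n; elim: n J G r => [|n IH] J G r.
  move=> /eqP; rewrite cards_eq0 => /eqP -> mG G0 Gr GA.
  have /fin_all_exists[A hA] : forall m, exists A : set (R * R),
      measurable A /\ G m = \1_A by move=> m; apply: GA; rewrite inE.
  have rE m : P [set w | A m (ee w m)] = (r m)%:E.
    rewrite -Gr; have [mA ->] := hA m.
    have mA' : measurable [set w | A m (ee w m)].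
      by rewrite -[X in measurable X]setTI; apply: measurable_entry.
    transitivity (\int[P]_w (\1_[set w | A m (ee w m)] w)%:E)%E.
      by rewrite integral_indic // setIT.
    by apply: eq_integral => w _; rewrite !indicE.
  rewrite -prodEFin (eq_bigr (fun m => P [set w | A m (ee w m)])); last first.
    by move=> m _; rewrite rE.
  have [_ /(_ A)] := he; rewrite /entries_in => <-; last by move=> m; have [] := hA m.
  have mE : measurable [set w | forall m, A m (ee w m)].
    rewrite [X in measurable X](_ : _ = \bigcap_(m in [set: 'I_M]) [set w | A m (ee w m)]).
      apply: fin_bigcap_measurable => // m _; have [mA _] := hA m.
      by rewrite -[X in measurable X]setTI; apply: measurable_entry.
    by apply/seteqP; split => [w h m _|w h m]; apply: h.
  transitivity (\int[P]_w (\1_[set w | forall m, A m (ee w m)] w)%:E)%E; last first.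
    by rewrite integral_indic // setIT.
  apply: eq_integral => w _; rewrite indicE; congr EFin.
  case: (boolP (w \in _)) => [|/negP] wA.
    rewrite inE in wA; rewrite big1 // => m _; have [_ ->] := hA m.
    by rewrite indicE mem_set //; exact: wA.
  have [m hm] : exists m, ~ A m (ee w m).
    by apply/existsNP => h; apply: wA; rewrite inE.
  rewrite (bigD1 m) //=; have [_ ->] := hA m.
  by rewrite indicE memNset // mul0r.
move=> Jn mG G0 Gr GA; have /card_gt0P[k kJ] : (0 < #|J|)%N by rewrite Jn.
have Dn : #|(J :\ k)%SET| = n.
  by apply/eqP; rewrite -eqSS -Jn (cardsD1 k J) kJ.
pose h w := \prod_(m | m != k) G m (ee w m).
pose c := \prod_(m | m != k) r m.
have mh : measurable_fun setT h.
  by apply: measurable_bigprod => m; apply: measurable_comp_entry.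
have h0 w : 0 <= h w by apply: prodr_ge0.
have gk := proj1 he k.
have [mk lk] := gk.
(* With an indicator in place of [G k], the induction hypothesis says that the law of entry [k],
   weighted by the other factors, is [c] times the Gaussian law. *)
have hnu A : measurable A ->
    (\int[P]_(w in (fun w => ee w k) @^-1` A) (h w)%:E =
     c%:E * (normal_prob 0 (Num.sqrt (sigma ^+ 2 / 2)) \x
             normal_prob 0 (Num.sqrt (sigma ^+ 2 / 2)))%E A)%E.
  move=> mA; pose G' m := if m == k then \1_A else G m.
  pose r' m := if m == k then fine (P ((fun w => ee w k) @^-1` A)) else r m.
  have mA' : measurable ((fun w => ee w k) @^-1` A).
    by rewrite -[X in measurable X]setTI; apply: measurable_entry.
  have := IH (J :\ k)%SET G' r' Dn.
  have -> : (\prod_m r' m) = fine (P ((fun w => ee w k) @^-1` A)) * c.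
    rewrite (bigD1 k) //= /r' eqxx; congr (_ * _).
    by apply: eq_bigr => m /negbTE ->.
  rewrite EFinM fineK ?fin_num_measure // muleC -lk // => <-.
  - rewrite [LHS]integral_mkcond; apply: eq_integral => w _.
    rewrite patchE (bigD1 k) //= /G' eqxx indicE.
    have -> : (ee w k \in A) = (w \in (fun w => ee w k) @^-1` A).
      by apply/idP/idP; rewrite !inE.
    case: ifP => _; rewrite ?mul0r // mul1r; congr EFin.
    by apply: eq_bigr => m /negbTE ->.
  - by move=> m; rewrite /G'; case: ifP => _ //; apply: measurable_indic.
  - by move=> m z; rewrite /G'; case: ifP => _ //; rewrite indicE.
  - move=> m; rewrite /G' /r'; case: eqP => [->|_]; last exact: Gr.
    rewrite fineK ?fin_num_measure //.
    transitivity (\int[P]_w (\1_((fun w => ee w k) @^-1` A) w)%:E)%E.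
      by apply: eq_integral => w _; rewrite !indicE.
    by rewrite integral_indic // setIT.
  - move=> m; rewrite !finset.inE negb_and negbK /G'.
    case: eqP => [_ _|_ /= mJ]; last exact: GA.
    by exists A.
have mGk : measurable_fun setT (EFin \o G k) by apply/measurable_EFinP.
have Gk0 z : (0 <= (EFin \o G k) z)%E by rewrite lee_fin.
have := @ge0_integral_weighted _ _ _ _ _ P
  (normal_prob 0 (Num.sqrt (sigma ^+ 2 / 2)) \x
   normal_prob 0 (Num.sqrt (sigma ^+ 2 / 2)))%E (fun w => ee w k) h c mk mh h0
  hnu (EFin \o G k) mGk Gk0.
rewrite -(complex_gaussian_law gk mGk Gk0) /= Gr => hE.
rewrite [in RHS](bigD1 k) //= -/c mulrC EFinM -hE.
by apply: eq_integral => w _; rewrite (bigD1 k) //= mulrC EFinM.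
Qed.

(** Exponential Markov inequality; [th] minimises [th ^+ 2 * sigma ^+ 2 / 4 - th * rho]. *)
Lemma noise_tail (a b : 'I_M -> R) (rho : R) : 0 < rho ->
  \sum_m (a m ^+ 2 + b m ^+ 2) = 1 ->
  (P [set w | rho < \sum_m (a m * (ee w m).1 + b m * (ee w m).2)]%R <=
   (expR (- (rho ^+ 2 / sigma ^+ 2)))%:E)%E.
Proof.
move=> rho0 ab1; pose th := 2 * rho / sigma ^+ 2.
have th0 : 0 < th by rewrite divr_gt0 // mulr_gt0.
pose S w := \sum_m (a m * (ee w m).1 + b m * (ee w m).2).
have mlin (x y : R) : measurable_fun [set: R * R] (fun z => x * z.1 + y * z.2).
  by apply: measurable_funD; apply: measurable_funM.
have mS : measurable_fun setT S.
  apply: measurable_sum => m.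
  exact: (measurable_comp_entry (g := fun z => a m * z.1 + b m * z.2)).
have mg : (\int[P]_w (expR (th * S w))%:E = (expR (th ^+ 2 * sigma ^+ 2 / 4))%:E)%E.
  have := @integral_prod_entries [set: 'I_M]%SET
    (fun m z => expR (th * a m * z.1 + th * b m * z.2))
    (fun m => expR (th ^+ 2 * (a m ^+ 2 + b m ^+ 2) * sigma ^+ 2 / 4)).
  rewrite -expR_sum -!mulr_suml -mulr_sumr ab1 mulr1 => <-.
  - apply: eq_integral => w _; rewrite -expR_sum mulr_sumr; congr (expR _)%:E.
    by apply: eq_bigr => m _; rewrite mulrDr !mulrA.
  - by move=> m; apply: measurableT_comp.
  - by move=> m z; apply: expR_ge0.
  - move=> m; have gm := proj1 he m.
    rewrite (complex_gaussian_mgf sg0 gm) !exprMn -mulrDr; congr (expR _)%:E.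
  - by move=> m; rewrite finset.in_setT.
have mA : measurable [set w | rho < S w].
  rewrite -[X in measurable X]setTI (_ : [set w | _] = S @^-1` `]rho, +oo[).
    by apply: mS => //; exact: measurable_itv.
  by apply/seteqP; split => w /=; rewrite in_itv /= andbT.
have mexp : measurable_fun [set: T] (fun w => (expR (th * S w))%:E).
  apply/measurable_EFinP; apply: measurableT_comp => //.
  exact: (measurable_funM (measurable_cst th) mS).
have h1 : ((expR (th * rho))%:E * P [set w | rho < S w]%R <=
    (expR (th ^+ 2 * sigma ^+ 2 / 4))%:E)%E.
  rewrite -mg -(integral_cst P mA) /=.
  apply: (@le_trans _ _ (\int[P]_(w in [set w | (rho < S w)%R]) (expR (th * S w))%:E)%E).
    apply: ge0_le_integral => //.
    - exact: measurable_funS mexp.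
    - by move=> w /= Sw; rewrite lee_fin ler_expR ler_pM2l // ltW.
  exact: ge0_subset_integral.
have -> : - (rho ^+ 2 / sigma ^+ 2) = th ^+ 2 * sigma ^+ 2 / 4 - th * rho.
  by rewrite /th; field; rewrite gt_eqF.
rewrite expRD expRN EFinM -lee_pdivlMl ?expR_gt0 // in h1 *.
by rewrite muleC.
Qed.

Lemma noise_energy :
  ('E_P[(fun w => l2norm (e w) ^+ 2)%R] = (M%:R * sigma ^+ 2)%:E)%E.
Proof.
rewrite unlock; transitivity (\int[P]_w (\sum_m ((ee w m).1 ^+ 2 + (ee w m).2 ^+ 2)%:E))%E.
  apply: eq_integral => w _; rewrite sumEFin; congr EFin.
  rewrite sqr_sqrtr; last by apply: sumr_ge0 => m _; rewrite sqr_ge0.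
  apply: eq_bigr => m _; rewrite /ee /re_im /=; case: (e w m 0) => x y /=.
  by rewrite sqr_sqrtr // addr_ge0 ?sqr_ge0.
rewrite ge0_integral_sum //.
- rewrite (eq_bigr (fun=> (sigma ^+ 2)%:E)) => [|m _].
    by rewrite sumEFin sumr_const card_ord mulr_natl.
  exact: (complex_gaussian_sqr sg0 (proj1 he m)).
- move=> m; apply/measurable_EFinP.
  apply: (measurable_comp_entry (g := fun z => z.1 ^+ 2 + z.2 ^+ 2)).
  by apply: measurable_funD; apply: measurable_funX.
- by move=> m w _; rewrite lee_fin addr_ge0 ?sqr_ge0.
Qed.

End GaussianNoise.

(** * One-step thresholding on a good event *)

Section RealNorms.
Variable R : realType.
Implicit Types (n : nat) (z : R[i]).

Lemma normc_real_complex z : `|z| = (normc z)%:C%C.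
Proof. by case: z. Qed.

Lemma normc_ge0 z : 0 <= normc z.
Proof. by case: z => a b; apply: sqrtr_ge0. Qed.

Lemma normc_conj z : normc (z^*) = normc z.
Proof. by apply: complexI; rewrite -!normc_real_complex norm_conjC. Qed.

Lemma normc_opp z : normc (- z) = normc z.
Proof. by apply: complexI; rewrite -!normc_real_complex normrN. Qed.

Lemma normc_triangle (z z' : R[i]) : normc (z + z') <= normc z + normc z'.
Proof.
by rewrite -lecR raddfD /= -!normc_real_complex ler_normD.
Qed.

Lemma normc_sum (I : finType) (Q : pred I) (f : I -> R[i]) :
  normc (\sum_(i | Q i) f i) <= \sum_(i | Q i) normc (f i).
Proof.
rewrite -lecR -normc_real_complex rmorph_sum /=.
apply: le_trans (ler_norm_sum _ _ _) _.
by apply: ler_sum => i _; rewrite normc_real_complex.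
Qed.

Lemma normc_real (a : R) : normc a%:C%C = `|a|.
Proof. by rewrite /normc /= expr0n addr0 sqrtr_sqr. Qed.

Lemma sum_mul_sqr_le (I : finType) (a b : I -> R) :
  (\sum_i a i * b i) ^+ 2 <= (\sum_i a i ^+ 2) * (\sum_i b i ^+ 2).
Proof.
rewrite -subr_ge0 -(pmulrn_lge0 _ (isT : (0 < 2)%N)).
have E1 (f g : I -> R) : (\sum_i f i) * (\sum_i g i) = \sum_i \sum_j f i * g j.
  by rewrite mulr_suml; apply: eq_bigr => k _; rewrite mulr_sumr.
have E2 (f g : I -> R) : (\sum_i f i) * (\sum_i g i) = \sum_i \sum_j f j * g i.
  by rewrite E1 exchange_big.
rewrite mulr2n {1}E1 E2 expr2 !E1 -!sumrB -big_split /=.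
apply: sumr_ge0 => i _; rewrite -!sumrB -big_split /=; apply: sumr_ge0 => j _.
have -> : a i ^+ 2 * b j ^+ 2 - a i * b i * (a j * b j) +
  (a j ^+ 2 * b i ^+ 2 - a i * b i * (a j * b j)) = (a i * b j - a j * b i) ^+ 2.
  by ring.
exact: sqr_ge0.
Qed.

Lemma l2norm_ge0 n (u : 'cV[R[i]]_n) : 0 <= l2norm u.
Proof. exact: sqrtr_ge0. Qed.

Lemma l2norm_sqr n (u : 'cV[R[i]]_n) : l2norm u ^+ 2 = \sum_i normc (u i 0) ^+ 2.
Proof. by rewrite sqr_sqrtr // sumr_ge0 // => i _; rewrite sqr_ge0. Qed.

Lemma normsq_l2norm n (u : 'cV[R[i]]_n) : normsq u = (l2norm u ^+ 2)%:C%C.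
Proof.
rewrite l2norm_sqr rmorph_sum; apply: eq_bigr => i _.
by rewrite normc_real_complex rmorphXn.
Qed.

Lemma sum_normc_mul_le n (u v : 'cV[R[i]]_n) :
  \sum_i normc (u i 0) * normc (v i 0) <= l2norm u * l2norm v.
Proof.
rewrite -(@ler_pXn2r _ 2) ?nnegrE ?mulr_ge0 ?l2norm_ge0 //; last first.
  by apply: sumr_ge0 => i _; rewrite mulr_ge0 ?normc_ge0.
by rewrite exprMn !l2norm_sqr sum_mul_sqr_le.
Qed.

Lemma l2norm_dot_le n (u v : 'cV[R[i]]_n) :
  normc ((u ^t* *m v) 0 0) <= l2norm u * l2norm v.
Proof.
apply: le_trans (sum_normc_mul_le u v); rewrite mxE.
apply: le_trans (normc_sum _ _) _; apply: ler_sum => i _.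
by rewrite !mxE normcM normc_conj.
Qed.

Lemma l2normD n (u v : 'cV[R[i]]_n) : l2norm (u + v) <= l2norm u + l2norm v.
Proof.
rewrite -(@ler_pXn2r _ 2) ?nnegrE ?addr_ge0 ?l2norm_ge0 //.
have := sum_normc_mul_le u v; rewrite sqrrD !l2norm_sqr => h.
apply: (@le_trans _ _ (\sum_i (normc (u i 0) + normc (v i 0)) ^+ 2)).
  apply: ler_sum => i _; rewrite mxE lerXn2r ?nnegrE ?addr_ge0 ?normc_ge0 //.
  exact: normc_triangle.
under eq_bigr do rewrite sqrrD; rewrite !big_split /=.
by rewrite lerD2r lerD2l mulr2n lerD.
Qed.

Lemma l2normZ n (c : R) (u : 'cV[R[i]]_n) :
  l2norm (c%:C%C *: u) = `|c| * l2norm u.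
Proof.
rewrite /l2norm -[X in X * _]sqrtr_sqr -sqrtrM ?sqr_ge0 //; congr (Num.sqrt _).
rewrite mulr_sumr; apply: eq_bigr => i _.
by rewrite mxE normcM normc_real exprMn real_normK ?num_real.
Qed.

Lemma l2norm_eq0 n (u : 'cV[R[i]]_n) : l2norm u = 0 -> u = 0.
Proof.
move=> u0; have := l2norm_sqr u; rewrite u0 expr0n /= => /esym/eqP.
rewrite psumr_eq0 => [/allP h|i _]; last by rewrite sqr_ge0.
apply/matrixP => i j; rewrite (ord1 j) mxE; apply: eq0_normc.
by have := h i; rewrite mem_index_enum sqrf_eq0 => /(_ isT)/eqP.
Qed.

Lemma l2norm_restrict_le n (S S' : {set 'I_n}) (x : 'cV[R[i]]_n) :
  S \subset S' -> l2norm (restrict S x) <= l2norm (restrict S' x).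
Proof.
move=> SS; rewrite ler_wsqrtr //; apply: ler_sum => i _; rewrite !mxE.
case: ifP => [/(fintype.subsetP SS) ->//|_].
by rewrite normc0 expr0n sqr_ge0.
Qed.

End RealNorms.

Section BestApproximation.

Lemma filter_take_count (T : eqType) (leT : rel T) (p : pred T) (s : seq T) :
  transitive leT -> (forall a b, leT a b -> p b -> p a) -> sorted leT s ->
  [seq i <- s | p i] = take (count p s) s.
Proof.
move=> tr up; elim: s => //= a s IH.
rewrite (path_sortedE tr) => /andP[/allP ale ss]; case: ifP => pa.
  by rewrite add1n /= IH.
have cs : count p s = 0%N.
  apply/eqP; rewrite -leqn0 leqNgt -has_count; apply/hasPn => b bs.
  by apply/negP => pb; rewrite (up _ _ (ale _ bs) pb) in pa.
by rewrite cs take0; apply/eqP; rewrite -size_eq0 size_filter cs.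
Qed.

(** A strict level set never separates entries of equal magnitude, so sorting puts exactly its
    indices first, however ties are ordered. *)
Lemma largest_entries_level (R : realType) n (x : 'cV[R[i]]_n) (c : R) :
  let S := [set i | c < normc (x i 0)]%SET in
  largest_entries #|S| x = S.
Proof.
move=> S; apply/setP => i; rewrite inE.
set leT := fun _ _ => _; set s := sort leT _.
have tr : transitive leT by move=> a b d ba bd; apply: le_trans bd ba.
have tot : total leT by move=> a b; apply: le_total.
have cS : #|S| = count (mem S) s.
  rewrite (seq.permP (permEl (perm_sort _ _))) -size_filter cardE.
  by rewrite [enum S]/enum_mem -enumT.
rewrite cS -(filter_take_count tr) ?sort_sorted //.
  by rewrite mem_filter mem_sort mem_enum andbT.
by move=> a b ab; rewrite /= !inE => /lt_le_trans; apply.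
Qed.

End BestApproximation.

(** * Least squares on a selected set of columns *)

Section LeastSquares.
Variables (R : realType) (M N : nat) (F : 'M[R[i]]_(M, N)).

Definition hollow_form (u v : 'cV[R[i]]_N) : R[i] :=
  \sum_i \sum_(j | j != i) (u i 0)^* * (F ^t* *m F) i j * v j 0.

Lemma gram_diag i : l2norm (col i F) = 1 -> (F ^t* *m F) i i = 1.
Proof.
move=> Fi; have := normsq_l2norm (col i F); rewrite Fi expr1n rmorph1 => <-.
by rewrite normsqE !mxE; apply: eq_bigr => k _; rewrite !mxE.
Qed.

Lemma dot_frame (u v : 'cV[R[i]]_N) : (forall i, l2norm (col i F) = 1) ->
  (u ^t* *m (F ^t* *m (F *m v))) 0 0 =
  \sum_i (u i 0)^* * v i 0 + hollow_form u v.
Proof.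
move=> F1; rewrite [F ^t* *m _]mulmxA mxE /hollow_form -big_split /=.
apply: eq_bigr => i _; rewrite [(u ^t*) _ _]mxE [(_ ^T) _ _]mxE.
rewrite [(_ *m v) _ _]mxE (bigD1 i) //= gram_diag // mul1r mulrDr; congr (_ + _).
by rewrite mulr_sumr; apply: eq_bigr => j _; rewrite mulrA.
Qed.

Lemma hollow_formZ (a b : R) u v :
  hollow_form (a%:C%C *: u) (b%:C%C *: v) = (a * b)%:C%C * hollow_form u v.
Proof.
rewrite /hollow_form mulr_sumr; apply: eq_bigr => i _.
rewrite mulr_sumr; apply: eq_bigr => j _.
rewrite [(_ *: u) _ _]mxE [(_ *: v) _ _]mxE rmorphM /= (CrealP (_ : a%:C%C \is Num.real)).
  by rewrite rmorphM; ring.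
by rewrite complex_real.
Qed.

(** Scaling each vector by the norm of the other makes the norms equal, and the sum of squares
    becomes twice the product. *)
Lemma hollow_form_bilinear_bound (S : {set 'I_N}) (c : R) :
  (forall u v : 'cV[R[i]]_N,
     (forall i, i \notin S -> u i 0 = 0) -> (forall i, i \notin S -> v i 0 = 0) ->
     normc (hollow_form u v) <= c / 2 * (l2norm u ^+ 2 + l2norm v ^+ 2)) ->
  forall u v : 'cV[R[i]]_N,
    (forall i, i \notin S -> u i 0 = 0) -> (forall i, i \notin S -> v i 0 = 0) ->
    normc (hollow_form u v) <= c * (l2norm u * l2norm v).
Proof.
move=> h u v uS vS.
have [u0|u0] := eqVneq (l2norm u) 0.
  rewrite u0 mul0r mulr0 (_ : hollow_form u v = 0) ?normc0 //.
  rewrite /hollow_form (l2norm_eq0 u0) big1 // => i _; rewrite big1 // => j _.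
  by rewrite mxE conjC0 !mul0r.
have [v0|v0] := eqVneq (l2norm v) 0.
  rewrite v0 !mulr0 (_ : hollow_form u v = 0) ?normc0 //.
  rewrite /hollow_form (l2norm_eq0 v0) big1 // => i _; rewrite big1 // => j _.
  by rewrite [(0 : 'cV[R[i]]_N) j 0]mxE mulr0.
have up : 0 < l2norm u by rewrite lt_neqAle eq_sym u0 l2norm_ge0.
have vp : 0 < l2norm v by rewrite lt_neqAle eq_sym v0 l2norm_ge0.
have uvp : 0 < l2norm u * l2norm v by rewrite mulr_gt0.
have := h ((l2norm v)%:C%C *: u) ((l2norm u)%:C%C *: v).
rewrite hollow_formZ normcM !l2normZ normc_real !gtr0_norm ?(mulrC (l2norm v)) //.
have uS' i : i \notin S -> ((l2norm v)%:C%C *: u) i 0 = 0.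
  by move=> /uS; rewrite mxE => ->; rewrite mulr0.
have vS' i : i \notin S -> ((l2norm u)%:C%C *: v) i 0 = 0.
  by move=> /vS; rewrite mxE => ->; rewrite mulr0.
move=> /(_ uS' vS') h1; rewrite -(ler_pM2l uvp); apply: le_trans h1 _.
by rewrite le_eqVlt; apply/orP; left; apply/eqP; field.
Qed.

Lemma mul_zero_extend (S : {set 'I_N}) (v : 'cV[R[i]]_#|S|) :
  F *m zero_extend v = subcols F S *m v.
Proof.
apply/matrixP => m j; rewrite (ord1 j) !mxE.
under eq_bigr do rewrite mxE mulr_sumr.
rewrite (exchange_big_dep xpredT) //=; apply: eq_bigr => k _.
by rewrite (big_pred1 (enum_val k)) => [|i]; rewrite ?mxE 1?eq_sym.
Qed.

Lemma zero_extend_out (S : {set 'I_N}) (v : 'cV[R[i]]_#|S|) i :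
  i \notin S -> zero_extend v i 0 = 0.
Proof.
move=> iS; rewrite mxE big1 // => k /eqP ki.
by case/negP: iS; rewrite -ki enum_valP.
Qed.

(** With [B] the pseudoinverse of [A], the identity [A *m B *m A = A] and the Hermitian symmetry of
    [A *m B] make the residual orthogonal to the range of [A]. *)
Lemma normal_equations (S : {set 'I_N}) (y : 'cV[R[i]]_M) n : n \in S ->
  (F ^t* *m (y - F *m zero_extend (mp_pinv (subcols F S) *m y))) n 0 = 0.
Proof.
move=> nS; rewrite mul_zero_extend.
set A := subcols F S; have [ABA _ hAB _] := mp_pinvP A; set B := mp_pinv A in ABA hAB *.
have E : A ^t* *m (y - A *m (B *m y)) = 0.
  rewrite mulmxBr !mulmxA -(mulmxA _ A) -hAB -trmxC_mul ABA.
  by rewrite subrr.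
have <- : (A ^t* *m (y - A *m (B *m y))) (enum_rank_in nS n) 0 =
    (F ^t* *m (y - A *m (B *m y))) n 0.
  rewrite !mxE; apply: eq_bigr => k _; congr (_ * _).
  by rewrite !mxE enum_rankK_in.
by rewrite E mxE.
Qed.

(** The error is [w] on [S] plus the missed part [r] off [S]. Testing the normal equations against
    [w] removes the residual, and [w] is orthogonal to [r], so |w|^2 <= rho |w|^2 + rho |w| |r| +
    beta |w| sqrt |S|. Dividing by |w| bounds it without inverting a Gram matrix. *)
Lemma least_squares_error (S S0 : {set 'I_N}) (x : 'cV[R[i]]_N)
    (eps : 'cV[R[i]]_M) (rho beta : R) :
  (forall i, l2norm (col i F) = 1) -> 0 <= rho -> rho < 1 -> 0 <= beta ->
  (forall u v : 'cV[R[i]]_N,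
     (forall i, i \notin S0 -> u i 0 = 0) -> (forall i, i \notin S0 -> v i 0 = 0) ->
     normc (hollow_form u v) <= rho * (l2norm u * l2norm v)) ->
  (forall n, normc ((F ^t* *m eps) n 0) <= beta) ->
  S \subset S0 -> (forall i, i \notin S0 -> x i 0 = 0) ->
  l2norm (x - zero_extend (mp_pinv (subcols F S) *m (F *m x + eps))) <=
  beta * Num.sqrt #|S|%:R / (1 - rho) +
  (1 + rho / (1 - rho)) * l2norm (restrict (S0 :\: S) x).
Proof.
move=> F1 rho0 rho1 beta0 cond noise SS xS0.
set xh := zero_extend _; set r := restrict _ x.
pose w := restrict S x - xh.
have xE : x = restrict S x + r.
  apply/matrixP => i j; rewrite (ord1 j) !mxE finset.inE.
  case: (boolP (i \in S)) => iS /=; first by rewrite addr0.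
  by case: ifP => [|/negbT /xS0 ->]; rewrite ?add0r ?addr0.
have wS i : i \notin S -> w i 0 = 0.
  by move=> iS; rewrite mxE [(- xh) _ _]mxE zero_extend_out // subr0 mxE (negbTE iS).
have wS0 i : i \notin S0 -> w i 0 = 0.
  by move=> iS; apply: wS; apply: contra iS; apply: (fintype.subsetP SS).
have rS0 i : i \notin S0 -> r i 0 = 0.
  by move=> iS; rewrite mxE finset.inE (negbTE iS) andbF.
have rS i : i \in S -> r i 0 = 0 by move=> iS; rewrite mxE finset.inE iS.
have -> : x - xh = w + r by rewrite {1}xE /w addrAC.
have resE : F *m x + eps - F *m xh = F *m w + F *m r + eps.
  by rewrite -mulmxDr /w [_ - xh + r]addrAC -xE mulmxBr addrAC.
clearbody w.
have zero : (w ^t* *m (F ^t* *m (F *m w + F *m r + eps))) 0 0 = 0.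
  rewrite mxE big1 // => n _; case: (boolP (n \in S)) => nS.
    by rewrite -resE normal_equations // mulr0.
  by rewrite [(w ^t*) _ _]mxE [(_ ^T) _ _]mxE (wS _ nS) conjC0 mul0r.
have wr0 : \sum_i (w i 0)^* * r i 0 = 0.
  apply: big1 => i _; case: (boolP (i \in S)) => iS; first by rewrite rS ?mulr0.
  by rewrite wS // conjC0 mul0r.
have wwE : \sum_i (w i 0)^* * w i 0 = (l2norm w ^+ 2)%:C%C.
  rewrite -normsq_l2norm; apply: eq_bigr => i _.
  by rewrite normCK mulrC.
have main : (l2norm w ^+ 2)%:C%C =
    - (hollow_form w w + hollow_form w r + (w ^t* *m (F ^t* *m eps)) 0 0).
  move: zero; rewrite !mulmxDr mxE [X in X + _]mxE !dot_frame // wwE wr0 add0r.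
  by move=> /eqP; rewrite -!addrA addr_eq0 !addrA => /eqP.
have noise_w : normc ((w ^t* *m (F ^t* *m eps)) 0 0) <=
    l2norm w * (beta * Num.sqrt #|S|%:R).
  pose g : 'cV[R[i]]_N := restrict S (F ^t* *m eps).
  have -> : (w ^t* *m (F ^t* *m eps)) 0 0 = (w ^t* *m g) 0 0.
    rewrite mxE [RHS]mxE; apply: eq_bigr => i _; rewrite [g _ _]mxE.
    case: ifP => // /negbT iS.
    by rewrite [(w ^t*) _ _]mxE [(_ ^T) _ _]mxE (wS _ iS) conjC0 !mul0r.
  apply: le_trans (l2norm_dot_le _ _) _; rewrite ler_wpM2l ?l2norm_ge0 //.
  rewrite -[beta]ger0_norm // -sqrtr_sqr -sqrtrM ?sqr_ge0 // ler_wsqrtr //.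
  rewrite mulr_natr -sumr_const [leRHS]big_mkcond; apply: ler_sum => i _.
  rewrite mxE; case: ifP => _; last by rewrite normc0 expr0n.
  by rewrite lerXn2r ?nnegrE ?normc_ge0.
have sq : l2norm w ^+ 2 <= rho * (l2norm w * l2norm w) +
    rho * (l2norm w * l2norm r) + l2norm w * (beta * Num.sqrt #|S|%:R).
  rewrite -[leLHS]ger0_norm ?sqr_ge0 // -normc_real main normc_opp.
  apply: le_trans (normc_triangle _ _) _; apply: lerD => //.
  by apply: le_trans (normc_triangle _ _) _; apply: lerD; apply: cond.
have lin : (1 - rho) * l2norm w <= rho * l2norm r + beta * Num.sqrt #|S|%:R.
  have [w0|w0] := eqVneq (l2norm w) 0.
    by rewrite w0 mulr0 addr_ge0 ?mulr_ge0 ?l2norm_ge0 ?sqrtr_ge0.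
  have wp : 0 < l2norm w by rewrite lt_neqAle eq_sym w0 l2norm_ge0.
  rewrite -(ler_pM2l wp); move: sq; set a := beta * _; nra.
have rp : 0 < 1 - rho by rewrite subr_gt0.
apply: le_trans (l2normD _ _) _; rewrite mulrDl mul1r addrCA [leRHS]addrC.
rewrite [leLHS]addrC addrC lerD2r.
rewrite -(ler_pM2l rp); apply: le_trans lin _.
by rewrite le_eqVlt; apply/orP; left; apply/eqP; field; rewrite gt_eqF.
Qed.

End LeastSquares.

(** * The spectral norm as an operator bound *)

Section SpectralNorm.
Variables (R : realType) (M N : nat) (F : 'M[R[i]]_(M, N)).
Let S := spectral_norm F.

(** The supremum of an unbounded set would be a default value; this crude entrywise bound makes
    [spectral_norm] a genuine supremum. *)
Lemma has_ubound_spectral :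
  has_ubound [set l2norm (F *m v) | v in [set v : 'cV[R[i]]_N | l2norm v = 1]].
Proof.
exists (Num.sqrt (\sum_i (\sum_j normc (F i j)) ^+ 2)) => _ [v v1 <-].
rewrite ler_wsqrtr //; apply: ler_sum => i _.
have s0 : 0 <= \sum_j normc (F i j) by apply: sumr_ge0 => j _; apply: normc_ge0.
rewrite lerXn2r ?nnegrE ?normc_ge0 //.
rewrite mxE; apply: le_trans (normc_sum _ _) _; apply: ler_sum => j _.
rewrite normcM ler_piMr ?normc_ge0 //.
rewrite -(@ler_pXn2r _ 2) ?nnegrE ?normc_ge0 // -[in leRHS]v1 l2norm_sqr.
rewrite (bigD1 j) //= lerDl; apply: sumr_ge0 => k _; exact: sqr_ge0.
Qed.

Lemma l2norm_mul_le (v : 'cV[R[i]]_N) : l2norm (F *m v) <= S * l2norm v.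
Proof.
have [v0|v0] := eqVneq (l2norm v) 0.
  rewrite v0 mulr0 (l2norm_eq0 v0) mulmx0 /l2norm big1 ?sqrtr0 // => i _.
  by rewrite mxE normc0 expr0n.
have vp : 0 < l2norm v by rewrite lt_neqAle eq_sym v0 l2norm_ge0.
pose u := ((l2norm v)^-1)%:C%C *: v.
have u1 : l2norm u = 1 by rewrite l2normZ gtr0_norm ?invr_gt0 // mulVf.
have vE : v = (l2norm v)%:C%C *: u.
  by rewrite scalerA -rmorphM /= divff // rmorph1 scale1r.
rewrite {1}vE -scalemxAr l2normZ gtr0_norm // mulrC ler_pM2r //.
by apply: ub_le_sup; [exact: has_ubound_spectral | exists u].
Qed.

Hypothesis F1 : forall i, l2norm (col i F) = 1.

Lemma spectral_norm_ge1 (i : 'I_N) : 1 <= S.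
Proof.
rewrite -(F1 i) colE; apply: le_trans (l2norm_mul_le _) _.
rewrite ler_piMr //.
  have := l2norm_mul_le (delta_mx i 0); rewrite -colE F1.
  set a := l2norm _ => h; have a0 : 0 <= a by apply: l2norm_ge0.
  rewrite leNgt; apply/negP => S0.
  have : S * a <= 0 by rewrite mulr_le0_ge0 // ltW.
  by apply/negP; rewrite -ltNge; apply: lt_le_trans h.
rewrite -(@ler_pXn2r _ 2) ?nnegrE ?l2norm_ge0 // l2norm_sqr (bigD1 i) //= big1.
  by rewrite mxE !eqxx normc1 addr0.
by move=> j ji; rewrite mxE (negbTE ji) normc0 expr0n.
Qed.

Lemma normsq_adj_le (w : 'cV[R[i]]_M) : 0 <= S ->
  normsq (F ^t* *m w) <= (S ^+ 2)%:C%C * normsq w.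
Proof.
move=> S0; rewrite !normsq_l2norm -rmorphM lecR -exprMn.
set z := F ^t* *m w.
rewrite lerXn2r ?nnegrE ?mulr_ge0 ?l2norm_ge0 //.
have [z0|z0] := eqVneq (l2norm z) 0.
  by rewrite z0 mulr_ge0 ?l2norm_ge0.
have zp : 0 < l2norm z by rewrite lt_neqAle eq_sym z0 l2norm_ge0.
rewrite -(ler_pM2r zp) -expr2 -[leLHS]ger0_norm ?sqr_ge0 // -normc_real.
rewrite -normsq_l2norm normsqE {1}/z trmxC_mul trmxCK -mulmxA.
apply: le_trans (l2norm_dot_le _ _) _; rewrite [S * _]mulrC -mulrA.
by rewrite ler_wpM2l ?l2norm_ge0 // l2norm_mul_le.
Qed.

(** The squared Frobenius norm is N by columns, and at most [S ^+ 2] for each of the M rows. This is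
    how the support size is later seen to be at most M. *)
Lemma frame_size_le : 0 <= S -> N%:R <= M%:R * S ^+ 2.
Proof.
move=> S0; have h (k : 'I_M) : \sum_j normc (F k j) ^+ 2 <= S ^+ 2.
  have := normsq_adj_le (delta_mx k 0) S0.
  have -> : normsq (delta_mx k 0 : 'cV[R[i]]_M) = 1.
    rewrite /normsq (bigD1 k) //= big1 => [|j jk]; last first.
      by rewrite mxE (negbTE jk) normr0 expr0n.
    by rewrite mxE !eqxx normr1 expr1n addr0.
  rewrite mulr1 normsq_l2norm lecR l2norm_sqr; apply: le_trans.
  apply: ler_sum => j _; rewrite -colE !mxE normc_conj //.
have -> : N%:R = \sum_(k < M) \sum_j normc (F k j) ^+ 2.
  rewrite exchange_big /= -[LHS](_ : \sum_(j < N) 1 = _); last first.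
    by rewrite sumr_const card_ord.
  apply: eq_bigr => j _; have := l2norm_sqr (col j F); rewrite F1 expr1n => ->.
  by apply: eq_bigr => k _; rewrite mxE.
apply: le_trans (ler_sum _ (fun k _ => h k)) _.
by rewrite sumr_const card_ord mulr_natl.
Qed.

End SpectralNorm.

Section Coherence.
Variables (R : realType) (M N : nat) (F : 'M[R[i]]_(M, N)).

Lemma inner_col i j : inner (col i F) (col j F) = (F ^t* *m F) j i.
Proof.
by rewrite /inner mxE; apply: eq_bigr => k _; rewrite !mxE mulrC.
Qed.

Lemma bigmax_ge (I : finType) (Q : pred I) (f : I -> R) i : Q i ->
  f i <= \big[Num.max/0]_(j | Q j) f j.
Proof. by move=> Qi; rewrite (bigD1 i) //= le_max lexx. Qed.

Lemma worst_coherence_ge i j : i != j ->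
  normc ((F ^t* *m F) i j) <= worst_coherence F.
Proof.
move=> ij; rewrite -inner_col.
apply: le_trans (bigmax_ge (fun j0 => \big[Num.max/0]_(j1 < N | j1 != j0)
  normc (inner (col j0 F) (col j1 F))) (isT : xpredT j)).
exact: (bigmax_ge (fun j1 => normc (inner (col j F) (col j1 F)))).
Qed.

Lemma worst_coherence_ge0 : 0 <= worst_coherence F.
Proof.
rewrite /worst_coherence; elim/big_ind: _ => // [x y x0 _|i _].
  by rewrite le_max x0.
elim/big_ind: _ => // [x y x0 _|j _]; first by rewrite le_max x0.
exact: normc_ge0.
Qed.

Lemma avg_coherence_ge i : (1 < N)%N ->
  normc (\sum_(j | j != i) (F ^t* *m F) i j) <= (N%:R - 1) * avg_coherence F.
Proof.
move=> N1; have N0 : N%:R - 1 != 0 :> R.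
  by rewrite subr_eq0 pnatr_eq1 gtn_eqF.
rewrite /avg_coherence mulrA divff // mul1r.
apply: le_trans (bigmax_ge (fun i => normc (\sum_(j | j != i)
  inner (col i F) (col j F))) (isT : xpredT i)).
rewrite le_eqVlt; apply/orP; left; apply/eqP.
rewrite -normc_conj rmorph_sum; congr normc; apply: eq_bigr => j _ /=.
by rewrite inner_col [RHS]gram_conj.
Qed.

End Coherence.

Section DeterministicOST.
Variables (R : realType) (M N : nat) (F : 'M[R[i]]_(M, N)).
Variables (t sigma snrv : R) (x : 'cV[R[i]]_N) (eps : 'cV[R[i]]_M).
Hypothesis F1 : forall i, l2norm (col i F) = 1.
Hypotheses (t0 : 0 < t) (t1 : t < 1) (sigma0 : 0 < sigma).
Let mu := worst_coherence F.
Let L := ln N%:R : R.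
Let rho := expR (- (1 / 2)) : R.
Let lambda := ost_lambda F sigma t snrv.
Let y := F *m x + eps.
Let Khat := ost_support F y lambda.
Hypothesis L0 : 0 <= L.
Hypothesis snr_eq : M%:R * snrv = l2norm x ^+ 2 / sigma ^+ 2.
Hypothesis interference : forall n,
  normc ((F ^t* *m (F *m x)) n 0 - x n 0) <=
  10 * mu * l2norm x * Num.sqrt (2 * L).
Hypothesis noise : forall n,
  normc ((F ^t* *m eps) n 0) <= 2 * sigma * Num.sqrt L.
Hypothesis conditioning : forall u v : 'cV[R[i]]_N,
  (forall i, i \notin supp x -> u i 0 = 0) ->
  (forall i, i \notin supp x -> v i 0 = 0) ->
  normc (hollow_form F u v) <= rho * (l2norm u * l2norm v).

Let a := 10 * mu * l2norm x * Num.sqrt (2 * L).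
Let b := 2 * sigma * Num.sqrt L.

Lemma sqrt_noise_level : Num.sqrt (2 * sigma ^+ 2 * L) * Num.sqrt 2 = b.
Proof.
rewrite -sqrtrM; last by rewrite mulr_ge0 // mulr_ge0 // sqr_ge0.
rewrite (_ : 2 * sigma ^+ 2 * L * 2 = (2 * sigma) ^+ 2 * L); last by ring.
by rewrite sqrtrM ?sqr_ge0 // sqrtr_sqr gtr0_norm // mulr_gt0.
Qed.

(** By [snr_eq], sqrt (M snr) is |x| / sigma. The parameter [t] thus divides the threshold between
    interference [a] and noise [b], whose sum it dominates. *)
Lemma ost_lambdaE : lambda = Num.max (a / t) (b / (1 - t)).
Proof.
rewrite /lambda /ost_lambda maxr_pMr ?sqrtr_ge0 //; congr Num.max; last first.
  by rewrite mulrA sqrt_noise_level.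
have -> : 2 * sigma ^+ 2 * ln N%:R = sigma ^+ 2 * (2 * L) by rewrite /L; ring.
rewrite snr_eq (sqrtrM _ (sqr_ge0 sigma)) (sqrtrM _ (sqr_ge0 (l2norm x))).
rewrite sqrtrV ?sqr_ge0 // !sqrtr_sqr (ger0_norm (l2norm_ge0 x)).
rewrite (gtr0_norm sigma0) -/mu.
by rewrite /a -/mu; field; rewrite !gt_eqF.
Qed.

Lemma lambda_ge : a + b <= lambda.
Proof.
have at' : a <= t * lambda.
  by rewrite mulrC -ler_pdivrMr // ost_lambdaE le_max lexx.
have bt : b <= (1 - t) * lambda.
  by rewrite mulrC -ler_pdivrMr ?subr_gt0 // ost_lambdaE le_max lexx orbT.
apply: le_trans (lerD at' bt) _; rewrite -mulrDl.
by rewrite addrC subrK mul1r.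
Qed.

Lemma matched_filter_error n : normc ((F ^t* *m y) n 0 - x n 0) <= lambda.
Proof.
apply: le_trans lambda_ge; rewrite /y mulmxDr mxE addrAC.
by apply: le_trans (normc_triangle _ _) _; apply: lerD.
Qed.

Let S := (T_sigma sigma t x :&: T_mu F t x)%SET.

(** The two levels are twice the two branches of [lambda]. As a strict level set, [S] consists of
    the [#|S|] largest entries. *)
Lemma threshold_setE : S = [set n | 2 * lambda < normc (x n 0)]%SET.
Proof.
apply/setP => n; rewrite !finset.inE ost_lambdaE maxr_pMr // gt_max andbC.
congr (_ && _); congr (_ < _).
  by rewrite /a /mu /L; field; rewrite gt_eqF.
rewrite -sqrt_noise_level; field.
by rewrite gt_eqF ?subr_gt0.
Qed.

Lemma threshold_set_sub : S \subset Khat.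
Proof.
apply/fintype.subsetP => n; rewrite threshold_setE !finset.inE => xn.
have := matched_filter_error n; rewrite -normc_opp opprB.
have := normc_triangle (x n 0 - (F ^t* *m y) n 0) ((F ^t* *m y) n 0).
rewrite subrK -/lambda; lra.
Qed.

Lemma ost_support_sub : Khat \subset supp x.
Proof.
apply/fintype.subsetP => n; rewrite !finset.inE => zn; apply/eqP => xn.
have := matched_filter_error n; rewrite xn subr0 -/lambda.
by apply/negP; rewrite -ltNge.
Qed.

Let rho0 : 0 < rho. Proof. exact: expR_gt0. Qed.

Let rho1 : rho < 1.
Proof. by rewrite /rho -[X in _ < X]expR0 ltr_expR oppr_lt0 divr_gt0. Qed.

Let x_out i : i \notin supp x -> x i 0 = 0.
Proof. by rewrite finset.inE negbK => /eqP. Qed.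

Lemma ost_error :
  l2norm (x - ost_estimate F y lambda) <=
  ost_c2 R * Num.sqrt (sigma ^+ 2 * #|Khat|%:R * L)
  + ost_c3 R * l2norm (restrict (supp x :\: Khat)%SET x).
Proof.
have b0 : 0 <= b by rewrite !mulr_ge0 ?sqrtr_ge0 // ltW.
have := least_squares_error F1 (ltW rho0) rho1 b0 conditioning noise
  ost_support_sub x_out.
rewrite -/y => /le_trans; apply; rewrite lerD2r /ost_c2 -/rho.
rewrite -[sigma ^+ 2 * _ * L]mulrA (sqrtrM _ (sqr_ge0 sigma)) sqrtr_sqr.
rewrite (gtr0_norm sigma0) (sqrtrM _ (ler0n R #|Khat|)).
rewrite le_eqVlt; apply/orP; left; apply/eqP; rewrite /b; field.
by rewrite gt_eqF // subr_gt0.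
Qed.

Lemma ost_error_best_approx :
  l2norm (x - ost_estimate F y lambda) <=
  ost_c2 R * Num.sqrt (sigma ^+ 2 * #|supp x|%:R * L)
  + ost_c3 R * l2norm (x - best_approx #|S| x).
Proof.
apply: le_trans ost_error _; apply: lerD.
  apply: ler_wpM2l; first by rewrite divr_ge0 // subr_ge0 ltW.
  rewrite ler_wsqrtr // ler_wpM2r // ler_wpM2l ?sqr_ge0 // ler_nat.
  by rewrite subset_leq_card // ost_support_sub.
apply: ler_wpM2l.
  by rewrite addr_ge0 // divr_ge0 ?(ltW rho0) // subr_ge0 ltW.
have -> : x - best_approx #|S| x = restrict (~: S)%SET x.
  rewrite /best_approx threshold_setE largest_entries_level.
  apply/matrixP => i j; rewrite (ord1 j) !mxE !finset.inE.
  by case: ifP; rewrite ?subrr ?subr0.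
apply: l2norm_restrict_le; apply/fintype.subsetP => i.
rewrite !finset.in_setD finset.in_setC => /andP[iK _].
by apply: contra iK; apply: (fintype.subsetP threshold_set_sub).
Qed.

End DeterministicOST.

(** * Probability of the good event *)

Section Interference.
Variable R : realType.

Lemma Re_add (z z' : R[i]) : complex.Re (z + z') = complex.Re z + complex.Re z'.
Proof. by case: z; case: z'. Qed.

Lemma Im_add (z z' : R[i]) : complex.Im (z + z') = complex.Im z + complex.Im z'.
Proof. by case: z; case: z'. Qed.

Lemma Re_sub (z z' : R[i]) : complex.Re (z - z') = complex.Re z - complex.Re z'.
Proof. by case: z; case: z'. Qed.

Lemma Im_sub (z z' : R[i]) : complex.Im (z - z') = complex.Im z - complex.Im z'.
Proof. by case: z; case: z'. Qed.

Lemma Re_sum (I : finType) (Q : pred I) (f : I -> R[i]) :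
  complex.Re (\sum_(i | Q i) f i) = \sum_(i | Q i) complex.Re (f i).
Proof. exact: (big_morph _ Re_add). Qed.

Lemma Im_sum (I : finType) (Q : pred I) (f : I -> R[i]) :
  complex.Im (\sum_(i | Q i) f i) = \sum_(i | Q i) complex.Im (f i).
Proof. exact: (big_morph _ Im_add). Qed.

Lemma Re_mul (z z' : R[i]) : complex.Re (z * z') =
  complex.Re z * complex.Re z' - complex.Im z * complex.Im z'.
Proof. by case: z; case: z'. Qed.

Lemma normc_sqr (z : R[i]) :
  normc z ^+ 2 = complex.Re z ^+ 2 + complex.Im z ^+ 2.
Proof. by case: z => a b /=; rewrite sqr_sqrtr // addr_ge0 ?sqr_ge0. Qed.

Lemma Re_le_normc (z : R[i]) : complex.Re z <= normc z.
Proof.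
apply: le_trans (ler_norm _) _.
rewrite -(@ler_pXn2r _ 2) ?nnegrE ?normc_ge0 // real_normK ?num_real //.
by rewrite normc_sqr lerDl sqr_ge0.
Qed.

Lemma expR_tenth_le : expR (1 / 10) <= 10 / 9 :> R.
Proof.
have := expR_ge1Dx (- (1 / 10) : R).
rewrite expRN => h; have e0 := expR_gt0 (1 / 10 : R).
have : (1 - 1 / 10) * expR (1 / 10) <= 1 :> R.
  by rewrite -ler_pdivlMr // [leRHS]div1r.
lra.
Qed.

(* The mean of b accounts for mu X in the threshold, hence the coefficients are
   centred before [perm_linear_mgf] applies. *)
Lemma perm_sum_tail N (A : {set 'I_N}) (c b : 'I_N -> R[i]) (mu X L : R) :
  0 < mu -> 0 < X -> 7 <= L -> (0 < #|A|)%N -> (20 * #|A| <= N)%N ->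
  (forall j, normc (b j) <= mu) ->
  normc (\sum_j b j) * (\sum_(a in A) normc (c a)) <= N%:R * (mu * X) ->
  \sum_(a in A) normc (c a) ^+ 2 = X ^+ 2 ->
  #|[set t : {perm 'I_N} | 10 * mu * X * Num.sqrt L <
       complex.Re (\sum_(a in A) c a * b (t a))]%SET|%:R * expR (2 * L) <=
  (N`!)%:R.
Proof.
move=> mu0 X0 L7 K0 KN bmu mean cX.
have N0 : (0 < N)%N by apply: leq_trans KN; rewrite muln_gt0.
have NR : (0 : R) < N%:R by rewrite ltr0n.
pose beta := (N%:R^-1)%:C%C * \sum_j b j.
pose b' j := b j - beta.
have sumb' : \sum_j b' j = 0.
  rewrite sumrB sumr_const card_ord -mulr_natl /beta mulrA.
  rewrite -[N%:R in X in _ - X]/((N%:R : R[i])) -(rmorph_nat (real_complex R)).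
  by rewrite -rmorphM /= divff ?gt_eqF // rmorph1 mul1r subrr.
pose sq := Num.sqrt L.
have sq2 : sq ^+ 2 = L by rewrite sqr_sqrtr //; lra.
have sq0 : 0 <= sq by apply: sqrtr_ge0.
(* With this choice the moment exponent is [21 / 10 * z * L], at most [5 / 2 * L], while a bad
   permutation contributes an exponent [5 * L - sq / 2], at least [24 / 5 * L]; the difference
   covers [2 * L]. *)
pose theta := sq / (2 * mu * X).
have th0 : 0 <= theta by rewrite divr_ge0 // !mulr_ge0 // ltW.
have r0 : \sum_j complex.Re (b' j) = 0 by rewrite -Re_sum sumb'.
have s0 : \sum_j complex.Im (b' j) = 0 by rewrite -Im_sum sumb'.
have g0 : 0 <= 4 * mu ^+ 2 by rewrite mulr_ge0 ?sqr_ge0.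
have osc i j : (complex.Re (b' i) - complex.Re (b' j)) ^+ 2 +
    (complex.Im (b' i) - complex.Im (b' j)) ^+ 2 <= 4 * mu ^+ 2.
  have -> : complex.Re (b' i) - complex.Re (b' j) = complex.Re (b i - b j).
    by rewrite /b' !Re_sub; ring.
  have -> : complex.Im (b' i) - complex.Im (b' j) = complex.Im (b i - b j).
    by rewrite /b' !Im_sub; ring.
  rewrite -normc_sqr (_ : 4 * mu ^+ 2 = (2 * mu) ^+ 2); last by ring.
  rewrite lerXn2r ?nnegrE ?normc_ge0 ?mulr_ge0 ?(ltW mu0) //.
  apply: le_trans (normc_triangle _ _) _; rewrite normc_opp.
  by have := bmu i; have := bmu j; lra.
have KR : (1 : R) <= #|A|%:R by rewrite ler1n.
have KNR : 20 * #|A|%:R <= N%:R :> R by rewrite -natrM ler_nat.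
have KltN : (#|A| < N)%N.
  by apply: leq_trans KN; rewrite -[X in (X < _)%N]mul1n ltn_pmul2r.
(* This [zeta] keeps the accumulated inflation below e^(1/10), and [20 * #|A| <= N] makes the drift
   term at most 1 / 25, so that 21 / 10 is admissible for [C0]. *)
have zeta0 : 0 < 1 / (10 * #|A|%:R) :> R by rewrite divr_gt0 // mulr_gt0 //; lra.
have num : 2 + 21 / 10 * ((1 + (1 / (10 * #|A|%:R))^-1) * #|A|%:R /
    (N - #|A|)%:R ^+ 2) <= 21 / 10 :> R.
  rewrite natrB ?(ltnW KltN) // div1r invrK.
  set k := #|A|%:R in KR KNR *; set n := N%:R in KNR *.
  have nk : 19 * k <= n - k by lra.
  have nk0 : 0 < n - k by lra.
  have h1 : (1 + 10 * k) * k <= 11 * k ^+ 2 by nra.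
  have h2 : 19 ^+ 2 * k ^+ 2 <= (n - k) ^+ 2.
    rewrite -exprMn lerXn2r ?nnegrE ?(ltW nk0) // mulr_ge0 //; lra.
  have : (1 + 10 * k) * k / (n - k) ^+ 2 <= 1 / 25.
    rewrite ler_pdivrMr ?exprn_gt0 //; apply: le_trans h1 _; nra.
  lra.
have := perm_linear_mgf r0 s0 g0 osc zeta0 KltN _ num
  (fun a => theta * complex.Re (c a)) (fun a => - (theta * complex.Im (c a)))
  (leqnn #|A|).
have -> : \sum_(a in A) ((theta * complex.Re (c a)) ^+ 2 +
    (- (theta * complex.Im (c a))) ^+ 2) = theta ^+ 2 * X ^+ 2.
  rewrite -cX mulr_sumr; apply: eq_bigr => a _; rewrite normc_sqr; ring.
have C00 : 0 <= 21 / 10 :> R by rewrite divr_ge0.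
move=> /(_ C00).
have -> : theta ^+ 2 * X ^+ 2 = L / (4 * mu ^+ 2).
  by rewrite /theta expr_div_n sq2; field; rewrite !gt_eqF.
set z := _ ^+ #|A|; set Sm := \sum_t _ => mgf.
have z_le : z <= 10 / 9.
  apply: le_trans expR_tenth_le.
  have -> : 1 / 10 = 1 / (10 * #|A|%:R) * #|A|%:R :> R.
    by field; rewrite gt_eqF //; lra.
  have hz : 0 <= 1 + 1 / (10 * #|A|%:R) :> R by rewrite addr_ge0 // ltW.
  by rewrite expRM_natr lerXn2r ?nnegrE ?expR_ge0 // expR_ge1Dx.
have exp_le : 21 / 10 * (4 * mu ^+ 2) * z * (L / (4 * mu ^+ 2)) <= 5 / 2 * L.
  have -> : 21 / 10 * (4 * mu ^+ 2) * z * (L / (4 * mu ^+ 2)) = 21 / 10 * z * L.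
    by field; rewrite gt_eqF.
  nra.
set Bad := [set _ | _]%SET.
have bad_le : #|Bad|%:R * expR (24 / 5 * L) <= Sm.
  rewrite mulr_natl -sumr_const [leLHS]big_mkcond; apply: ler_sum => t _.
  case: ifP => [|_]; last exact: expR_ge0.
  rewrite finset.inE => tB; rewrite ler_expR.
  have -> : \sum_(a in A) (theta * complex.Re (c a) * complex.Re (b' (t a)) +
      - (theta * complex.Im (c a)) * complex.Im (b' (t a))) =
      theta * (complex.Re (\sum_(a in A) c a * b (t a)) -
               complex.Re (beta * \sum_(a in A) c a)).
    rewrite !mulr_sumr !Re_sum -sumrB mulr_sumr; apply: eq_bigr => a _.
    by rewrite /b' Re_sub Im_sub (Re_mul (c a)) (Re_mul beta); ring.
  have drift : complex.Re (beta * \sum_(a in A) c a) <= mu * X.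
    apply: le_trans (Re_le_normc _) _; rewrite normcM /beta normcM normc_real.
    rewrite gtr0_norm ?invr_gt0 // -mulrA ler_pdivrMl //.
    apply: le_trans mean; rewrite ler_wpM2l ?normc_ge0 //.
    exact: normc_sum.
  have sq_le : sq <= 2 / 5 * L by rewrite -sq2; nra.
  have muX : 0 < mu * X by rewrite mulr_gt0.
  have : mu * X * (10 * sq - 1) <= complex.Re (\sum_(a in A) c a * b (t a)) -
               complex.Re (beta * \sum_(a in A) c a).
    by move: tB; rewrite -/sq; lra.
  move=> /(ler_wpM2l th0); apply: le_trans.
  have -> : theta * (mu * X * (10 * sq - 1)) = 5 * sq ^+ 2 - sq / 2.
    by rewrite /theta; field; rewrite !gt_eqF.
  rewrite sq2; lra.
have e0 := expR_gt0 (14 / 5 * L).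
rewrite -(ler_pM2r e0) -[_ * expR (2 * L) * _]mulrA -expRD.
have -> : 2 * L + 14 / 5 * L = 24 / 5 * L by field.
apply: le_trans bad_le _; apply: le_trans mgf _.
rewrite ler_wpM2l // ler_expR; apply: le_trans exp_le _; lra.
Qed.


End Interference.

(** * Numerical constants *)

Section Numerics.
Variable R : realType.

Lemma expR1_le3 : expR 1 <= 3 :> R.
Proof.
have h := expR_ge1Dx (- (1 / 8) : R).
have e0 := expR_gt0 (1 / 8 : R).
have h8 : expR (1 / 8) <= 8 / 7 :> R.
  rewrite expRN in h.
  have : (1 - 1 / 8) * expR (1 / 8) <= 1 :> R.
    by rewrite -ler_pdivlMr // [leRHS]div1r.
  lra.
have -> : 1 = 1 / 8 * 8%:R :> R by field.
rewrite expRM_natr; apply: (@le_trans _ _ ((8 / 7) ^+ 8)).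
  by rewrite lerXn2r ?nnegrE ?divr_ge0 // ltW.
lra.
Qed.

Lemma expR1_ge : 61 / 25 <= expR 1 :> R.
Proof.
have h := expR_ge1Dx (1 / 4 : R).
have -> : 1 = 1 / 4 * 4%:R :> R by field.
rewrite expRM_natr; apply: (@le_trans _ _ ((5 / 4) ^+ 4)); first by lra.
rewrite lerXn2r ?nnegrE ?expR_ge0 ?divr_ge0 //; lra.
Qed.

Lemma expRNhalf_ge : 54 / 100 <= expR (- (1 / 2)) :> R.
Proof.
have h := expR_ge1Dx (- (1 / 4) : R).
have -> : - (1 / 2) = - (1 / 4) * 2%:R :> R by field.
rewrite expRM_natr; apply: (@le_trans _ _ ((3 / 4) ^+ 2)); first by lra.
rewrite lerXn2r ?nnegrE ?expR_ge0 ?divr_ge0 //; lra.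
Qed.

Lemma ost_c1_sqr_ge : 20 ^+ 3 <= ost_c1 R ^+ 2.
Proof.
have c90 : 90 <= ost_c1 R by have := expR1_ge; rewrite /ost_c1; lra.
apply: (@le_trans _ _ (90 ^+ 2)); first by lra.
by rewrite lerXn2r ?nnegrE //; apply: le_trans c90.
Qed.

Lemma ln_nat_ge_half N : (1 < N)%N -> 1 / 2 <= ln N%:R :> R.
Proof.
move=> N1; rewrite -ler_expR lnK ?posrE ?ltr0n 1?ltnW //.
apply: (@le_trans _ _ 2); last by rewrite ler_nat.
have h := expR_ge1Dx (- (1 / 2) : R); have e0 := expR_gt0 (1 / 2 : R).
rewrite expRN in h.
have : (1 - 1 / 2) * expR (1 / 2) <= 1 :> R.
  by rewrite -ler_pdivlMr // [leRHS]div1r.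
lra.
Qed.

(** Since log N is at least 1 / 2, N is at least 4000, above 3^7 and hence above e^7. *)
Lemma ln_large N : (1 < N)%N -> 20 ^+ 3 * ln N%:R <= N%:R :> R -> 7 <= ln N%:R :> R.
Proof.
move=> N1 h; have h2 := ln_nat_ge_half N1.
rewrite -ler_expR lnK ?posrE ?ltr0n 1?ltnW //.
have -> : 7 = 1 * 7%:R :> R by rewrite mul1r.
rewrite expRM_natr; apply: (@le_trans _ _ (3 ^+ 7)); last by lra.
by rewrite lerXn2r ?nnegrE ?expR_ge0 // expR1_le3.
Qed.

Lemma pow9_ge N q : (0 < N)%N -> 2 * ln N%:R <= q%:R :> R ->
  (N ^ 4 <= 9 ^ q)%N.
Proof.
move=> N0 h; rewrite -(ler_nat R) !natrX.
have {1}<- : expR (ln N%:R) = N%:R :> R by rewrite lnK // posrE ltr0n.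
rewrite -expRM_natr; apply: (@le_trans _ _ (expR (2 * q%:R))).
  by rewrite ler_expR; lra.
rewrite expRM_natr lerXn2r ?nnegrE ?expR_ge0 //.
have -> : 2 = 1 * 2%:R :> R by rewrite mul1r.
rewrite expRM_natr; have := expR1_le3; have := expR_gt0 (1 : R).
set e := expR 1; nra.
Qed.

End Numerics.

(** The loss (2 N + M) c N is at most 3 c N^2, hence at most N^3, against the gain N^4. *)
Lemma count_of_moment M N c q a f : (M <= N)%N -> (0 < N)%N ->
  (3 * c <= N)%N -> (N ^ 4 <= q)%N ->
  (a * q <= f * (N + M + N) * (c * N))%N -> (N * a <= f)%N.
Proof.
move=> MN N0 cN Nq aq.
have h1 : ((N + M + N) * (c * N) <= N ^ 3)%N.
  have s3 : (N + M + N <= 3 * N)%N by lia.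
  apply: leq_trans (leq_mul s3 (leqnn _)) _.
  rewrite mulnACA !expnS expn0 muln1 [(N * (N * N))%N]mulnC mulnC.
  by rewrite leq_mul2l cN orbT.
have N3 : (0 < N ^ 3)%N by rewrite expn_gt0 N0.
rewrite -(leq_pmul2r N3) mulnAC -expnS mulnC.
apply: leq_trans (leq_mul (leqnn a) Nq) _; apply: leq_trans aq _.
by rewrite -mulnA leq_mul.
Qed.

Lemma normc_le_of_dirs (R : realType) (w : R[i]) (r : R) : 0 <= r ->
  (forall k : 'I_4, complex.Re ((0 +i* 1)%C ^+ k * w) <= r) ->
  normc w <= Num.sqrt 2 * r.
Proof.
move=> r0 h; rewrite -(@ler_pXn2r _ 2) ?nnegrE ?normc_ge0 ?mulr_ge0 ?sqrtr_ge0 //.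
rewrite exprMn sqr_sqrtr // normc_sqr.
have := h (inord 0); have := h (inord 1); have := h (inord 2); have := h (inord 3).
rewrite !inordK // expr0 expr1 !exprS expr0; case: w {h} => a b /=.
rewrite !(mul0r, mul1r, mulr0, mulr1, sub0r, subr0, add0r, addr0, oppr0).
rewrite !(mulNr, opprK, mul1r, mul0r, sub0r, subr0, addr0, add0r).
move=> h3 h2 h1 h0.
have a2 : a ^+ 2 <= r ^+ 2 by nra.
have b2 : b ^+ 2 <= r ^+ 2 by nra.
by rewrite mulr_natl mulr2n lerD.
Qed.

Lemma normc_dir (R : realType) (k : nat) : normc ((0 +i* 1)%C ^+ k : R[i]) = 1.
Proof.
elim: k => [|k IH]; first by rewrite expr0 normc1.
rewrite exprS normcM IH mulr1 /normc /=.
by rewrite expr0n expr1n add0r sqrtr1.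
Qed.

(** * Permutations with small interference and a well conditioned hollow Gram form *)

Section GoodPermutations.
Variables (R : realType) (M N : nat) (F : 'M[R[i]]_(M, N)).
Variable x0 : 'cV[R[i]]_N.
Hypothesis F1 : forall i, l2norm (col i F) = 1.
Hypothesis N1 : (1 < N)%N.
Hypothesis MN : (M <= N)%N.
Let mu := worst_coherence F.
Let L := ln N%:R : R.
Let S := spectral_norm F.
Let A := supp x0.
Hypothesis K0 : (0 < #|A|)%N.
Hypothesis hK : #|A|%:R <= N%:R / (ost_c1 R ^+ 2 * S ^+ 2 * L).
Hypothesis mu_le : mu <= 1 / (164 * L).
Hypothesis nu_le : avg_coherence F <= mu / Num.sqrt M%:R.

Let L0 : 0 < L.
Proof. by have := @ln_nat_ge_half R _ N1; rewrite /L; lra. Qed.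

Let S1 : 1 <= S. Proof. exact: (spectral_norm_ge1 F1 (Ordinal N1)). Qed.

Let KSL : 20 ^+ 3 * (#|A|%:R * S ^+ 2 * L) <= N%:R.
Proof.
have S0 : 0 < S by apply: lt_le_trans S1.
have c1 := @ost_c1_sqr_ge R.
have d0 : 0 < ost_c1 R ^+ 2 * S ^+ 2 * L.
  by rewrite !mulr_gt0 ?exprn_gt0 // /ost_c1 mulr_gt0 ?expR_gt0.
move: hK; rewrite ler_pdivlMr //; apply: le_trans.
have -> : #|A|%:R * (ost_c1 R ^+ 2 * S ^+ 2 * L) =
  ost_c1 R ^+ 2 * (#|A|%:R * S ^+ 2 * L) by ring.
by rewrite ler_wpM2r // !mulr_ge0 ?sqr_ge0 // ltW.
Qed.

Let KR : 1 <= #|A|%:R :> R. Proof. by rewrite ler1n. Qed.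

Let S2 : 1 <= S ^+ 2. Proof. exact: exprn_ege1. Qed.

Let L7 : 7 <= L.
Proof.
apply: ln_large => //; apply: le_trans KSL; rewrite ler_pM2l ?exprn_gt0 //.
by rewrite ler_peMl ?(ltW L0) // mulr_ege1.
Qed.

Let KLN : 20 ^+ 3 * (#|A|%:R * L) <= N%:R.
Proof.
apply: le_trans KSL; rewrite ler_pM2l ?exprn_gt0 // [leRHS]mulrAC ler_peMr //.
by rewrite mulr_ge0 // ltW.
Qed.

Let KN : (20 * #|A| <= N)%N.
Proof.
rewrite -(ler_nat R) natrM; apply: le_trans KLN.
have := L7; have := KR; set k := #|A|%:R; nra.
Qed.

Let N_large : (3 * 200 <= N)%N.
Proof.
rewrite -(ler_nat R) natrM; apply: le_trans KLN.
have := L7; have := KR; set k := #|A|%:R; nra.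
Qed.

Let mu0 : 0 <= mu. Proof. exact: worst_coherence_ge0. Qed.

Let M_large : #|A|%:R <= M%:R :> R.
Proof.
have S0 : 0 < S by apply: lt_le_trans S1.
have S20 : 0 < S ^+ 2 by rewrite exprn_gt0.
rewrite -(ler_pM2r S20); apply: le_trans (frame_size_le F1 (ltW S0)).
apply: le_trans KSL; rewrite [leRHS]mulrCA; apply: ler_peMr.
  by rewrite mulr_ge0 // ltW.
by have := L7; lra.
Qed.

(* With q about 2 ln N one has N ^ 4 <= 9 ^ q.+1, which beats the dimensional
   factor 3 N, the loss 200 N from decoupling, and the required N. *)
Lemma conditioning_tail : exists Bad : {set {perm 'I_N}},
  (N * #|Bad| <= N`!)%N /\
  forall (t : {perm 'I_N}) (u v : 'cV[R[i]]_N), t \notin Bad ->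
    (forall i, i \notin (t @: A)%SET -> u i 0 = 0) ->
    (forall i, i \notin (t @: A)%SET -> v i 0 = 0) ->
    normc (hollow_form F u v) <= expR (- (1 / 2)) * (l2norm u * l2norm v).
Proof.
have S0 : 0 < S by apply: lt_le_trans S1.
(* Rounding down makes [q.+1] exceed [2 * L], as [pow9_ge] wants, while [L >= 7] keeps it below
   [22 / 10 * L]. *)
pose q := Num.truncn (2 * L).
have /andP[q1 q2] : q%:R <= 2 * L < q.+1%:R by apply: truncn_itv; have := L0; lra.
have q3 : q.+1%:R <= 22 / 10 * L :> R.
  by rewrite -natr1; have := L7; lra.
have KltN : (#|A| < N)%N.
  by apply: leq_trans KN; rewrite -[X in (X < _)%N]mul1n ltn_pmul2r.
pose iv := L^-1; have iv0 : 0 < iv by rewrite invr_gt0.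
have Liv : L * iv = 1 by rewrite divff // gt_eqF.
(* [b] is 1 / 20^3 divided by [L], corrected by 20 / 19 because up to N / 20 values are already
   taken. [eta] is just above nine times the sum of [b] and [q.+1%:R * mu ^+ 2]; this is where the
   coherence bound 1 / (164 log N), weakened to 1 / (160 log N), is spent. *)
pose b := iv / (19 * 20 ^+ 2); pose eta := iv / (5 * 10 ^+ 2).
have b0 : 0 < b by rewrite divr_gt0 // mulr_gt0 // exprn_gt0.
have eta0 : 0 < eta by rewrite divr_gt0 // mulr_gt0 // exprn_gt0.
have iv1 : iv <= 1 / 7.
  by rewrite -(ler_pM2l L0) Liv; have := L7; lra.
have mu_iv : mu <= iv / (16 * 10).
  apply: le_trans mu_le _; rewrite invfM mul1r mulrC ler_wpM2l ?(ltW iv0) //.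
  by rewrite lef_pV2 ?posrE //; lra.
have mu1 : mu <= 1 by apply: le_trans mu_iv _; lra.
have mu2 : mu ^+ 2 <= iv ^+ 2 / (16 * 10) ^+ 2.
  by rewrite -expr_div_n lerXn2r ?nnegrE // divr_ge0 // ltW.
have c_frame : #|A|%:R * S ^+ 2 <= b * (N - #|A|)%:R.
  rewrite natrB ?(ltnW KltN) // -(ler_pM2l L0).
  have -> : L * (b * (N%:R - #|A|%:R)) = (N%:R - #|A|%:R) / (19 * 20 ^+ 2).
    transitivity (L * iv * (N%:R - #|A|%:R) / (19 * 20 ^+ 2)).
      by rewrite /b; field.
    by rewrite Liv mul1r.
  rewrite ler_pdivlMr ?mulr_gt0 ?exprn_gt0 //.
  have h1 : 20 * #|A|%:R <= N%:R :> R by rewrite -natrM ler_nat.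
  have := KSL; lra.
have q_iv : q.+1%:R * iv <= 22 / 10.
  by have := ler_wpM2r (ltW iv0) q3; rewrite -[_ * L * iv]mulrA Liv mulr1.
have c_eta : 9 * (b + q.+1%:R * mu ^+ 2) <= eta.
  have h : q.+1%:R * mu ^+ 2 <= 22 / 10 / (16 * 10) ^+ 2 * iv.
    apply: (@le_trans _ _ (q.+1%:R * (iv ^+ 2 / (16 * 10) ^+ 2))).
      by rewrite ler_wpM2l.
    rewrite (_ : q.+1%:R * (iv ^+ 2 / (16 * 10) ^+ 2) = q.+1%:R * iv / (16 * 10) ^+ 2 * iv).
      by rewrite ler_wpM2r ?(ltW iv0) // ler_wpM2r // invr_ge0 exprn_ge0.
    by field.
  apply: (@le_trans _ _ (9 * (b + 22 / 10 / (16 * 10) ^+ 2 * iv))).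
    by rewrite ler_wpM2l // lerD2l.
  rewrite (_ : 9 * (b + 22 / 10 / (16 * 10) ^+ 2 * iv) =
    (9 / (19 * 20 ^+ 2) + 9 * (22 / 10 / (16 * 10) ^+ 2)) * iv); last first.
    by rewrite /b; field.
  rewrite /eta [leRHS]mulrC ler_wpM2r ?(ltW iv0) //; lra.
have c_tau1 : 9 * (b + q.+1%:R) <= 20 * L.
  have : b <= 1 / 10.
    rewrite /b ler_pdivrMr ?mulr_gt0 ?exprn_gt0 //; lra.
  by have := L7; lra.
have c_tau : 9 * (b * (20 * L) + q.+1%:R * eta) <= (13 / 50) ^+ 2.
  have -> : b * (20 * L) = 20 * (L * iv) / (19 * 20 ^+ 2) by rewrite /b; field.
  have -> : q.+1%:R * eta = q.+1%:R * iv / (5 * 10 ^+ 2) by rewrite /eta; field.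
  rewrite Liv; move: q_iv; set w := _ * iv; lra.
have F1' i : normsq (col i F) = 1 by rewrite normsq_l2norm F1 expr1n rmorph1.
have F_coh i j : i != j -> `|(F ^t* *m F) i j| <= mu%:C%C.
  by move=> ij; rewrite normc_real_complex lecR worst_coherence_ge.
have B0 : 0 <= (S ^+ 2)%:C%C by rewrite ler0c sqr_ge0.
have c_frame' : #|A|%:R * (S ^+ 2)%:C%C <= b%:C%C * (N - #|A|)%:R.
  by rewrite -!(rmorph_nat (real_complex R)) -!rmorphM lecR.
have c_eta' : 9 * (b%:C%C + q.+1%:R * mu%:C%C ^+ 2) <= eta%:C%C.
  by rewrite -!(rmorph_nat (real_complex R)) -!(rmorphXn, rmorphM, rmorphD) lecR.
have c_tau1' : 9 * (b%:C%C + q.+1%:R) <= (20 * L)%:C%C.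
  by rewrite -!(rmorph_nat (real_complex R)) -!(rmorphM, rmorphD) lecR.
have c_tau' : 9 * (b%:C%C * (20 * L)%:C%C + q.+1%:R * eta%:C%C) <=
    (13 / 50)%:C%C ^+ 2.
  by rewrite -!(rmorph_nat (real_complex R)) -!(rmorphXn, rmorphM, rmorphD) lecR.
have Th0 : (0 < 200 * N)%N by rewrite muln_gt0 /= (ltnW N1).
have kp0 : 0 < (13 / 50)%:C%C :> R[i] by rewrite ltcR divr_gt0.
have mu0' : 0 <= mu%:C%C by rewrite ler0c.
have mu1' : mu%:C%C <= 1 by rewrite -(rmorph1 (real_complex R)) lecR.
have eta0' : 0 < eta%:C%C by rewrite ltcR.
have tau0' : 0 < (20 * L)%:C%C by rewrite ltcR mulr_gt0.
have [Bad [cB hB]] := hollow_gram_tail F1' F_coh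
  (fun w => normsq_adj_le w (ltW S0)) B0 KltN c_frame' mu0' mu1' eta0' tau0' kp0
  c_eta' c_tau1' c_tau' Th0.
exists Bad; split.
  exact: (count_of_moment MN (ltnW N1) N_large (pow9_ge (ltnW N1) (ltW q2)) cB).
move=> t u v tB uS vS.
apply: (@le_trans _ _ (54 / 100 * (l2norm u * l2norm v))); last first.
  by rewrite ler_wpM2r ?expRNhalf_ge // mulr_ge0 ?l2norm_ge0.
apply: (hollow_form_bilinear_bound (S := (t @: A)%SET)) => // u' v' u'S v'S.
have := hB t u' v' tB u'S v'S.
rewrite !normsq_l2norm -rmorphD normc_real_complex -/(hollow_form F u' v').
(* With [Theta = 200 * N] the trivial bound on bad splits costs 1 / 100, and 26 / 100 + 1 / 100 is
   half of 54 / 100. *)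
have -> : (13 / 50)%:C%C + 2 * N%:R / (200 * N)%:R = (54 / 100 / 2)%:C%C :> R[i].
  rewrite -!(rmorph_nat (real_complex R)) -fmorphV -!(rmorphM, rmorphD).
  congr _%:C%C; rewrite natrM; field.
  by rewrite pnatr_eq0 -lt0n ltnW.
by rewrite -rmorphM lecR.
Qed.

Let X := l2norm x0.

Let X0 : 0 < X.
Proof.
rewrite lt_neqAle l2norm_ge0 andbT; apply/eqP => X0.
have /card_gt0P[a] := K0; rewrite finset.inE => /eqP; apply.
by rewrite (l2norm_eq0 (esym X0)) mxE.
Qed.

Definition hollow_row n (j : 'I_N) : R[i] :=
  if j == n then 0 else (F ^t* *m F) n j.

Lemma hollow_row_le n j : normc (hollow_row n j) <= mu.
Proof.
rewrite /hollow_row; case: eqVneq => [_|jn]; first by rewrite normc0.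
by apply: worst_coherence_ge; rewrite eq_sym.
Qed.

Lemma sum_hollow_row n :
  normc (\sum_j hollow_row n j) <= (N%:R - 1) * (mu / Num.sqrt M%:R).
Proof.
have -> : \sum_j hollow_row n j = \sum_(j | j != n) (F ^t* *m F) n j.
  rewrite [RHS]big_mkcond; apply: eq_bigr => j _; rewrite /hollow_row.
  by case: eqVneq.
apply: le_trans (avg_coherence_ge F n N1) _; apply: ler_wpM2l => //.
by rewrite subr_ge0 ler1n ltnW.
Qed.

Lemma sum_normc_supp_le : \sum_(a in A) normc (x0 a 0) <= Num.sqrt #|A|%:R * X.
Proof.
have s0 : 0 <= \sum_(a in A) normc (x0 a 0).
  by apply: sumr_ge0 => a _; apply: normc_ge0.
rewrite -(@ler_pXn2r _ 2) ?nnegrE ?mulr_ge0 ?sqrtr_ge0 ?(ltW X0) //.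
rewrite exprMn sqr_sqrtr // /X l2norm_sqr.
have := sum_mul_sqr_le (fun a => (a \in A)%:R : R) (fun a => normc (x0 a 0)).
have -> : \sum_a ((a \in A)%:R : R) ^+ 2 = #|A|%:R.
  rewrite -sumr_const [RHS]big_mkcond; apply: eq_bigr => a _.
  by case: (a \in A); rewrite ?expr1n ?expr0n.
apply: le_trans; rewrite le_eqVlt; apply/orP; left; apply/eqP; congr (_ ^+ 2).
rewrite big_mkcond; apply: eq_bigr => a _.
by case: (a \in A); rewrite ?mul1r ?mul0r.
Qed.

(** Average coherence and [#|A| <= M] bound the mean: the factor sqrt #|A| from Cauchy-Schwarz is
    cancelled by 1 / sqrt M. The rate N^-2 leaves room for all rows and four directions [z]. *)
Lemma interference_tail n (z : R[i]) : normc z = 1 ->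
  exists Bad : {set {perm 'I_N}}, (#|Bad| * N ^ 2 <= N`!)%N /\
    forall t : {perm 'I_N}, t \notin Bad ->
      complex.Re (\sum_(a in A) z * x0 a 0 * hollow_row n (t a)) <=
      10 * mu * X * Num.sqrt L.
Proof.
(* Orthogonal columns are set apart because the exponent [theta] divides by [mu]. *)
move=> z1; have [mu00|mu00] := eqVneq mu 0.
  exists finset.set0; rewrite cards0; split => // t _.
  rewrite big1 => [|a _]; first by rewrite mu00 mulr0 !mul0r.
  rewrite (_ : hollow_row n (t a) = 0) ?mulr0 //; apply: eq0_normc.
  by apply/eqP; rewrite eq_le normc_ge0 andbT -mu00 hollow_row_le.
have mup : 0 < mu by rewrite lt_neqAle eq_sym mu00.
have cE a : normc (z * x0 a 0) = normc (x0 a 0) by rewrite normcM z1 mul1r.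
have mean : normc (\sum_j hollow_row n j) * (\sum_(a in A) normc (z * x0 a 0)) <=
    N%:R * (mu * X).
  under [X in _ * X <= _]eq_bigr do rewrite cE.
  have Mp : 0 < Num.sqrt M%:R :> R.
    by rewrite sqrtr_gt0; apply: lt_le_trans M_large; apply: lt_le_trans KR.
  apply: le_trans (ler_pM (normc_ge0 _) _ (sum_hollow_row n) sum_normc_supp_le) _.
    by apply: sumr_ge0 => a _; apply: normc_ge0.
  have -> : (N%:R - 1) * (mu / Num.sqrt M%:R) * (Num.sqrt #|A|%:R * X) =
    (N%:R - 1) * (mu * X) * (Num.sqrt #|A|%:R / Num.sqrt M%:R) by ring.
  have muX : 0 <= mu * X by rewrite mulr_ge0 // ltW.
  have r1 : Num.sqrt #|A|%:R / Num.sqrt M%:R <= 1 :> R.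
    by rewrite ler_pdivrMr // mul1r ler_wsqrtr.
  apply: (@le_trans _ _ ((N%:R - 1) * (mu * X))).
    by rewrite ler_piMr // mulr_ge0 // subr_ge0 ler1n ltnW.
  by rewrite ler_wpM2r // gerBl.
have energy : \sum_(a in A) normc (z * x0 a 0) ^+ 2 = X ^+ 2.
  rewrite /X l2norm_sqr big_mkcond; apply: eq_bigr => a _; rewrite cE.
  case: ifP => // /negbT; rewrite finset.inE negbK => /eqP ->.
  by rewrite normc0 expr0n.
exists [set t : {perm 'I_N} | 10 * mu * X * Num.sqrt L <
  complex.Re (\sum_(a in A) z * x0 a 0 * hollow_row n (t a))]%SET; split.
  rewrite -(ler_nat R) natrM natrX.
  have {1}<- : expR L = N%:R :> R by rewrite lnK // posrE ltr0n ltnW.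
  rewrite -expRM_natr [L * _]mulrC.
  exact: (perm_sum_tail mup X0 L7 K0 KN (hollow_row_le n) mean energy).
by move=> t; rewrite finset.inE -leNgt.
Qed.

(** The counting lemmas speak of images [t @: A], so they are applied with [t] the inverse of [s];
    inversion is a bijection and preserves counts. *)
Lemma supp_row_perm (s : {perm 'I_N}) :
  supp (row_perm s x0) = ((s^-1)%g @: A)%SET.
Proof.
apply/setP => i; rewrite finset.inE mxE -[i in RHS](permK s) mem_imset.
  by rewrite finset.inE.
exact: perm_inj.
Qed.

Lemma l2norm_row_perm (s : {perm 'I_N}) : l2norm (row_perm s x0) = X.
Proof.
congr Num.sqrt; rewrite [RHS](reindex_inj (@perm_inj _ s)).
by apply: eq_bigr => i _; rewrite mxE.
Qed.

Lemma interferenceE (s : {perm 'I_N}) n :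
  (F ^t* *m (F *m row_perm s x0)) n 0 - row_perm s x0 n 0 =
  \sum_(a in A) x0 a 0 * hollow_row n ((s^-1)%g a).
Proof.
rewrite mulmxA [(_ *m row_perm _ _) _ _]mxE (bigD1 n) //= gram_diag // mul1r.
rewrite addrAC subrr add0r.
rewrite [RHS]big_mkcond [LHS](reindex_inj (@perm_inj _ (s^-1)%g)).
rewrite [LHS]big_mkcond /=.
apply: eq_bigr => a _; rewrite [row_perm _ _ _ _]mxE permKV /hollow_row.
rewrite [in RHS]finset.inE.
case: eqVneq => [_|_] /=; first by rewrite mulr0; case: ifP.
by case: eqP => [->|_] /=; rewrite ?mulr0 // mulrC.
Qed.

Lemma good_perms_nonzero : exists Bad : {set {perm 'I_N}},
  (N * #|Bad| <= 5 * N`!)%N /\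
  forall s : {perm 'I_N}, s \notin Bad ->
    let x := row_perm s x0 in
    (forall n, normc ((F ^t* *m (F *m x)) n 0 - x n 0) <=
       10 * mu * l2norm x * Num.sqrt (2 * L)) /\
    (forall u v : 'cV[R[i]]_N,
       (forall i, i \notin supp x -> u i 0 = 0) ->
       (forall i, i \notin supp x -> v i 0 = 0) ->
       normc (hollow_form F u v) <= expR (- (1 / 2)) * (l2norm u * l2norm v)).
Proof.
have [Bc [cBc hBc]] := conditioning_tail.
have /fin_all_exists[BI hBI] : forall nk : 'I_N * 'I_4, exists Bad : {set {perm 'I_N}},
    (#|Bad| * N ^ 2 <= N`!)%N /\
    forall t : {perm 'I_N}, t \notin Bad ->
      complex.Re (\sum_(a in A) (0 +i* 1)%C ^+ nk.2 * x0 a 0 *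
        hollow_row nk.1 (t a)) <= 10 * mu * X * Num.sqrt L.
  by move=> nk; apply: interference_tail; apply: normc_dir.
(* One share of N! / N goes to conditioning and four to interference, from 4 N pairs of a row and a
   direction at N! / N^2 each. *)
pose Bt := (Bc :|: \bigcup_nk BI nk)%SET.
have cBt : (N * #|Bt| <= 5 * N`!)%N.
  have cU : (#|(\bigcup_nk BI nk)%SET| <= \sum_nk #|BI nk|)%N.
    elim/big_rec2: _ => [|i n D _ IH]; first by rewrite cards0.
    by apply: leq_trans (leq_card_setU _ _) _; rewrite leq_add2l.
  have cI : (N * \sum_nk #|BI nk| <= 4 * N`!)%N.
    have N0 : (0 < N)%N by apply: ltnW.
    rewrite -(leq_pmul2r N0) mulnAC -[(N * N)%N]/(N ^ 2)%N mulnC big_distrl /=.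
    apply: (@leq_trans (\sum_(nk : 'I_N * 'I_4) N`!)).
      by apply: leq_sum => nk _; have [] := hBI nk.
    by rewrite sum_nat_const card_prod !card_ord mulnAC mulnC mulnA mulnAC mulnC.
  apply: (@leq_trans (N * (#|Bc| + \sum_nk #|BI nk|))).
    rewrite leq_mul2l; apply/orP; right; apply: leq_trans (leq_card_setU _ _) _.
    by rewrite leq_add2l.
  rewrite mulnDr; apply: leq_trans (leq_add cBc cI) _.
  by rewrite -[X in (X + _)%N]mul1n -mulnDl.
exists ((fun s : {perm 'I_N} => (s^-1)%g) @: Bt)%SET; split.
  by rewrite card_imset //; apply: invg_inj.
move=> s sB x.
have tB : (s^-1)%g \notin Bt.
  apply: contra sB => tB; apply/imsetP; exists (s^-1)%g => //.
  by rewrite invgK.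
move: tB; rewrite finset.in_setU negb_or => /andP[tc tI]; split.
  move=> n; rewrite /x interferenceE l2norm_row_perm.
  rewrite sqrtrM // [leRHS](_ : _ = Num.sqrt 2 * (10 * mu * X * Num.sqrt L)).
    apply: normc_le_of_dirs => [|k].
      by rewrite !mulr_ge0 ?sqrtr_ge0 // ltW.
    have tnk : (s^-1)%g \notin BI (n, k).
      by apply: contra tI => tI; apply/bigcupP; exists (n, k).
    have [_ /(_ _ tnk)] := hBI (n, k); apply: le_trans.
    rewrite le_eqVlt; apply/orP; left; apply/eqP; congr complex.Re.
    by rewrite mulr_sumr; apply: eq_bigr => a _; rewrite mulrA.
  by ring.
move=> u v; rewrite /x supp_row_perm => uS vS.
exact: hBc tc uS vS.
Qed.

End GoodPermutations.

Lemma union_bound d (T : measurableType d) (R : realType) (P : probability T R)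
    (I : finType) (U : I -> set T) : (forall i, measurable (U i)) ->
  measurable [set w | exists i, U i w] /\
  (P [set w | exists i, U i w] <= \sum_i P (U i))%E.
Proof.
move=> mU; have -> : [set w | exists i, U i w] = \big[setU/set0]_i U i.
  apply/seteqP; split => w /=.
    by move=> [i Ui]; rewrite (bigD1 i) //=; left.
  elim/big_ind: _ => //= [X Y hX hY [/hX|/hY]//|i _ Ui]; by exists i.
have h (r : seq I) : measurable (\big[setU/set0]_(i <- r) U i) /\
    (P (\big[setU/set0]_(i <- r) U i) <= \sum_(i <- r) P (U i))%E.
  elim: r => [|i r [mr Pr]]; first by rewrite !big_nil measure0.
  rewrite !big_cons; split; first exact: measurableU.
  by apply: le_trans (measureU2 _ (mU i) mr) _; rewrite leeD2l.
exact: h.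
Qed.

(** At level [rho] each of the 4 N directions fails with probability at most e^(-2 log N), that is
    N^-2; passing from directions to the modulus costs sqrt 2. *)
Lemma noise_event d (T : measurableType d) (R : realType) (P : probability T R)
    (M N : nat) (F : 'M[R[i]]_(M, N)) (sigma : R) (e : T -> 'cV[R[i]]_M) :
  (forall i, l2norm (col i F) = 1) -> (1 < N)%N -> 0 < sigma ->
  gaussian_noise P sigma e ->
  exists B : set T, [/\ measurable B, (P B <= (4 / N%:R)%:E)%E &
    forall w, ~ B w -> forall n,
      normc ((F ^t* *m e w) n 0) <= 2 * sigma * Num.sqrt (ln N%:R)].
Proof.
move=> F1 N1 s0 he.
have L0 : 0 < ln (N%:R : R) by rewrite ln_gt0 // ltr1n.
have N0 : (0 < N%:R :> R) by rewrite ltr0n ltnW.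
pose rho := sigma * Num.sqrt (2 * ln N%:R).
have rho0 : 0 < rho by rewrite mulr_gt0 // sqrtr_gt0 mulr_gt0.
pose g (nk : 'I_N * 'I_4) m : R[i] := (0 +i* 1)%C ^+ nk.2 * (F ^t*) nk.1 m.
pose V nk w := \sum_m (complex.Re (g nk m) * (re_im (e w m 0)).1 +
  - complex.Im (g nk m) * (re_im (e w m 0)).2).
have VE nk w : V nk w = complex.Re ((0 +i* 1)%C ^+ nk.2 * (F ^t* *m e w) nk.1 0).
  rewrite [(_ *m e w) _ _]mxE mulr_sumr Re_sum; apply: eq_bigr => m _.
  by rewrite mulrA -/(g nk m) [RHS]Re_mul mulNr.
have g1 nk : \sum_m (complex.Re (g nk m) ^+ 2 + (- complex.Im (g nk m)) ^+ 2) = 1.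
  transitivity (l2norm (col nk.1 F) ^+ 2); last by rewrite F1 expr1n.
  rewrite l2norm_sqr; apply: eq_bigr => m _.
  by rewrite sqrrN -normc_sqr normcM normc_dir mul1r !mxE normc_conj.
pose U nk := [set w | rho < V nk w].
have mU nk : measurable (U nk).
  have mV : measurable_fun setT (V nk).
    apply: measurable_sum => m; apply: measurable_funD;
      apply: measurable_funM => //.
      exact: measurableT_comp measurable_fst (measurable_entry he m).
    exact: measurableT_comp measurable_snd (measurable_entry he m).
  rewrite -[U nk]setTI (_ : U nk = V nk @^-1` `]rho, +oo[).
    by apply: mV => //; exact: measurable_itv.
  by apply/seteqP; split => w; rewrite /U /= in_itv /= andbT.
have [mB PB] := union_bound P mU.
exists [set w | exists nk, U nk w]; split => //.
  apply: le_trans PB _.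
  apply: (@le_trans _ _ (\sum_(nk : 'I_N * 'I_4) (N%:R ^- 2)%:E)%E).
    apply: lee_sum => nk _; apply: le_trans (noise_tail s0 he rho0 (g1 nk)) _.
    rewrite lee_fin /rho exprMn sqr_sqrtr; last by rewrite mulr_ge0 // ltW.
    rewrite mulrAC divff ?gt_eqF ?exprn_gt0 // mul1r expRN.
    rewrite lef_pV2 ?posrE ?expR_gt0 ?exprn_gt0 //.
    by rewrite mulrC expRM_natr lnK.
  rewrite sumEFin lee_fin sumr_const card_prod !card_ord -[leLHS]mulr_natr natrM.
  rewrite le_eqVlt; apply/orP; left; apply/eqP; field.
  by rewrite gt_eqF.
move=> w Bw n; have -> : 2 * sigma * Num.sqrt (ln N%:R) = Num.sqrt 2 * rho.
  rewrite /rho sqrtrM // -[X in X * sigma](@sqr_sqrtr _ 2) //.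
  by move: (Num.sqrt 2) => r; ring.
apply: normc_le_of_dirs (ltW rho0) _ => k; rewrite -(VE (n, k)) leNgt.
by apply/negP => h; apply: Bw; exists (n, k).
Qed.

Lemma perm_event d (T : measurableType d) (R : realType) (P : probability T R)
    (N : nat) (p : T -> {perm 'I_N}) (Bad : {set {perm 'I_N}}) :
  uniform_perm P p ->
  measurable [set w | p w \in Bad] /\
  (P [set w | p w \in Bad] <= (#|Bad|%:R / N`!%:R)%:E)%E.
Proof.
move=> hp; pose U s := if s \in Bad then p @^-1` [set s] else set0.
have mU s : measurable (U s).
  by rewrite /U; case: ifP => _; [have [] := hp s | exact: measurable0].
have -> : [set w | p w \in Bad] = [set w | exists s, U s w].
  apply/seteqP; split => w /=; first by move=> pB; exists (p w); rewrite /U pB.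
  by move=> [s]; rewrite /U; case: ifP => // sB /= ->.
have [mB PB] := union_bound P mU; split=> //.
apply: le_trans PB _; rewrite le_eqVlt; apply/orP; left; apply/eqP.
rewrite (eq_bigr (fun s => (if s \in Bad then N`!%:R^-1 else 0 : R)%:E)).
  by rewrite sumEFin -big_mkcond sumr_const mulr_natl.
by move=> s _; rewrite /U; case: ifP => _; [have [] := hp s | rewrite measure0].
Qed.

Lemma good_perms (R : realType) (M N : nat) (F : 'M[R[i]]_(M, N))
    (x0 : 'cV[R[i]]_N) :
  unit_norm_frame F -> strong_coherence F -> (1 < N)%N ->
  #|supp x0|%:R <= N%:R / (ost_c1 R ^+ 2 * spectral_norm F ^+ 2 * ln N%:R) ->
  exists Bad : {set {perm 'I_N}},
  (N * #|Bad| <= 5 * N`!)%N /\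
  forall s : {perm 'I_N}, s \notin Bad ->
    let x := row_perm s x0 in
    (forall n, normc ((F ^t* *m (F *m x)) n 0 - x n 0) <=
       10 * worst_coherence F * l2norm x * Num.sqrt (2 * ln N%:R)) /\
    (forall u v : 'cV[R[i]]_N,
       (forall i, i \notin supp x -> u i 0 = 0) ->
       (forall i, i \notin supp x -> v i 0 = 0) ->
       normc (hollow_form F u v) <= expR (- (1 / 2)) * (l2norm u * l2norm v)).
Proof.
move=> [rF F1] [mu_le nu_le] N1 hK.
have MN : (M <= N)%N by rewrite -rF rank_leq_col.
(* A nonempty support is what forces N to be large; with an empty one [x0] vanishes and both bounds
   are trivial. *)
case: (posnP #|supp x0|) => [/eqP|K0]; last exact: good_perms_nonzero.
rewrite cards_eq0 => /eqP K0; exists finset.set0.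
rewrite cards0 muln0; split=> // s _ x.
have zero_of (u : 'cV[R[i]]_N) : (forall i, i \notin supp x0 -> u i 0 = 0) -> u = 0.
  by move=> h; apply/colP => i; rewrite mxE h // K0 finset.inE.
have x00 : x0 = 0.
  by apply: zero_of => i; rewrite finset.inE negbK => /eqP.
have -> : x = 0 by apply/colP => i; rewrite /x x00 !mxE.
have s0 : supp (0 : 'cV[R[i]]_N) = supp x0 by rewrite x00.
split=> [n|u v].
  rewrite !mulmx0 mxE subrr normc0 !mulr_ge0 ?sqrtr_ge0 //.
  exact: worst_coherence_ge0.
rewrite s0 => /zero_of -> /zero_of ->.
rewrite /hollow_form big1 => [|i _]; last first.
  by rewrite big1 // => j _; rewrite [X in _ * X]mxE mulr0.
by rewrite normc0 !mulr_ge0 ?l2norm_ge0 ?expR_ge0.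
Qed.
Theorem theorem15
  (R : realType) (d : measure_display) (T : measurableType d)
  (P : probability T R)
  (M N K : nat) (hN : (1 < N)%N)
  (F : 'M[R[i]]_(M, N))
  (hF : unit_norm_frame F) (hSCP : strong_coherence F)
  (t sigma : R) (ht0 : 0 < t) (ht1 : t < 1) (hsigma : 0 < sigma)
  (x0 : 'cV[R[i]]_N) (hx0 : #|supp x0| = K)
  (p : T -> {perm 'I_N}) (hp : uniform_perm P p)
  (e : T -> 'cV[R[i]]_M) (he : gaussian_noise P sigma e)
  (hpe : perm_noise_independent P p e)
  (hK : K%:R <= N%:R / (ost_c1 R ^+ 2 * spectral_norm F ^+ 2 * ln N%:R)) :
  exists E : set T,
    [/\ measurable E,
        ((1 - 10 / N%:R)%:E < P E)%E
      & forall w, E w ->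
        let x := row_perm (p w) x0 in
        let y := F *m x + e w in
        let lambda := ost_lambda F sigma t (snr P x e) in
        let Khat := ost_support F y lambda in
        let xhat := ost_estimate F y lambda in
        let S := T_sigma sigma t x :&: T_mu F t x in
        [/\ S \subset Khat,
            Khat \subset supp x,
            l2norm (x - xhat) <=
              ost_c2 R * Num.sqrt (sigma ^+ 2 * #|Khat|%:R * ln N%:R)
              + ost_c3 R * l2norm (restrict (supp x :\: Khat) x)
          & l2norm (x - xhat) <=
              ost_c2 R * Num.sqrt (sigma ^+ 2 * K%:R * ln N%:R)
              + ost_c3 R * l2norm (x - best_approx #|S| x)]].
Proof.
subst K; have [rF F1] := hF.
have N0 : (0 < N%:R :> R) by rewrite ltr0n ltnW.
have L0 : 0 <= ln (N%:R : R) by rewrite ln_ge0 // ler1n ltnW.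
have [Bad [cBad hBad]] := good_perms hF hSCP hN hK.
have [mB1 PB1] := perm_event Bad hp.
have [B2 [mB2 PB2 hB2]] := noise_event F1 hN hsigma he.
pose B := [set w | p w \in Bad] `|` B2.
have mB : measurable B by apply: measurableU.
(* Five from the permutation and four from the noise; 9 < 10 gives the strict inequality. *)
have PB : (P B <= (9 / N%:R)%:E)%E.
  apply: le_trans (measureU2 _ mB1 mB2) _.
  apply: (@le_trans _ _ ((5 / N%:R)%:E + (4 / N%:R)%:E)%E).
    apply: leeD PB2; apply: le_trans PB1 _; rewrite lee_fin.
    rewrite ler_pdivlMr // mulrAC ler_pdivrMr ?ltr0n ?fact_gt0 //.
    by rewrite -!natrM ler_nat mulnC.
  by rewrite -EFinD lee_fin -mulrDl -natrD.
exists (~` B); split; first exact: measurableC.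
  rewrite probability_setC //; apply: (@lt_le_trans _ _ (1 - (9 / N%:R)%:E)%E).
    by rewrite -EFinB lte_fin ltrD2l ltrN2 ltr_pM2r ?invr_gt0 // ltr_nat.
  by rewrite leeB.
move=> w /not_orP[/negP pw /hB2 noise] x y lambda Khat xhat S.
have [interference conditioning] := hBad _ pw.
(* With no rows the columns could not have norm one; [M] must be nonzero to cancel against the noise
   energy in [snr_eq]. *)
have M0 : (0 < M)%N.
  rewrite lt0n; apply/eqP => M0; have := F1 (Ordinal (ltnW hN)).
  rewrite /l2norm big1 ?sqrtr0 => [/eqP|i]; first by rewrite eq_sym oner_eq0.
  by have := leq_trans (ltn_ord i) (eq_leq M0).
have snr_eq : M%:R * snr P x e = l2norm x ^+ 2 / sigma ^+ 2.
  rewrite /snr (noise_energy hsigma he) //=; field.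
  by rewrite gt_eqF //= pnatr_eq0 -lt0n.
have cx : #|supp x| = #|supp x0|.
  by rewrite supp_row_perm card_imset //; apply: perm_inj.
split.
- exact: (threshold_set_sub ht0 ht1 hsigma L0 snr_eq interference noise).
- exact: (ost_support_sub ht0 ht1 hsigma L0 snr_eq interference noise).
- exact: (ost_error F1 ht0 ht1 hsigma L0 snr_eq interference noise conditioning).
- rewrite -cx.
  exact: (ost_error_best_approx F1 ht0 ht1 hsigma L0 snr_eq interference noise
    conditioning).
Qed.
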